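(* Let $Q = (\mathcal{I}, E)$ be a quiver, $\mathbf{v} \in \mathbb{Z}^{\mathcal{I}}_{\geq 0}$ a dimension vector, and $\alpha$ a central parameter. Let $\mathbf{v}^*$ be a Harder-Narasimhan type and $*$ a fixed filtration of type $\mathbf{v}^*$. Suppose $A \in \mathrm{Rep}(Q, \mathbf{v})_{*,\mathbf{v}^*}$ is a critical point of $\|\Phi - \alpha\|^2$. The (complex) codimension of the Harder-Narasimhan stratum $\mathrm{Rep}(Q, \mathbf{v})_{\mathbf{v}^*}$ in $\mathrm{Rep}(Q, \mathbf{v})$, locally near $A$, is $$d(Q, \mathbf{v}, \mathbf{v}^* ) := \dim_{\mathbb{C}} \mathrm{Rep}(Q, \mathbf{v})_*^{LT} - \dim_{\mathbb{C}} (\mathfrak{g}_{\mathbb{C}})_*^{LT}.$$ In particular, the codimension is independent of the choice of $A$ in the set $C_{\mathbf{v}^*}$ of critical points of type $\mathbf{v}^*$.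
   Context: A quiver $Q=(\mathcal{I},E)$ is a finite oriented graph; $\mathrm{out}(a),\mathrm{in}(a)$ are the tail and head of $a\in E$. $V_\ell$ are hermitian vector spaces with $\dim_{\mathbb{C}}V_\ell=v_\ell$; $\mathrm{Rep}(Q,\mathbf{v})=\bigoplus_{a\in E}\mathrm{Hom}(V_{\mathrm{out}(a)},V_{\mathrm{in}(a)})$ with its standard hermitian structure; $\mathrm{Vect}(Q,\mathbf{v})=\bigoplus_\ell V_\ell$. $\mathfrak{g}=\prod_\ell\mathfrak{u}(V_\ell)$ with inner product $\mathrm{tr}(u^*v)$, $\mathfrak{g}_{\mathbb{C}}=\prod_\ell\mathfrak{gl}(V_\ell)$, and $\Phi(A)=\frac{i}{2}\sum_a[A_a,A_a^*]\in\mathfrak{g}$ is the moment map for the conjugation action of $G=\prod_\ell U(V_\ell)$. The central parameter $\alpha=(\alpha_\ell)\in(i\mathbb{R})^{\mathcal{I}}$ is identified with $(\alpha_\ell\,\mathrm{id}_{V_\ell})_\ell$ and satisfies $\sum_\ell\alpha_\ell v_\ell=0$. The slope of a nonzero dimension vector $\mathbf{w}$ is $\mu_\alpha(Q,\mathbf{w})=\left(\sum_\ell i\alpha_\ell w_\ell\right)/\left(\sum_\ell w_\ell\right)$. A subrepresentation is a collection of subspaces preserved by all $A_a$, with restricted maps. The Harder-Narasimhan filtration of $A$ is $0=A_0\subsetneq A_1\subsetneq\cdots\subsetneq A_L=A$ where each $A_j/A_{j-1}$ is the nonzero subrepresentation of $A/A_{j-1}$ of maximal slope and, among those, maximal rank;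 its type is $\mathbf{v}^*=(\mathbf{v}_1,\dots,\mathbf{v}_L)$, $\mathbf{v}_j$ being the dimension vector of $A_j/A_{j-1}$. $\mathrm{Rep}(Q,\mathbf{v})_{\mathbf{v}^*}$ is the set of representations of type $\mathbf{v}^*$, and $\mathrm{Rep}(Q,\mathbf{v})_{*,\mathbf{v}^*}$ its subset of representations preserving the fixed filtration $*$ of $\mathrm{Vect}(Q,\mathbf{v})$. $C_{\mathbf{v}^*}$ is the set of critical points of $\|\Phi-\alpha\|^2$ for which the dimension vectors of the eigenspaces of $i(\Phi(A)-\alpha)$ in $\mathrm{Vect}(Q,\mathbf{v})$, ordered by decreasing $\alpha$-slope, form $\mathbf{v}^*$ (equivalently, critical points of Harder-Narasimhan type $\mathbf{v}^*$). With the orthogonal splitting $V_\ell=\bigoplus_{j=1}^LV_{\ell,j}$ associated to $*$ (the $p$-th step of $*$ being $\bigoplus_\ell\bigoplus_{j\le p}V_{\ell,j}$), $\mathrm{Rep}(Q,\mathbf{v})_*^{LT}=\bigoplus_a\bigoplus_{j<k}\mathrm{Hom}(V_{\mathrm{out}(a),j},V_{\mathrm{in}(a),k})$ and $(\mathfrak{g}_{\mathbb{C}})_*^{LT}=\bigoplus_\ell\bigoplus_{j<k}\mathrm{Hom}(V_{\ell,j},V_{\ell,k})$ (strictly block lower-triangular parts). *)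

(* Defs.v *)
From HB Require Import structures.
From mathcomp Require Import all_boot all_order all_algebra.
From mathcomp Require Import complex.
From mathcomp Require Import all_classical all_reals all_analysis.
Set Implicit Arguments.
Unset Strict Implicit.
Unset Printing Implicit Defensive.
Import Order.TTheory GRing.Theory Num.Theory.
Import numFieldNormedType.Exports.
Local Open Scope classical_set_scope.
Local Open Scope sesquilinear_scope.
Local Open Scope complex_scope.
Local Open Scope ring_scope.

(* The complex field R[i] as a numClosedFieldType; its topology is the one of
   numFieldNormedType, which is not inferred for the bare type R[i]. *)
Definition Cplx (R : realType) : numClosedFieldType := R[i].

Record quiver := Quiver {
  vertex : finType;
  arrow : finType;
  qout : arrow -> vertex;
  qin : arrow -> vertex }.

Definition dimvec (Q : quiver) := {ffun vertex Q -> nat}.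

Definition rank_dim (Q : quiver) (w : dimvec Q) : nat := (\sum_l w l)%N.

(* The hermitian space V_l is C^(v l), as column vectors with the standard
   hermitian form; prod_topology carries the product topology. *)
Definition Rep (R : realType) (Q : quiver) (v : dimvec Q) : Type :=
  prod_topology (fun a : arrow Q => 'M[Cplx R]_(v (qin a), v (qout a))).

Definition dimRep (Q : quiver) (v : dimvec Q) : nat :=
  (\sum_(a : arrow Q) v (qin a) * v (qout a))%N.

Definition central_parameter (R : realType) (Q : quiver) (v : dimvec Q)
    (alpha : vertex Q -> Cplx R) : Prop :=
  (forall l, complex.Re (alpha l) = 0) /\
  \sum_l alpha l * (v l)%:R = 0.

(* For alpha in (iR)^I the numbers 'i * alpha l are real, so that taking the
   real part only changes their type. *)
Definition slope (R : realType) (Q : quiver) (alpha : vertex Q -> Cplx R)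
    (w : dimvec Q) : R :=
  (\sum_l complex.Re ('i * alpha l) * (w l)%:R) / (rank_dim w)%:R.

Definition vect_index (Q : quiver) (v : dimvec Q) : finType :=
  {l : vertex Q & 'I_(v l)}.

Definition vect_dim (Q : quiver) (v : dimvec Q) : nat := #|vect_index v|.

(* The isometric inclusion of V_l as a summand of Vect(Q,v). *)
Definition vect_inj (R : realType) (Q : quiver) (v : dimvec Q)
    (l : vertex Q) : 'M[Cplx R]_(vect_dim v, v l) :=
  \matrix_(k, j)
    ((enum_val k : vect_index v) == Tagged (fun l' => 'I_(v l')) j)%:R.

Lemma vect_inj_isometry (R : realType) (Q : quiver) (v : dimvec Q)
    (l l' : vertex Q) (i : 'I_(v l)) (j : 'I_(v l')) :
  ((vect_inj R v l)^t* *m vect_inj R v l') i j =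
    (Tagged (fun m => 'I_(v m)) i == Tagged (fun m => 'I_(v m)) j)%:R.
Proof.
rewrite mxE (bigD1 (enum_rank (Tagged (fun m => 'I_(v m)) i))) //= !mxE.
rewrite !enum_rankK eqxx conjC1 mul1r big1 ?addr0 // => k ki.
rewrite !mxE; case: eqP => [ek|_]; last by rewrite conjC0 mul0r.
by case/eqP: ki; rewrite -ek enum_valK.
Qed.

Definition vect_arrow (R : realType) (Q : quiver) (v : dimvec Q)
    (A : Rep R v) (a : arrow Q) : 'M[Cplx R]_(vect_dim v) :=
  vect_inj R v (qin a) *m A a *m (vect_inj R v (qout a))^t*.

Definition moment_map (R : realType) (Q : quiver) (v : dimvec Q)
    (A : Rep R v) : 'M[Cplx R]_(vect_dim v) :=
  ('i / 2) *: \sum_(a : arrow Q)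
    (vect_arrow A a *m (vect_arrow A a)^t* -
     (vect_arrow A a)^t* *m vect_arrow A a).

Definition central_mx (R : realType) (Q : quiver) (v : dimvec Q)
    (alpha : vertex Q -> Cplx R) : 'M[Cplx R]_(vect_dim v) :=
  \sum_l alpha l *: (vect_inj R v l *m (vect_inj R v l)^t*).

Definition shifted_moment (R : realType) (Q : quiver) (v : dimvec Q)
    (alpha : vertex Q -> Cplx R) (A : Rep R v) : 'M[Cplx R]_(vect_dim v) :=
  moment_map A - central_mx v alpha.

Definition energy (R : realType) (Q : quiver) (v : dimvec Q)
    (alpha : vertex Q -> Cplx R) (A : Rep R v) : R :=
  complex.Re
    (\tr ((shifted_moment alpha A)^t* *m shifted_moment alpha A)).

(* The energy is a real polynomial in the real and imaginary parts of the
   entries of A, so its differential at A vanishes iff all its directional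
   derivatives at A do. *)
Definition critical_point (R : realType) (Q : quiver) (v : dimvec Q)
    (alpha : vertex Q -> Cplx R) (A : Rep R v) : Prop :=
  forall B : Rep R v,
    is_derive (0 : R) (1 : R)
      (fun t : R => energy alpha ((fun a => A a + (t%:C : Cplx R) *: B a) : Rep R v)) 0.

Definition grsub (R : realType) (Q : quiver) (v : dimvec Q) : Type :=
  forall l : vertex Q, {vspace 'cV[Cplx R]_(v l)}.

Definition grsub_le (R : realType) (Q : quiver) (v : dimvec Q)
    (U W : grsub R v) : Prop := forall l, (U l <= W l)%VS.

Definition subrep (R : realType) (Q : quiver) (v : dimvec Q)
    (A : Rep R v) (U : grsub R v) : Prop :=
  forall (a : arrow Q) (x : 'cV[Cplx R]_(v (qout a))),
    x \in U (qout a) -> A a *m x \in U (qin a).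

(* Dimension vector of W / U, for U contained in W. *)
Definition quo_dim (R : realType) (Q : quiver) (v : dimvec Q)
    (U W : grsub R v) : dimvec Q := [ffun l => (\dim (W l) - \dim (U l))%N].

(* A filtration of length L is given by its steps F 0, ..., F L; the values
   F p for p > L are irrelevant. *)
Definition filtration (R : realType) (Q : quiver) (v : dimvec Q) (L : nat)
    (F : nat -> grsub R v) : Prop :=
  [/\ forall l, F 0%N l = 0%VS,
      forall l, F L l = fullv
    & forall j, (j < L)%N -> grsub_le (F j) (F j.+1)].

Definition filtration_of_type (R : realType) (Q : quiver) (v : dimvec Q)
    (vs : seq (dimvec Q)) (F : nat -> grsub R v) : Prop :=
  filtration (size vs) F /\
  mkseq (fun j => quo_dim (F j) (F j.+1)) (size vs) = vs.

(* Subrepresentations of A / F j are the quotients U / F j with U a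
   subrepresentation of A containing F j. *)
Definition HN_filtration (R : realType) (Q : quiver) (v : dimvec Q)
    (alpha : vertex Q -> Cplx R) (A : Rep R v) (L : nat)
    (F : nat -> grsub R v) : Prop :=
  [/\ filtration L F,
      forall j, (j <= L)%N -> subrep A (F j)
    & forall j, (j < L)%N ->
        let w := quo_dim (F j) (F j.+1) in
        (0 < rank_dim w)%N /\
        forall U : grsub R v, subrep A U -> grsub_le (F j) U ->
          let u := quo_dim (F j) U in
          (0 < rank_dim u)%N ->
          slope alpha u <= slope alpha w /\
          (slope alpha u = slope alpha w -> (rank_dim u <= rank_dim w)%N)].

Definition HN_stratum (R : realType) (Q : quiver) (v : dimvec Q)
    (alpha : vertex Q -> Cplx R) (vs : seq (dimvec Q)) : set (Rep R v) :=
  [set A | exists F : nat -> grsub R v,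
     filtration_of_type vs F /\ HN_filtration alpha A (size vs) F].

Definition HN_stratum_preserving (R : realType) (Q : quiver) (v : dimvec Q)
    (alpha : vertex Q -> Cplx R) (vs : seq (dimvec Q))
    (F : nat -> grsub R v) : set (Rep R v) :=
  [set A | HN_stratum alpha vs A /\
     forall j, (j <= size vs)%N -> subrep A (F j)].

(* The component at the vertex l of the eigenspace of i (Phi(A) - alpha) in
   Vect(Q,v) for the eigenvalue z. *)
Definition moment_eigenspace (R : realType) (Q : quiver) (v : dimvec Q)
    (alpha : vertex Q -> Cplx R) (A : Rep R v) (z : Cplx R) : grsub R v :=
  fun l => lker (linfun (mulmx
    (('i *: shifted_moment alpha A - z%:M) *m vect_inj R v l))).

Lemma mem_moment_eigenspace (R : realType) (Q : quiver) (v : dimvec Q)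
    (alpha : vertex Q -> Cplx R) (A : Rep R v) (z : Cplx R) (l : vertex Q)
    (x : 'cV[Cplx R]_(v l)) :
  x \in moment_eigenspace alpha A z l <->
  'i *: shifted_moment alpha A *m (vect_inj R v l *m x) =
    z *: (vect_inj R v l *m x).
Proof.
rewrite memv_ker lfunE /= -mulmxA mulmxBl mul_scalar_mx subr_eq0.
by split=> /eqP.
Qed.

Definition eigen_dim (R : realType) (Q : quiver) (v : dimvec Q)
    (alpha : vertex Q -> Cplx R) (A : Rep R v) (z : Cplx R) : dimvec Q :=
  [ffun l => \dim (moment_eigenspace alpha A z l)].

Definition critical_set (R : realType) (Q : quiver) (v : dimvec Q)
    (alpha : vertex Q -> Cplx R) (vs : seq (dimvec Q)) : set (Rep R v) :=
  [set A | critical_point alpha A /\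
     exists zs : seq (Cplx R),
       [/\ uniq zs,
           forall z, (z \in zs) <-> (0 < rank_dim (eigen_dim alpha A z))%N,
           map (eigen_dim alpha A) zs = vs
         & sorted (fun w w' => slope alpha w' < slope alpha w) vs]].

Definition orthov (R : realType) (n : nat) (U : {vspace 'cV[Cplx R]_n}) :
    {vspace 'cV[Cplx R]_n} :=
  (\bigcap_(i < \dim U) lker (linfun (mulmx (((vbasis U)`_i)^t*))))%VS.

Lemma memv_orthov (R : realType) (n : nat) (U : {vspace 'cV[Cplx R]_n})
    (x : 'cV[Cplx R]_n) :
  x \in orthov U <-> (forall y, y \in U -> y^t* *m x = 0).
Proof.
split=> [/subv_bigcapP xU y yU|xU].
- rewrite (coord_vbasis yU) raddf_sum /= raddf_sum /= mulmx_suml big1 // => i _.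
  have := xU i isT; rewrite -memvE memv_ker lfunE /= => /eqP xi.
  by rewrite linearZ /= map_mxZ -scalemxAl xi scaler0.
- apply/subv_bigcapP => i _; rewrite -memvE memv_ker lfunE /=; apply/eqP/xU.
  by apply: vbasis_mem; rewrite mem_nth ?size_tuple.
Qed.

(* With steps numbered from 0, the summand V_(l,j+1) of the splitting: the
   orthogonal complement of F j in F j.+1. *)
Definition splitting (R : realType) (Q : quiver) (v : dimvec Q)
    (F : nat -> grsub R v) (j : nat) : grsub R v :=
  fun l => (F j.+1 l :&: orthov (F j l))%VS.

Definition dim_Hom (K : fieldType) (aT rT : vectType K) (U : {vspace aT})
    (W : {vspace rT}) : nat :=
  \dim {: 'Hom(subvs_of U, subvs_of W)}.

Definition dim_Rep_LT (R : realType) (Q : quiver) (v : dimvec Q) (L : nat)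
    (F : nat -> grsub R v) : nat :=
  (\sum_(a : arrow Q) \sum_(j < L) \sum_(k < L | j < k)
     dim_Hom (splitting F j (qout a)) (splitting F k (qin a)))%N.

Definition dim_g_LT (R : realType) (Q : quiver) (v : dimvec Q) (L : nat)
    (F : nat -> grsub R v) : nat :=
  (\sum_(l : vertex Q) \sum_(j < L) \sum_(k < L | j < k)
     dim_Hom (splitting F j l) (splitting F k l))%N.

Definition HN_codim (R : realType) (Q : quiver) (v : dimvec Q) (L : nat)
    (F : nat -> grsub R v) : int :=
  (dim_Rep_LT L F)%:Z - (dim_g_LT L F)%:Z.

(* Near A, the set S is a (locally closed, embedded) complex submanifold of
   complex dimension m: a relatively open neighbourhood of A in S is the
   homeomorphic image of an open subset of C^m under a holomorphic immersion
   psi. Here differentiability is over the field Cplx R. *)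
Definition complex_submanifold_at (R : realType) (Q : quiver) (v : dimvec Q)
    (S : set (Rep R v)) (A : Rep R v) (m : nat) : Prop :=
  exists (D : set 'rV[Cplx R]_m) (U : set (Rep R v))
         (psi : 'rV[Cplx R]_m -> Rep R v) (chi : Rep R v -> 'rV[Cplx R]_m),
    [/\ [/\ open D, open U & (S `&` U) A],
        forall x, D x -> forall a, differentiable (fun y => psi y a) x,
        forall x, D x -> forall h,
          (forall a, 'd (fun y => psi y a) x h = 0) -> h = 0,
        psi @` D = S `&` U
      & (forall x, D x -> chi (psi x) = x) /\
        {within S `&` U, continuous chi}].

Definition complex_codim_at (R : realType) (Q : quiver) (v : dimvec Q)
    (S : set (Rep R v)) (A : Rep R v) (d : int) : Prop :=
  exists m : nat, complex_submanifold_at S A m /\ d = (dimRep v)%:Z - m%:Z.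

(* Main.v *)
From HB Require Import structures.
Require Import Defs.
From mathcomp Require Import all_boot all_order all_algebra.
From mathcomp Require Import complex.
From mathcomp Require Import all_classical all_reals all_analysis.
From mathcomp Require Import ring lra zify.
Set Implicit Arguments.
Unset Strict Implicit.
Unset Printing Implicit Defensive.
Import Order.TTheory GRing.Theory Num.Theory.
Import numFieldNormedType.Exports.
Local Open Scope classical_set_scope.
Local Open Scope sesquilinear_scope.
Local Open Scope complex_scope.
Local Open Scope ring_scope.

(** Let A be a point of the stratum of type vs, with Harder-Narasimhan
    filtration F, and choose at each vertex a basis e l adapted to F, so that
    F becomes the standard flag of coordinate subspaces. Representations near
    A in the stratum are described by two parameters: a strictly block lower
    triangular matrix X l at each vertex, which moves the flag inside a big
    cell by the unipotent 1 + X l, and a representation B which preserves the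
    standard flag and has it as Harder-Narasimhan filtration. The chart is
    the transport psi (X, B) of B by the frame e (1 + X). It has dim g_LT
    coordinates for X and dim Rep - dim Rep_LT coordinates for B, which gives
    the codimension ([chart_dimE], [HN_codimE]).

    The chart is injective because the Harder-Narasimhan filtration is the
    only filtration of its dimensions by subrepresentations ([HN_unique]): it
    determines X, and then B is recovered by undoing the transport. It is an
    immersion because a tangent vector killed by its differential yields
    matrices Y l whose commutator with B preserves the standard flag. The
    slopes of the quotients strictly decrease, so there is no nonzero map from
    a step of the filtration to a later quotient, and Y preserves the flag
    itself ([HN_hom_vanish]); as Y is also the logarithmic derivative of 1 + X,
    it is zero ([chart_immersion]).

    Openness of the domain and of the cell, and continuity of the inverse of
    the chart, come from one compactness argument. Subspaces are encoded by
    their orthogonal projectors, which form a compact family; being a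
    subrepresentation is a closed condition on projectors and the dimension is
    locally constant on them, so a statement about all invariant subspaces, or
    all invariant flags, of A extends to the representations near A
    ([near_all_projectors], [open_chart_dom], [open_cell_open],
    [near_cell_frame]).

    It remains to see that a critical point A of type vs lies in the stratum.
    Put H = i (Phi A - alpha). In the direction of the commutators of H with
    the arrows the derivative of the energy is a negative multiple of the sum
    of their squared norms, so H commutes with A at a critical point
    ([critical_commute]) and its eigenspaces are subrepresentations. For a
    subrepresentation with orthogonal projector P, the degree is minus the
    trace of P H minus a nonnegative term, which vanishes when P commutes with
    A ([theta0_trace], [tr_invariant_ge0]). Hence the slope of an eigenspace is
    minus its eigenvalue, and the sums of eigenspaces taken by increasing
    eigenvalue satisfy the maximality of Harder-Narasimhan steps
    ([eflag_destab], [critical_in_stratum]). *)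

(** * Slopes, Harder-Narasimhan filtrations and change of basis *)

Definition mulv (K : fieldType) m n (M : 'M[K]_(m, n)) : 'Hom('cV[K]_n, 'cV[K]_m) :=
  linfun (mulmx M).

Lemma mulvE (K : fieldType) m n (M : 'M[K]_(m, n)) x : mulv M x = M *m x.
Proof. by rewrite lfunE. Qed.

Section HarderNarasimhan.
Variables (R : realType) (Q : quiver) (v : dimvec Q) (alpha : vertex Q -> Cplx R).
Local Notation K := (Cplx R).
Implicit Types (A : Rep R v) (U W : grsub R v) (F G : nat -> grsub R v).

Definition grsub_rank U : nat := (\sum_l \dim (U l))%N.

Definition weight l : R := complex.Re ('i * alpha l).

(** The slope condition made linear, as for stability of quiver
    representations in the sense of King: degree minus mu times rank.
    Comparing the slope of W / U with mu amounts to comparing the values at W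
    and at U. *)
Definition theta (mu : R) U : R :=
  \sum_l (weight l - mu) * (\dim (U l))%:R.

Definition grsub_add U W : grsub R v := fun l => (U l + W l)%VS.
Definition grsub_cap U W : grsub R v := fun l => (U l :&: W l)%VS.

(** Modularity is what makes maximal destabilizing subrepresentations
    unique. *)
Lemma theta_modular mu U W :
  theta mu (grsub_add U W) + theta mu (grsub_cap U W) = theta mu U + theta mu W.
Proof.
rewrite /theta -!big_split /=; apply: eq_bigr => l _.
by rewrite -!mulrDr -!natrD /grsub_add /grsub_cap dimv_sum_cap.
Qed.

Lemma grsub_le_dim U W l : grsub_le U W -> (\dim (U l) <= \dim (W l))%N.
Proof. by move=> UW; apply: dimvS. Qed.

Lemma grsub_rank_le U W : grsub_le U W -> (grsub_rank U <= grsub_rank W)%N.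
Proof. by move=> UW; apply: leq_sum => l _; apply: grsub_le_dim. Qed.

Lemma grsub_rank_eq U W : grsub_le U W -> (grsub_rank W <= grsub_rank U)%N -> forall l, U l = W l.
Proof.
move=> UW le l; apply/eqP; rewrite eqEdim UW /=.
rewrite leqNgt; apply/negP => lt; move: le; rewrite leqNgt => /negP; apply.
rewrite /grsub_rank (bigD1 l) //= [X in (_ < X)%N](bigD1 l) //= -addSn leq_add //.
by apply: leq_sum => k _; apply: grsub_le_dim.
Qed.

Lemma theta_eq_dim mu U W : (forall l, \dim (U l) = \dim (W l)) ->
  theta mu U = theta mu W.
Proof. by move=> UW; apply: eq_bigr => l _; rewrite UW. Qed.

Lemma grsub_rank_eq_dim U W : (forall l, \dim (U l) = \dim (W l)) -> grsub_rank U = grsub_rank W.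
Proof. by move=> UW; apply: eq_bigr => l _; rewrite UW. Qed.

Lemma theta_mu mu mu' U : theta mu U = theta mu' U + (mu' - mu) * (grsub_rank U)%:R.
Proof.
rewrite /theta /grsub_rank natr_sum mulr_sumr -big_split /=; apply: eq_bigr => l _.
by rewrite -mulrDl; congr (_ * _); ring.
Qed.

Lemma rank_quo U W : grsub_le U W ->
  rank_dim (quo_dim U W) = (grsub_rank W - grsub_rank U)%N.
Proof.
move=> UW; rewrite /rank_dim /grsub_rank -sumnB => [|l _]; last exact: grsub_le_dim.
by apply: eq_bigr => l _; rewrite ffunE.
Qed.

Lemma deg_quo U W : grsub_le U W ->
  \sum_l weight l * (quo_dim U W l)%:R = theta 0 W - theta 0 U.
Proof.
move=> UW; rewrite /theta -sumrB; apply: eq_bigr => l _.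
by rewrite ffunE natrB ?grsub_le_dim // mulrBr !subr0.
Qed.

Lemma theta_slope mu U W : grsub_le U W -> (grsub_rank U < grsub_rank W)%N ->
  theta mu W - theta mu U =
    (slope alpha (quo_dim U W) - mu) * (grsub_rank W - grsub_rank U)%:R.
Proof.
move=> UW lt; rewrite /slope (deg_quo UW) rank_quo //.
rewrite mulrBl divfK; last by rewrite pnatr_eq0 -lt0n subn_gt0.
rewrite !(theta_mu mu 0) natrB ?(ltnW lt) //; ring.
Qed.

(** The condition on a step W / U of a Harder-Narasimhan filtration, with its
    slope mu as a parameter: W maximizes theta mu among the subrepresentations
    that contain U, and has the largest rank among the maximizers. *)
Definition destab_max A (mu : R) U W : Prop :=
  [/\ (grsub_rank U < grsub_rank W)%N, theta mu W = theta mu U &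
    forall Z, subrep A Z -> grsub_le U Z ->
      theta mu Z <= theta mu U /\
      (theta mu Z = theta mu U -> (grsub_rank Z <= grsub_rank W)%N)].

Lemma destab_max_slope A mu U W : grsub_le U W -> destab_max A mu U W ->
  mu = slope alpha (quo_dim U W).
Proof.
move=> UW [lt e _]; have := theta_slope mu UW lt; rewrite e subrr.
move=> /esym/eqP; rewrite mulf_eq0 pnatr_eq0 subn_eq0 leqNgt lt orbF subr_eq0.
by move=> /eqP.
Qed.

(** The slope comparison leaves out the Z of the same rank as U; for these
    theta takes its value at U, so that the linear condition covers them
    too. *)
Lemma HN_stepP A U W : grsub_le U W ->
  (let w := quo_dim U W in
   (0 < rank_dim w)%N /\
   forall Z : grsub R v, subrep A Z -> grsub_le U Z ->
     let u := quo_dim U Z in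
     (0 < rank_dim u)%N ->
     slope alpha u <= slope alpha w /\
     (slope alpha u = slope alpha w -> (rank_dim u <= rank_dim w)%N))
  <-> destab_max A (slope alpha (quo_dim U W)) U W.
Proof.
move=> UW /=; rewrite rank_quo // subn_gt0; set mu := slope _ _; split.
  move=> [lt H]; split=> //.
    by apply/eqP; rewrite -subr_eq0 theta_slope // subrr mul0r.
  move=> Z sZ UZ; have [eq|ltZ] := leqP (grsub_rank Z) (grsub_rank U).
    rewrite (@theta_eq_dim _ Z U); last by move=> l; rewrite (grsub_rank_eq UZ eq).
    by split=> // _; apply: leq_trans eq (ltnW lt).
  have [] := H Z sZ UZ; rewrite rank_quo // ?subn_gt0 // => le eq.
  have e := theta_slope mu UZ ltZ.
  have p : (0 : R) < (grsub_rank Z - grsub_rank U)%:R by rewrite ltr0n subn_gt0.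
  split; first by rewrite -subr_le0 e pmulr_lle0 // subr_le0.
  move=> /eqP; rewrite -subr_eq0 e mulf_eq0 (gt_eqF p) orbF subr_eq0 => /eqP.
  by move=> /eq le2; have := grsub_rank_le UZ; have := grsub_rank_le UW; lia.
move=> [lt tW H]; split=> // Z sZ UZ; rewrite rank_quo // subn_gt0 => ltZ.
have [le eq] := H Z sZ UZ; have e := theta_slope mu UZ ltZ.
have p : (0 : R) < (grsub_rank Z - grsub_rank U)%:R by rewrite ltr0n subn_gt0.
split; first by rewrite -subr_le0 -(pmulr_lle0 _ p) -e subr_le0.
move=> s; apply: leq_sub2r; apply: eq; apply/eqP; rewrite -subr_eq0 e s.
by rewrite subrr mul0r.
Qed.

Lemma HN_filtrationP A L F : HN_filtration alpha A L F <->
  [/\ filtration L F, forall j, (j <= L)%N -> subrep A (F j) &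
      forall j, (j < L)%N ->
        destab_max A (slope alpha (quo_dim (F j) (F j.+1))) (F j) (F j.+1)].
Proof.
split=> [] [f s H]; split=> // j jL; have [_ _ fj] := f;
  by have := H j jL; have := HN_stepP A (fj _ jL) => -[].
Qed.

Lemma filtration_le L F p q : filtration L F -> (p <= q <= L)%N ->
  grsub_le (F p) (F q).
Proof.
move=> [_ _ f] /andP[]; elim: q => [|q IH].
  by rewrite leqn0 => /eqP-> _ l; apply: subvv.
rewrite leq_eqVlt => /orP[/eqP-> _ l|]; first exact: subvv.
rewrite ltnS => pq qL l; apply: subv_trans (f q qL l).
by apply: IH => //; apply: ltnW.
Qed.

Lemma subrep_add A U W : subrep A U -> subrep A W -> subrep A (grsub_add U W).
Proof.
move=> sU sW a x /memv_addP[y yU [z zW ->]]; rewrite mulmxDr.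
by apply: memv_add; [apply: sU|apply: sW].
Qed.

Lemma subrep_cap A U W : subrep A U -> subrep A W -> subrep A (grsub_cap U W).
Proof.
move=> sU sW a x; rewrite !memv_cap => /andP[xU xW].
by rewrite sU ?sW.
Qed.

(** By induction G p = F p. Then F p.+1 and G p.+1 have the same dimensions,
    so both maximize theta; by modularity so does their sum, whose rank cannot
    exceed that of F p.+1. As G is only required to be invariant, this
    identifies every limit of invariant flags of the right dimensions. *)
Lemma HN_unique A L F G : HN_filtration alpha A L F -> filtration L G ->
  (forall p, (p <= L)%N -> subrep A (G p)) ->
  (forall p l, (p <= L)%N -> \dim (G p l) = \dim (F p l)) ->
  forall p l, (p <= L)%N -> G p l = F p l.
Proof.
move=> /HN_filtrationP[fF sF hF] fG sG dG p + pL.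
elim: p pL => [|p IH] pL; first by case: fG fF => + _ _ [+ _ _] l => -> ->.
have {}IH l : G p l = F p l by apply: IH; apply: ltnW.
have FpS : grsub_le (F p) (F p.+1) by case: fF => _ _; apply.
have GpS : grsub_le (F p) (G p.+1).
  by move=> l; rewrite -IH; case: fG => _ _; apply.
have [lt eq max] := hF p pL; set mu := slope _ _ in eq max.
pose S := grsub_add (F p.+1) (G p.+1); pose C := grsub_cap (F p.+1) (G p.+1).
have sS : subrep A S by apply: subrep_add; [apply: sF|apply: sG].
have sC : subrep A C by apply: subrep_cap; [apply: sF|apply: sG].
have FS : grsub_le (F p.+1) S by move=> l; apply: addvSl.
have FpS' : grsub_le (F p) S by move=> l; apply: subv_trans (FpS l) (FS l).
have FpC : grsub_le (F p) C by move=> l; rewrite subv_cap FpS GpS.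
(* The intersection does not exceed the maximum, so by modularity the sum
   attains it. *)
have [leS eqS] := max S sS FpS'; have [leC _] := max C sC FpC.
have := theta_modular mu (F p.+1) (G p.+1); rewrite -/S -/C.
rewrite (@theta_eq_dim _ (G p.+1) (F p.+1)); last by move=> l; apply: dG.
rewrite eq => md.
have {}eqS : (grsub_rank S <= grsub_rank (F p.+1))%N.
  by apply: eqS; apply/eqP; rewrite eq_le leS /=; lra.
have SF := grsub_rank_eq FS eqS => l.
apply/eqP; rewrite eqEdim dG // leqnn andbT SF; exact: addvSr.
Qed.

(** If the slope of the next step were at least mu, the term F j.+2 would be a
    maximizer of theta mu above F j, of larger rank than F j.+1. *)
Lemma HN_slope_decr A L F j k : HN_filtration alpha A L F -> (j < k < L)%N ->
  slope alpha (quo_dim (F k) (F k.+1)) < slope alpha (quo_dim (F j) (F j.+1)).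
Proof.
move=> /HN_filtrationP[fF sF hF] /andP[jk kL].
have step i : (i.+1 < L)%N ->
    slope alpha (quo_dim (F i.+1) (F i.+2)) < slope alpha (quo_dim (F i) (F i.+1)).
  move=> iL; have iL' := ltnW iL; have [_ _ fS] := fF.
  have le2 := fS _ iL; have le1 := fS _ iL'.
  have [lt eq max] := hF i iL'; set mu := slope _ (quo_dim (F i) _) in eq max *.
  have [lt' _ _] := hF i.+1 iL.
  have [] := max (F i.+2) (sF _ iL) (fun l => subv_trans (le1 l) (le2 l)).
  rewrite leNgt => ng neq; have {neq ng} : theta mu (F i.+2) < theta mu (F i).
    rewrite lt_neqAle leNgt ng andbT; apply/eqP => /neq.
    by rewrite leqNgt lt'.
  rewrite -eq -subr_lt0 theta_slope // pmulr_llt0 ?subr_lt0 //.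
  by rewrite ltr0n subn_gt0.
elim: k jk kL => // k IH; rewrite ltnS leq_eqVlt => /orP[/eqP->|jk] kL.
  exact: step.
by apply: lt_trans (step _ kL) _; apply: IH => //; apply: ltnW.
Qed.

(** Rank-nullity for the map that f induces from U to the quotient by W. *)
Lemma dim_img_preim (V1 V2 : vectType K) (f : 'Hom(V1, V2))
    (U : {vspace V1}) (W : {vspace V2}) :
  (\dim (f @: U + W) + \dim (U :&: f @^-1: W) = \dim U + \dim W)%N.
Proof.
have := dimv_sum_cap (f @: U) W.
(* Rank-nullity is applied to f on U and on the preimage of W in U, which
   contains the kernel. *)
have -> : (f @: U :&: W)%VS = (f @: (U :&: f @^-1: W))%VS.
  apply/vspaceP => y; apply/idP/idP.
    rewrite memv_cap => /andP[/memv_imgP[x xU ->]] xW.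
    by apply: memv_img; rewrite memv_cap xU -memv_preim.
  move=> /memv_imgP[x]; rewrite memv_cap -memv_preim => /andP[xU xW] ->.
  by rewrite memv_cap xW memv_img.
have := limg_ker_dim f U; have := limg_ker_dim f (U :&: f @^-1: W).
have -> : (U :&: f @^-1: W :&: lker f)%VS = (U :&: lker f)%VS.
  rewrite -capvA; congr (_ :&: _)%VS; apply/vspaceP => x.
  rewrite memv_cap -memv_preim memv_ker; case: eqP => [->|]; last by rewrite andbF.
  by rewrite mem0v.
by lia.
Qed.

(** The map induced from F j.+1 / F j to F k.+1 / F k is a morphism. A nonzero
    image would be a quotient of the source, hence of slope at least that of
    the source, and a subobject of the target, hence of slope at most that of
    the target, which is smaller. *)
Lemma HN_hom_step A L F (f : forall l, 'M[K]_(v l)) j k :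
  HN_filtration alpha A L F -> (j < k < L)%N ->
  (forall l x, x \in F j l -> f l *m x \in F k l) ->
  (forall l x, x \in F j.+1 l -> f l *m x \in F k.+1 l) ->
  (forall a x, x \in F j.+1 (qout a) ->
     f (qin a) *m (A a *m x) - A a *m (f (qout a) *m x) \in F k (qin a)) ->
  forall l x, x \in F j.+1 l -> f l *m x \in F k l.
Proof.
move=> hn jkL f0 f1 fA; have mulr := HN_slope_decr hn jkL.
have /andP[jk kL] := jkL; have jL := ltn_trans jk kL.
have /HN_filtrationP[fF sF hF] := hn; have [_ _ fS] := fF.
pose Ke : grsub R v := fun l => (F j.+1 l :&: mulv (f l) @^-1: F k l)%VS.
pose Im : grsub R v := fun l => (mulv (f l) @: F j.+1 l + F k l)%VS.
have sKe : subrep A Ke.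
  move=> a x; rewrite !memv_cap -!memv_preim !mulvE => /andP[xF fx].
  rewrite (sF j.+1) //=.
  rewrite -[f _ *m (_ *m _)](subrK (A a *m (f (qout a) *m x))).
  by apply: memvD; [apply: fA|apply: (sF k) => //; apply: ltnW].
have sIm : subrep A Im.
  move=> a x /memv_addP[_ /memv_imgP[y yF ->] [z zF ->]]; rewrite mulvE mulmxDr.
  apply: memvD; last first.
    apply: (subvP (addvSr _ _)); apply: (sF k) => //; exact: ltnW.
  rewrite -[A a *m (_ *m _)](subKr (f (qin a) *m (A a *m y))).
  apply: memvB.
    apply: (subvP (addvSl _ _)); rewrite -mulvE; apply: memv_img.
    exact: (sF j.+1).
  by apply: (subvP (addvSr _ _)); apply: fA.
have [lj ej mj] := hF j jL; set muj := slope _ _ in ej mj mulr.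
have [lk ek mk] := hF k kL; set muk := slope _ _ in ek mk mulr.
have jKe : grsub_le (F j) Ke.
  move=> l; rewrite subv_cap fS //=; apply/subvP => x xF.
  by rewrite -memv_preim mulvE f0.
have [tK _] := mj Ke sKe jKe.
have kIm : grsub_le (F k) Im by move=> l; apply: addvSr.
have [tI _] := mk Im sIm kIm.
have eI mu : theta mu Im + theta mu Ke = theta mu (F j.+1) + theta mu (F k).
  rewrite /theta -!big_split /=; apply: eq_bigr => l _.
  by rewrite -!mulrDr -!natrD dim_img_preim.
have leI : (grsub_rank Im <= grsub_rank (F k))%N.
  rewrite leqNgt; apply/negP => ltI.
  have h : 0 <= theta muj Im - theta muj (F k) by have := eI muj; lra.
  move: h; rewrite (theta_slope _ kIm ltI) pmulr_lge0 ?ltr0n ?subn_gt0 // => h.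
  move: tI; rewrite -subr_le0 (theta_slope _ kIm ltI) pmulr_lle0; last first.
    by rewrite ltr0n subn_gt0.
  by move=> h'; lra.
move=> l x xF; rewrite (grsub_rank_eq kIm leI); apply: (subvP (addvSl _ _)).
by rewrite -mulvE; apply: memv_img.
Qed.

(** A family f whose commutator with A preserves the filtration preserves it
    too. The image of F q is pushed down from F L to F p, one step at a time,
    by the previous lemma, with an outer induction on q <= p. *)
Lemma HN_hom_vanish A L F (f : forall l, 'M[K]_(v l)) :
  HN_filtration alpha A L F ->
  (forall p a x, (p <= L)%N -> x \in F p (qout a) ->
     f (qin a) *m (A a *m x) - A a *m (f (qout a) *m x) \in F p (qin a)) ->
  forall p l x, (p <= L)%N -> x \in F p l -> f l *m x \in F p l.
Proof.
move=> hn fA p l x pL; have [fF _ _] := hn; have [F0 F1 _] := fF.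
suff H q r : (q <= p)%N -> (p <= r <= L)%N ->
    forall l x, x \in F q l -> f l *m x \in F r l.
  by apply: H; rewrite // leqnn.
elim: q r => [|q IH] r qp /andP[pr rL] {}l {}x.
  by rewrite F0 memv0 => /eqP->; rewrite mulmx0 mem0v.
have [s] : {s | s + r = L}%N by exists (L - r)%N; lia.
elim: s r pr rL l x => [|s IHs] r pr rL l x.
  by rewrite add0n => -> _; rewrite F1 memvf.
move=> e; apply: (@HN_hom_step A L F f q r hn _ _ _ _ l x).
- by lia.
- by move=> l' x'; apply: IH; lia.
- by move=> l' x'; apply: IHs; lia.
move=> a y yq; have qL : (q.+1 <= r <= L)%N by lia.
apply: (subvP (filtration_le fF qL _)); apply: fA => //; lia.
Qed.

Definition rep_conj (g : forall l, 'M[K]_(v l)) A : Rep R v :=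
  fun a => g (qin a) *m A a *m invmx (g (qout a)).

Definition grsub_img (g : forall l, 'M[K]_(v l)) U : grsub R v :=
  fun l => (mulv (g l) @: U l)%VS.

Lemma mem_grsub_img g U l x : g l \in unitmx ->
  (x \in grsub_img g U l) = (invmx (g l) *m x \in U l).
Proof.
move=> gu; apply/memv_imgP/idP => [[y yU ->]|xU].
  by rewrite mulvE mulKmx.
by exists (invmx (g l) *m x) => //; rewrite mulvE mulKVmx.
Qed.

Lemma dim_grsub_img g U l : g l \in unitmx -> \dim (grsub_img g U l) = \dim (U l).
Proof.
move=> gu; apply: limg_dim_eq.
have -> : lker (mulv (g l)) = 0%VS.
  apply/eqP; rewrite -subv0; apply/subvP => x; rewrite memv_ker mulvE memv0.
  by move=> /eqP gx; rewrite -(mulKmx gu x) gx mulmx0.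
by rewrite capv0.
Qed.

Lemma subrep_conj g A U : (forall l, g l \in unitmx) ->
  subrep (rep_conj g A) (grsub_img g U) <-> subrep A U.
Proof.
move=> gu; split=> [s a x xU|s a x].
  have := s a (g (qout a) *m x); rewrite !mem_grsub_img // mulKmx // => /(_ xU).
  by rewrite /rep_conj -!mulmxA !mulKmx.
by rewrite !mem_grsub_img // => xU; rewrite /rep_conj -!mulmxA !mulKmx //; apply: s.
Qed.

Lemma grsub_imgK g U : (forall l, g l \in unitmx) ->
  grsub_img g (grsub_img (fun l => invmx (g l)) U) = U.
Proof.
move=> gu; apply: functional_extensionality_dep => l; apply/vspaceP => x.
by rewrite !mem_grsub_img ?unitmx_inv // invmxK mulKVmx.
Qed.

Lemma grsub_img_le g U W : (forall l, g l \in unitmx) ->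
  grsub_le (grsub_img g U) (grsub_img g W) <-> grsub_le U W.
Proof.
move=> gu; split=> h l; last by apply: limgS; apply: h.
apply/subvP => x xU; have /subvP/(_ (g l *m x)) := h l.
by rewrite !mem_grsub_img // mulKmx //; apply.
Qed.

Lemma filtration_img g L F : (forall l, g l \in unitmx) ->
  filtration L F -> filtration L (fun p => grsub_img g (F p)).
Proof.
move=> gu [F0 F1 FS]; split.
- by move=> l; rewrite /grsub_img F0 limg0.
- move=> l; rewrite /grsub_img F1; apply/vspaceP => x.
  by rewrite [LHS](@mem_grsub_img g (fun=> fullv)) // !memvf.
- by move=> j jL; apply/grsub_img_le => //; apply: FS.
Qed.

Lemma HN_conj g A L F : (forall l, g l \in unitmx) ->
  HN_filtration alpha A L F ->
  HN_filtration alpha (rep_conj g A) L (fun p => grsub_img g (F p)).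
Proof.
move=> gu /HN_filtrationP[fF sF hF].
have dimg U l : \dim (grsub_img g U l) = \dim (U l) by apply: dim_grsub_img.
apply/HN_filtrationP; split.
- exact: filtration_img.
- by move=> j jL; apply/subrep_conj => //; apply: sF.
move=> j jL; have [lt eq max] := hF j jL.
have -> : quo_dim (grsub_img g (F j)) (grsub_img g (F j.+1)) = quo_dim (F j) (F j.+1).
  by apply/ffunP => l; rewrite !ffunE !dimg.
split.
- by rewrite !(grsub_rank_eq_dim (dimg _)).
- by rewrite !(theta_eq_dim _ (dimg _)).
move=> Z; rewrite -(grsub_imgK Z gu) => /subrep_conj sZ /grsub_img_le leZ.
rewrite !(grsub_rank_eq_dim (dimg _)) !(theta_eq_dim _ (dimg _)).
by apply: max; [apply: sZ|apply: leZ].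
Qed.

End HarderNarasimhan.

(** * Column spaces and orthogonal projectors *)

Section ColumnSpace.
Variable K : fieldType.

Definition colsp m n (M : 'M[K]_(m, n)) : {vspace 'cV[K]_m} := limg (mulv M).

Lemma colspP m n (M : 'M[K]_(m, n)) x :
  reflect (exists y, x = M *m y) (x \in colsp M).
Proof.
apply: (iffP memv_imgP) => [[y _ ->]|[y ->]]; first by exists y; rewrite mulvE.
by exists y; rewrite ?memvf ?mulvE.
Qed.

Lemma mem_colsp m n (M : 'M[K]_(m, n)) y : M *m y \in colsp M.
Proof. by apply/colspP; exists y. Qed.

Lemma unitmx_inj n (M : 'M[K]_n) :
  (forall x : 'cV_n, M *m x = 0 -> x = 0) -> M \in unitmx.
Proof.
move=> inj; rewrite -unitmx_tr -row_free_unit -kermx_eq0; apply/rowV0P => x.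
move=> /sub_kermxP xM; apply: trmx_inj; rewrite trmx0; apply: inj.
by rewrite -[M]trmxK -trmx_mul xM trmx0.
Qed.

Lemma colsp_sub m n p (M : 'M[K]_(m, n)) (N : 'M[K]_(m, p)) :
  (colsp M <= colsp N)%VS -> exists Z, M = N *m Z.
Proof.
move=> /subvP MN.
have h j : exists y, col j M = N *m y.
  by apply/colspP/MN; rewrite colE; apply: mem_colsp.
have [f fP] := fin_all_exists h.
exists (\matrix_(i, j) f j i 0); apply/matrixP => i j.
transitivity (col j M i 0); first by rewrite mxE.
by rewrite fP !mxE; apply: eq_bigr => k _; rewrite !mxE.
Qed.

Lemma colsp_mul m n p (M : 'M[K]_(m, n)) (N : 'M[K]_(n, p)) :
  (colsp (M *m N) <= colsp M)%VS.
Proof.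
by apply/subvP => _ /colspP[y ->]; rewrite -mulmxA mem_colsp.
Qed.

Lemma mem_colsp_idem n (P : 'M[K]_n) x : P *m P = P ->
  (x \in colsp P) = (P *m x == x).
Proof.
move=> PP; apply/colspP/eqP => [[y ->]|<-]; first by rewrite mulmxA PP.
by exists x.
Qed.

Lemma colsp_sub_idem m n (P : 'M[K]_m) (M : 'M[K]_(m, n)) : P *m P = P ->
  (colsp M <= colsp P)%VS -> P *m M = M.
Proof. by move=> PP /colsp_sub[Z ->]; rewrite mulmxA PP. Qed.

Definition basis_mx n (U : {vspace 'cV[K]_n}) : 'M[K]_(n, \dim U) :=
  \matrix_(i, j) (vbasis U)`_j i 0.

Lemma basis_mxE n (U : {vspace 'cV[K]_n}) y :
  basis_mx U *m y = \sum_j y j 0 *: (vbasis U)`_j.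
Proof.
apply/colP => i; rewrite mxE summxE; apply: eq_bigr => j _.
by rewrite !mxE mulrC.
Qed.

Lemma colsp_basis n (U : {vspace 'cV[K]_n}) : colsp (basis_mx U) = U.
Proof.
apply/vspaceP => x; apply/colspP/idP => [[y ->]|xU].
  rewrite basis_mxE memv_suml // => j _; apply: memvZ; apply: vbasis_mem.
  by rewrite mem_nth // size_tuple.
exists (\col_j coord (vbasis U) j x); rewrite basis_mxE {1}(coord_vbasis xU).
by apply: eq_bigr => j _; rewrite mxE.
Qed.

Lemma basis_mx_inj n (U : {vspace 'cV[K]_n}) m (y : 'M[K]_(\dim U, m)) :
  basis_mx U *m y = 0 -> y = 0.
Proof.
move=> e; apply/matrixP => j k; rewrite mxE.
have := basis_mxE (col k y); rewrite colE mulmxA e mul0mx => /esym.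
have /freeP/[apply] := basis_free (vbasisP U).
by move=> /(_ j); rewrite -colE mxE.
Qed.

Lemma dim_colsp_inj m n (M : 'M[K]_(m, n)) :
  (forall y : 'cV_n, M *m y = 0 -> y = 0) -> \dim (colsp M) = n.
Proof.
move=> inj; have := limg_ker_dim (mulv M) fullv.
have -> : lker (mulv M) = 0%VS.
  apply/eqP; rewrite -subv0; apply/subvP => x; rewrite memv_ker mulvE memv0.
  by move=> /eqP/inj->.
by rewrite capv0 dimv0 add0n dimvf /dim /= muln1 => ->.
Qed.

(** Write P = M N with the columns of M a basis of the image; then N M is the
    identity and the trace is cyclic. *)
Lemma tr_idem n (P : 'M[K]_n) : P *m P = P -> \tr P = (\dim (colsp P))%:R.
Proof.
move=> PP; set M := basis_mx (colsp P).
have PM : P *m M = M by apply: colsp_sub_idem; rewrite // colsp_basis.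
have [N PN] : exists N, P = M *m N by apply: colsp_sub; rewrite colsp_basis.
have NM : N *m M = 1%:M.
  apply/eqP; rewrite -subr_eq0; apply/eqP; apply: (basis_mx_inj (U := colsp P)).
  by rewrite mulmxBr mulmxA -PN -/M PM mulmx1 subrr.
by rewrite {1}PN mxtrace_mulC NM mxtrace1.
Qed.

End ColumnSpace.

Section OrthogonalProjector.
Variable C : numClosedFieldType.

Lemma ctrmx_mul m n p (M : 'M[C]_(m, n)) (N : 'M[C]_(n, p)) :
  (M *m N)^t* = N^t* *m M^t*.
Proof. by rewrite trmx_mul map_mxM. Qed.

Lemma tr_ctrmx_mul m n (M : 'M[C]_(m, n)) :
  \tr (M *m M^t*) = \sum_i \sum_j `|M i j| ^+ 2.
Proof.
apply: eq_bigr => i _; rewrite mxE; apply: eq_bigr => j _.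
by rewrite !mxE normCK.
Qed.

Lemma tr_ctrmx_ge0 m n (M : 'M[C]_(m, n)) : 0 <= \tr (M *m M^t*).
Proof.
rewrite tr_ctrmx_mul; apply: sumr_ge0 => i _; apply: sumr_ge0 => j _.
exact: exprn_ge0.
Qed.

Lemma tr_ctrmx_eq0 m n (M : 'M[C]_(m, n)) : \tr (M *m M^t*) = 0 -> M = 0.
Proof.
rewrite tr_ctrmx_mul => /eqP; rewrite psumr_eq0; last first.
  by move=> i _; apply: sumr_ge0 => j _; exact: exprn_ge0.
move=> /allP h; apply/matrixP => i j; rewrite mxE.
have := h i; rewrite mem_index_enum => /(_ isT); rewrite psumr_eq0; last first.
  by move=> k _; exact: exprn_ge0.
move=> /allP/(_ j); rewrite mem_index_enum => /(_ isT).
by rewrite expf_eq0 normr_eq0 => /andP[_ /eqP].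
Qed.

Lemma ctrmx_mul_eq0 m n (M : 'M[C]_(m, n)) : M^t* *m M = 0 -> M = 0.
Proof.
move=> e; rewrite -[M]trmxCK [M^t*](tr_ctrmx_eq0 (M := M^t*)) ?trmx0 ?map_mx0 //.
by rewrite trmxCK e mxtrace0.
Qed.

Definition orth_proj n (P : 'M[C]_n) : Prop := P^t* = P /\ P *m P = P.

(** The least-squares formula in terms of a basis of U, whose Gram matrix is
    invertible because the hermitian form is definite. *)
Lemma orth_proj_exists n (U : {vspace 'cV[C]_n}) :
  exists2 P, orth_proj P & colsp P = U.
Proof.
set M := basis_mx U; set G := M^t* *m M.
have Gu : G \in unitmx.
  apply: unitmx_inj => x Gx; apply: (basis_mx_inj (U := U)).
  apply: ctrmx_mul_eq0; rewrite ctrmx_mul -mulmxA (mulmxA _ _ x) -/G.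
  by rewrite Gx mulmx0.
have GC : G^t* = G by rewrite ctrmx_mul trmxCK.
have GiC : (invmx G)^t* = invmx G.
  by rewrite -[in RHS]GC trmx_inv map_invmx.
exists (M *m invmx G *m M^t*).
  split; first by rewrite !ctrmx_mul trmxCK GiC mulmxA.
  by rewrite -!mulmxA (mulmxA _ M) -/G mulKVmx.
apply: etrans (colsp_basis U); rewrite -/M; apply/vspaceP => x.
apply/colspP/colspP => [[y ->]|[y ->]].
  by exists (invmx G *m (M^t* *m y)); rewrite !mulmxA.
by exists (M *m y); rewrite -!mulmxA (mulmxA _ M) -/G mulKmx.
Qed.

(** The squared entries of row i add up to the i-th diagonal entry, which is
    therefore at most one. *)
Lemma orth_proj_entry n (P : 'M[C]_n) i j : orth_proj P -> `|P i j| <= 1.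
Proof.
move=> [PC PP].
have e : P i i = \sum_k `|P i k| ^+ 2.
  rewrite -{1}PP mxE; apply: eq_bigr => k _.
  by rewrite normCK -[in X in _ * X = _]PC !mxE.
have le k : `|P i k| ^+ 2 <= P i i.
  rewrite [leRHS]e (bigD1 k) //= lerDl; apply: sumr_ge0 => ? _; exact: exprn_ge0.
have p0 : 0 <= P i i by apply: le_trans (le i); exact: exprn_ge0.
have p1 : P i i <= 1.
  have := le i; rewrite ger0_norm //; move: p0; rewrite le_eqVlt.
  by move=> /orP[/eqP <- _|p0]; rewrite ?ler01 // expr2 -[leRHS]mul1r ler_pM2r.
by rewrite -(@expr_le1 _ 2) //; apply: le_trans (le j) p1.
Qed.

End OrthogonalProjector.

(** * Limits of matrices and compactness of projectors *)

Section MatrixLimits.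
Context {T : Type} {F : set_system T} {FF : Filter F}.

Lemma cvg_mxP (K : topologicalType) m n (f : T -> 'M[K]_(m, n))
    (M : 'M[K]_(m, n)) :
  (forall i j, f x i j @[x --> F] --> M i j) -> f x @[x --> F] --> M.
Proof.
move=> h A [P nP PA]; apply: (@filterS _ F _ [set x | forall i j, P i j (f x i j)]).
  by move=> x Px; apply: PA.
apply: filter_forall => i; apply: filter_forall => j.
exact: (h i j _ (nP i j)).
Qed.

Lemma cvg_prodP (I : eqType) (S : I -> topologicalType) (f : T -> prod_topology S)
    (l : prod_topology S) :
  (forall i, f x i @[x --> F] --> l i) -> f x @[x --> F] --> l.
Proof.
move=> h; apply/cvg_sup => i A [B [[C oC <-] /= Cl] CA].
apply: (filterS CA); have := h i C; apply.
by apply: open_nbhs_nbhs.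
Qed.

Lemma cvg_proj (I : eqType) (S : I -> topologicalType) (f : T -> prod_topology S)
    (l : prod_topology S) i :
  f x @[x --> F] --> l -> f x i @[x --> F] --> l i.
Proof.
move=> fl; apply: (@cvg_comp _ _ _ f (fun g : prod_topology S => g i) _ _ _ fl).
exact: proj_continuous.
Qed.

Variable K : numFieldType.

Lemma cvg_entry m n (f : T -> 'M[K]_(m, n)) (M : 'M[K]_(m, n)) i j :
  f x @[x --> F] --> M -> f x i j @[x --> F] --> M i j.
Proof.
move=> fM; apply: (@cvg_comp _ _ _ f (fun g : 'M[K]_(m, n) => g i j) _ _ _ fM).
exact: coord_continuous.
Qed.

Lemma cvg_sumr (I : Type) (r : seq I) (P : pred I) (f : I -> T -> K) (a : I -> K) :
  (forall i, P i -> f i x @[x --> F] --> a i) ->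
  \sum_(i <- r | P i) f i x @[x --> F] --> \sum_(i <- r | P i) a i.
Proof.
by move=> h; apply: cvg_big => //; exact: add_continuous.
Qed.

Lemma cvg_prodr (I : Type) (r : seq I) (P : pred I) (f : I -> T -> K) (a : I -> K) :
  (forall i, P i -> f i x @[x --> F] --> a i) ->
  \prod_(i <- r | P i) f i x @[x --> F] --> \prod_(i <- r | P i) a i.
Proof.
by move=> h; apply: cvg_big => //; exact: mul_continuous.
Qed.

Lemma cvg_mulmx m n p (f : T -> 'M[K]_(m, n)) (g : T -> 'M[K]_(n, p))
    (M : 'M[K]_(m, n)) (N : 'M[K]_(n, p)) :
  f x @[x --> F] --> M -> g x @[x --> F] --> N -> f x *m g x @[x --> F] --> M *m N.
Proof.
move=> fM gN; apply: cvg_mxP => i j; rewrite mxE.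
under eq_fun do rewrite mxE.
by apply: cvg_sumr => k _; apply: cvgM; apply: cvg_entry.
Qed.

Lemma cvg_mxtrace n (f : T -> 'M[K]_n) (M : 'M[K]_n) :
  f x @[x --> F] --> M -> \tr (f x) @[x --> F] --> \tr M.
Proof. by move=> fM; apply: cvg_sumr => i _; apply: cvg_entry. Qed.

Lemma cvg_det n (f : T -> 'M[K]_n) (M : 'M[K]_n) :
  f x @[x --> F] --> M -> \det (f x) @[x --> F] --> \det M.
Proof.
move=> fM; apply: cvg_sumr => s _; apply: cvgM; first exact: cvg_cst.
by apply: cvg_prodr => i _; apply: cvg_entry.
Qed.

Lemma cvg_adjugate n (f : T -> 'M[K]_n) (M : 'M[K]_n) :
  f x @[x --> F] --> M -> \adj (f x) @[x --> F] --> \adj M.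
Proof.
move=> fM; apply: cvg_mxP => i j; rewrite mxE.
under eq_fun do rewrite mxE.
apply: cvgM; first exact: cvg_cst.
apply: cvg_det; apply: cvg_mxP => k l; rewrite !mxE.
by under eq_fun do rewrite !mxE; apply: cvg_entry.
Qed.

Lemma near_unitmx n (f : T -> 'M[K]_n) (M : 'M[K]_n) :
  f x @[x --> F] --> M -> M \in unitmx -> \forall x \near F, f x \in unitmx.
Proof.
move=> fM; rewrite unitmxE unitfE => M0.
by apply: filterS (cvgr_neq0 _ (cvg_det fM) M0) => x; rewrite unitmxE unitfE.
Qed.

Lemma cvg_invmx n (f : T -> 'M[K]_n) (M : 'M[K]_n) :
  f x @[x --> F] --> M -> M \in unitmx -> invmx (f x) @[x --> F] --> invmx M.
Proof.
move=> fM Mu; have := near_unitmx fM Mu => fu.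
apply: (@cvg_trans _ (((\det (f x))^-1 *: \adj (f x)) @[x --> F])).
  apply: near_eq_cvg; apply: filterS fu => x fxu.
  by rewrite /invmx fxu.
rewrite /invmx Mu; apply: cvg_mxP => i j; rewrite mxE.
under eq_fun do rewrite mxE.
apply: cvgM; last by apply: cvg_entry; apply: cvg_adjugate.
apply: cvgV; last exact: cvg_det.
by move: Mu; rewrite unitmxE unitfE.
Qed.

Lemma near_mx_neq m n (f g : T -> 'M[K]_(m, n)) (M N : 'M[K]_(m, n)) :
  f x @[x --> F] --> M -> g x @[x --> F] --> N -> M <> N ->
  \forall x \near F, f x <> g x.
Proof.
move=> fM gN MN.
have [i [j ij]] : exists i j, M i j - N i j != 0.
  apply: contrapT => h; apply: MN; apply/matrixP => i j.
  by apply/eqP; rewrite -subr_eq0; apply/negP => /negP ij; apply: h; exists i, j.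
have h : \forall x \near F, f x i j - g x i j != 0.
  by apply: cvgr_neq0 ij; apply: cvgB; apply: cvg_entry.
by apply: filterS h => x + e; rewrite e subrr eqxx.
Qed.

End MatrixLimits.

Section ProjectorLimits.
Variable C : numClosedFieldType.

Lemma cvg_ctrmx (T : Type) (F : set_system T) (FF : Filter F) m n
    (f : T -> 'M[C]_(m, n)) (M : 'M[C]_(m, n)) :
  f x @[x --> F] --> M -> (f x)^t* @[x --> F] --> M^t*.
Proof.
move=> fM; apply: cvg_mxP => i j; rewrite !mxE.
under eq_fun do rewrite !mxE.
apply/cvgrPdist_lt => e e0; have h : \forall x \near F, `|M j i - f x j i| < e.
  by apply: cvgr_dist_lt => //; apply: cvg_entry.
by apply: filterS h => x; rewrite -rmorphB norm_conjC.
Qed.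

(** The rank of a projector is its trace, and two natural numbers at distance
    less than one are equal. *)
Lemma near_dim_colsp (T : Type) (F : set_system T) (FF : Filter F) n
    (f : T -> 'M[C]_n) (P : 'M[C]_n) :
  f x @[x --> F] --> P -> orth_proj P ->
  \forall x \near F, orth_proj (f x) -> \dim (colsp (f x)) = \dim (colsp P).
Proof.
move=> fP [_ PP]; have h : \forall x \near F, `|\tr P - \tr (f x)| < 1.
  by apply: cvgr_dist_lt => //; apply: cvg_mxtrace.
apply: filterS h => x + [_ fx]; rewrite !tr_idem //.
set a := \dim _; set b := \dim _ => lt.
have far (i j : nat) : (i < j)%N -> ~~ (`|(i%:R : C) - j%:R| < 1).
  move=> ij; apply/negP => /lt_geF; rewrite distrC -natrB 1?ltnW // normr_nat.
  by rewrite ler1n subn_gt0 ij.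
have [ab|ba|//] := ltngtP a b; first by have := far _ _ ab; rewrite lt.
by have := far _ _ ba; rewrite distrC lt.
Qed.

Lemma near_orth_proj (T : Type) (F : set_system T) (FF : Filter F) n
    (f : T -> 'M[C]_n) (P : 'M[C]_n) :
  f x @[x --> F] --> P -> ~ orth_proj P -> \forall x \near F, ~ orth_proj (f x).
Proof.
move=> fP; rewrite /orth_proj => /not_andP[h|h].
  have nf : \forall x \near F, (f x)^t* <> f x.
    by apply: near_mx_neq h => //; apply: cvg_ctrmx.
  by apply: filterS nf => x /[swap] -[].
have nf : \forall x \near F, f x *m f x <> f x.
  by apply: near_mx_neq h => //; apply: cvg_mulmx.
by apply: filterS nf => x /[swap] -[].
Qed.

End ProjectorLimits.

Lemma compact_mx (T : topologicalType) m n (A : set T) :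
  compact A -> compact [set M : 'M[T]_(m, n) | forall i j, A (M i j)].
Proof.
move=> cA; pose S : 'I_m * 'I_n -> topologicalType := fun=> T.
pose g (h : prod_topology S) : 'M[T]_(m, n) := \matrix_(i, j) h (i, j).
have cg : continuous g.
  move=> h; apply: (@cvg_mxP _ (nbhs h) (nbhs_filter h)) => i j; rewrite mxE.
  by under eq_fun do rewrite mxE; apply: (@cvg_proj _ (nbhs h) _ S id h).
have -> : [set M : 'M[T]_(m, n) | forall i j, A (M i j)] =
    g @` [set h : prod_topology S | forall ij, A (h ij)].
  apply/seteqP; split => [M AM|_ [h Ah <-] i j]; last by rewrite mxE; apply: Ah.
  exists (fun ij => M ij.1 ij.2); first by move=> ij; apply: AM.
  by apply/matrixP => i j; rewrite mxE.
apply: (@continuous_compact (prod_topology S)).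
  exact: continuous_subspaceT.
by apply: (@tychonoff _ S (fun=> A)).
Qed.

Section UnitDisc.
Variable R : realType.
Local Notation C := (Cplx R).

(** The complex numbers as the plane: the closed square is then compact as the
    image of a product of segments. *)
Definition cplx_of (p : R * R) : C := p.1%:C + ('i%C : C) * p.2%:C.

Lemma cvg_real_complex (x : R) : (y%:C : C) @[y --> x] --> (x%:C : C).
Proof.
apply/cvgrPdist_lt => e; rewrite ltcE /= => /andP[/eqP e0 ep].
near=> y; rewrite -rmorphB normc_def /= expr0n /= addr0 sqrtr_sqr ltcE /= -e0.
rewrite eqxx /=; near: y; apply: cvgr_dist_lt => //; exact: cvg_id.
Unshelve. all: by end_near. Qed.

Lemma unit_box_compact : compact (cplx_of @` (`[-1, 1] `*` `[-1, 1])).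
Proof.
apply: continuous_compact; last by apply: compact_setX; apply: segment_compact.
apply: continuous_subspaceT => -[x y]; rewrite /cplx_of.
apply: cvgD; first by apply: (@cvg_comp _ _ _ fst) (@cvg_real_complex x); exact: cvg_fst.
apply: cvgM; first exact: cvg_cst.
by apply: (@cvg_comp _ _ _ snd) (@cvg_real_complex y); exact: cvg_snd.
Qed.

Lemma norm_le1_box (z : C) : `|z| <= 1 -> (cplx_of @` (`[-1, 1] `*` `[-1, 1])) z.
Proof.
case: z => x y; rewrite normc_def lecE /= => /andP[_ le].
have sq : x ^+ 2 + y ^+ 2 <= 1.
  by rewrite -(@ler_sqrt _ _ 1) ?ler01 // sqrtr1.
exists (x, y); last by rewrite [RHS]complexE.
by rewrite /= !in_itv /=; split; apply/andP; split; nra.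
Qed.

End UnitDisc.

Section ProjectorsCompact.
Variables (R : realType) (I : finType) (n : I -> nat).
Local Notation C := (Cplx R).

Definition projfam := prod_topology (fun i : I => 'M[C]_(n i)).

(** The tube lemma for the compact set of families of orthogonal projectors.
    It turns a property of one family near P0 into a property of all families
    at once, hence of all subspaces or all flags. *)
Lemma near_all_projectors (T : Type) (F : set_system T) (G : T -> projfam -> Prop) :
  Filter F ->
  (forall P0 : projfam, (forall i, orth_proj (P0 i)) ->
    \forall P \near P0 & x \near F, (forall i, orth_proj (P i)) -> G x P) ->
  \forall x \near F, forall P : projfam, (forall i, orth_proj (P i)) -> G x P.
Proof.
move=> FF h.
pose B := cplx_of (R := R) @` (`[-1, 1] `*` `[-1, 1]).
pose K := [set P : projfam | forall i, [set M : 'M[C]_(n i) | forall j k, B (M j k)] (P i)].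
have cK : compact K.
  apply: (@tychonoff I (fun i : I => 'M[C]_(n i))
    (fun i => [set M | forall j k, B (M j k)])) => i.
  by apply: compact_mx; apply: unit_box_compact.
have := (compact_near_coveringP K).1 cK T F
  (fun x P => (forall i, orth_proj (P i)) -> G x P) FF.
have H P0 : K P0 -> \forall P \near P0 & x \near F, (forall i, orth_proj (P i)) -> G x P.
  move=> _; have [pP|] := pselect (forall i, orth_proj (P0 i)); first exact: h.
  (* Near a family which is not made of orthogonal projectors there is nothing
     to prove, the projectors being closed. *)
  move=> /existsNP[i nP].
  have : \forall P \near P0, ~ orth_proj (P i).
    apply: (@near_orth_proj _ _ (nbhs P0) _ _ (fun P : projfam => P i) (P0 i)) => //.
    exact: (@cvg_proj _ (nbhs P0) _ _ id P0).
  move=> nP'; exists ([set P | ~ orth_proj (P i)], setT) => /=.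
    by split=> //; apply: filterT.
  by move=> [P x] /= [nPi _] /(_ i).
move=> /(_ H); apply: filterS => x Gx P pP; apply: Gx => // i j k.
by apply: norm_le1_box; apply: orth_proj_entry.
Qed.

End ProjectorsCompact.

(** * Differentiability of matrix functions *)

Section MatrixDifferentials.
Variables (K : numFieldType) (V : normedModType K).
Implicit Types (x h : V).

Lemma differentiable_big (W : normedModType K) (I : Type) (r : seq I) (P : pred I)
    (f : I -> V -> W) x :
  (forall i, P i -> differentiable (f i) x) ->
  differentiable (fun y => \sum_(i <- r | P i) f i y) x.
Proof.
move=> df; elim: r => [|i r IH].
  have -> : (fun y => \sum_(i <- [::] | P i) f i y) = cst 0.
    by apply/funext => y; rewrite big_nil.
  exact: differentiable_cst.
under eq_fun do rewrite big_cons; case Pi: (P i) => //.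
by apply: differentiableD => //; apply: df.
Qed.

Lemma differentiable_bigprod (I : Type) (r : seq I) (P : pred I) (f : I -> V -> K) x :
  (forall i, P i -> differentiable (f i) x) ->
  differentiable (fun y => \prod_(i <- r | P i) f i y) x.
Proof.
move=> df; elim: r => [|i r IH].
  have -> : (fun y => \prod_(i <- [::] | P i) f i y) = cst 1.
    by apply/funext => y; rewrite big_nil.
  exact: differentiable_cst.
under eq_fun do rewrite big_cons; case Pi: (P i) => //.
by apply: differentiableM => //; apply: df.
Qed.

Lemma differentiable_mx m n (M : V -> 'M[K]_(m, n)) x :
  (forall i j, differentiable (fun y => M y i j) x) -> differentiable M x.
Proof.
move=> dM; have -> : M = fun y => \sum_i \sum_j M y i j *: delta_mx i j.
  by apply/funext => y; exact: matrix_sum_delta.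
apply: differentiable_big => i _; apply: differentiable_big => j _.
by apply: differentiableZl.
Qed.

Lemma differentiable_entry m n (M : V -> 'M[K]_(m, n)) i j x :
  differentiable M x -> differentiable (fun y => M y i j) x.
Proof.
move=> dM; apply: (@differentiable_comp _ _ _ _ M (fun N : 'M[K]_(m, n) => N i j)) => //.
exact: differentiable_coord.
Qed.

Lemma derive_entry m n (M : V -> 'M[K]_(m, n)) i j x h :
  differentiable M x -> 'D_h (fun y => M y i j) x = 'D_h M x i j.
Proof.
move=> dM; rewrite !deriveE //; last exact: differentiable_entry.
have lc : linear (fun N : 'M[K]_(m, n) => N i j) by move=> k A B; rewrite !mxE.
pose clM := GRing.isLinear.Build _ _ _ _ _ lc.
pose cL : {linear 'M[K]_(m, n) -> K} := HB.pack (fun N : 'M[K]_(m, n) => N i j) clM.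
have cc : continuous cL by exact: coord_continuous.
have := @diff_comp _ _ _ _ M cL x dM (@linear_differentiable _ _ _ cL _ cc).
by move=> /(congr1 (fun g : V -> K => g h)) /=; rewrite (diff_lin _ cc) => ->.
Qed.

Lemma differentiable_mulmx m n p (M : V -> 'M[K]_(m, n)) (N : V -> 'M[K]_(n, p)) x :
  differentiable M x -> differentiable N x -> differentiable (fun y => M y *m N y) x.
Proof.
move=> dM dN; apply: differentiable_mx => i j; under eq_fun do rewrite mxE.
apply: differentiable_big => k _.
by apply: differentiableM; apply: differentiable_entry.
Qed.

Lemma differentiable_det n (M : V -> 'M[K]_n) x :
  differentiable M x -> differentiable (fun y => \det (M y)) x.
Proof.
move=> dM; apply: differentiable_big => s _; apply: differentiableM.
  exact: differentiable_cst.
by apply: differentiable_bigprod => i _; apply: differentiable_entry.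
Qed.

Lemma differentiable_adjugate n (M : V -> 'M[K]_n) x :
  differentiable M x -> differentiable (fun y => \adj (M y)) x.
Proof.
move=> dM; apply: differentiable_mx => i j; under eq_fun do rewrite mxE.
apply: differentiableM; first exact: differentiable_cst.
apply: differentiable_det; apply: differentiable_mx => k l.
by under eq_fun do rewrite !mxE; apply: differentiable_entry.
Qed.

Lemma derive_mulmx m n p (M : V -> 'M[K]_(m, n)) (N : V -> 'M[K]_(n, p)) x h :
  differentiable M x -> differentiable N x ->
  'D_h (fun y => M y *m N y) x = 'D_h M x *m N x + M x *m 'D_h N x.
Proof.
move=> dM dN; apply/matrixP => i j; rewrite -derive_entry; last first.
  exact: differentiable_mulmx.
have dMe k : derivable (fun y => M y i k) x h.
  by apply: diff_derivable; apply: differentiable_entry.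
have dNe k : derivable (fun y => N y k j) x h.
  by apply: diff_derivable; apply: differentiable_entry.
have -> : (fun y => (M y *m N y) i j) =
    \sum_(k < n) ((fun y => M y i k) \* (fun y => N y k j)).
  by apply/funext => y; rewrite mxE fct_sumE.
rewrite derive_sum; last by move=> k; apply: derivableM.
rewrite !mxE -big_split /=; apply: eq_bigr => k _.
by rewrite deriveM // !derive_entry // addrC; congr (_ + _); apply: mulrC.
Qed.

End MatrixDifferentials.

(** * Bases adapted to a flag of subspaces *)

Section MatrixFlags.
Variable K : fieldType.

Lemma invmx_mulmx n (A B : 'M[K]_n) : A \in unitmx -> B \in unitmx ->
  invmx (A *m B) = invmx B *m invmx A.
Proof.
move=> Au Bu; have ABu : A *m B \in unitmx by rewrite unitmx_mul Au.
by rewrite -(mulKmx ABu (invmx B *m invmx A)) -mulmxA mulKVmx // mulmxV // mulmx1.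
Qed.

Lemma pid_mulE n m d (M : 'M[K]_(n, m)) i j :
  ((pid_mx d : 'M[K]_n) *m M) i j = if (i < d)%N then M i j else 0.
Proof.
rewrite mxE (bigD1 i) //= big1 => [|k ki]; rewrite !mxE ?eqxx ?addr0 /=.
  by case: ifP; rewrite ?mul1r ?mul0r.
by rewrite (negPf (_ : (i : nat) != k)) ?mul0r // eq_sym.
Qed.

Lemma mul_pidE n m d (M : 'M[K]_(m, n)) i j :
  (M *m (pid_mx d : 'M[K]_n)) i j = if (j < d)%N then M i j else 0.
Proof.
rewrite mxE (bigD1 j) //= big1 => [|k kj]; rewrite !mxE ?eqxx ?addr0 /=.
  by case: ifP; rewrite ?mulr1 ?mulr0.
by rewrite (negPf (_ : (k : nat) != j)) ?mulr0 // eq_sym.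
Qed.

Lemma mem_colsp_pid n d (e : 'M[K]_n) x : e \in unitmx ->
  (x \in colsp (e *m (pid_mx d : 'M[K]_n))) <->
  (forall i : 'I_n, (d <= i)%N -> (invmx e *m x) i 0 = 0).
Proof.
move=> eu; split=> [/colspP[y ->] i di|h].
  by rewrite -mulmxA mulKmx // pid_mulE ltnNge di.
apply/colspP; exists (invmx e *m x).
have -> : e *m pid_mx d *m (invmx e *m x) = e *m (invmx e *m x); last by rewrite mulKVmx.
rewrite -mulmxA; congr (_ *m _); apply/matrixP => i j; rewrite pid_mulE ord1.
by case: ltnP => // /h ->.
Qed.

Lemma colsp_mulmx n m p (e : 'M[K]_(p, n)) (M : 'M[K]_(n, m)) :
  colsp (e *m M) = (mulv e @: colsp M)%VS.
Proof.
apply/vspaceP => x; apply/colspP/memv_imgP => [[y ->]|[_ /colspP[y ->] ->]].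
  by exists (M *m y); rewrite ?mem_colsp // mulvE mulmxA.
by exists y; rewrite mulvE mulmxA.
Qed.

Lemma dim_colsp_unit n m (e : 'M[K]_n) (M : 'M[K]_(n, m)) : e \in unitmx ->
  \dim (colsp (e *m M)) = \dim (colsp M).
Proof.
move=> eu; rewrite colsp_mulmx; apply: limg_dim_eq.
have -> : lker (mulv e) = 0%VS; last by rewrite capv0.
apply/eqP; rewrite -subv0; apply/subvP => x; rewrite memv_ker mulvE memv0.
by move=> /eqP ex; rewrite -(mulKmx eu x) ex mulmx0.
Qed.

Lemma dim_colsp_pid n d : (d <= n)%N -> \dim (colsp (pid_mx d : 'M[K]_n)) = d.
Proof.
move=> dn; pose M : 'M[K]_(n, d) := pid_mx d.
have -> : colsp (pid_mx d : 'M[K]_n) = colsp M.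
  apply/eqP; rewrite eqEsubv; apply/andP; split.
    by rewrite -(@pid_mx_id _ n d n d (leqnn d)); apply: colsp_mul.
  by rewrite /M -(@pid_mx_id _ n n d d dn); apply: colsp_mul.
apply: dim_colsp_inj => y My; apply/colP => i; rewrite mxE.
have := congr1 (fun z : 'cV[K]_n => z (widen_ord dn i) 0) My; rewrite !mxE.
rewrite (bigD1 i) //= big1 => [|k ki]; rewrite !mxE /= ?eqxx ?ltn_ord ?mul1r ?addr0 //.
by rewrite (negPf (_ : (i : nat) != k)) ?mul0r // eq_sym.
Qed.

(** Concatenated bases of successive complements, so that each term of the
    flag is spanned by an initial segment of the list. *)
Fixpoint flag_basis n (f : nat -> {vspace 'cV[K]_n}) p : seq 'cV[K]_n :=
  if p is p'.+1 then flag_basis f p' ++ vbasis (f p'.+1 :\: f p') else vbasis (f 0%N).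

Lemma flag_basisP n L (f : nat -> {vspace 'cV[K]_n}) p :
  (forall j, (j < L)%N -> (f j <= f j.+1)%VS) -> (p <= L)%N ->
  free (flag_basis f p) /\ <<flag_basis f p>>%VS = f p.
Proof.
move=> fS; elim: p => [_|p IH pL] /=.
  by split; [exact: basis_free (vbasisP _)|exact: span_basis (vbasisP _)].
have [fs sp] := IH (ltnW pL); have sv := span_basis (vbasisP (f p.+1 :\: f p)).
split; last first.
  by rewrite span_cat sp sv addvC -{2}(addv_diff_cap (f p.+1) (f p)) (capv_idPr (fS _ pL)).
rewrite cat_free fs (basis_free (vbasisP _)) /=; apply/directv_addP.
by rewrite sp sv capvC capv_diff.
Qed.

Lemma flag_basis_take n (f : nat -> {vspace 'cV[K]_n}) p q : (q <= p)%N ->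
  take (size (flag_basis f q)) (flag_basis f p) = flag_basis f q.
Proof.
elim: p => [|p IH]; first by rewrite leqn0 => /eqP->; rewrite take_size.
rewrite leq_eqVlt => /orP[/eqP->|]; first by rewrite take_size.
rewrite ltnS => qp; have e := IH qp; rewrite /= takel_cat //.
by rewrite -e size_take_min geq_minr.
Qed.

Lemma adapted_basis n L (f : nat -> {vspace 'cV[K]_n}) : f L = fullv ->
  (forall j, (j < L)%N -> (f j <= f j.+1)%VS) ->
  exists2 e : 'M[K]_n, e \in unitmx &
    forall p, (p <= L)%N -> f p = colsp (e *m (pid_mx (\dim (f p)) : 'M[K]_n)).
Proof.
move=> fL fS; set s := flag_basis f L.
have szs p : (p <= L)%N -> size (flag_basis f p) = \dim (f p).
  by move=> /(flag_basisP fS)[+ <-]; rewrite /free => /eqP.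
have [fs _] := flag_basisP fS (leqnn L).
have sn : size s = n by rewrite szs // fL dimvf /dim /= muln1.
set e : 'M[K]_n := \matrix_(i, j) s`_j i 0.
have ee (y : 'cV[K]_n) : e *m y = \sum_(j < n) y j 0 *: s`_j.
  by apply/colP => i; rewrite mxE summxE; apply: eq_bigr => j _; rewrite !mxE mulrC.
exists e.
  apply: unitmx_inj => y; rewrite ee => e0; apply/colP => j; rewrite mxE.
  have st : size s == n by apply/eqP.
  have /freeP/(_ (fun j => y j 0) e0) := fs : free (Tuple st).
  exact.
move=> p pL; have [_ sp] := flag_basisP fS pL.
have ts : take (\dim (f p)) s = flag_basis f p by rewrite -szs // flag_basis_take.
apply/eqP; rewrite eqEsubv; apply/andP; split; last first.
  apply/subvP => _ /colspP[y ->]; rewrite -mulmxA ee memv_suml // => j _.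
  rewrite pid_mulE; case: ltnP => jd; last by rewrite scale0r mem0v.
  apply: memvZ; rewrite -sp -ts; apply: memv_span.
  by rewrite -(nth_take 0 jd) mem_nth // ts szs.
rewrite -{1}sp; apply/span_subvP => x /(nthP 0)[j]; rewrite szs // => jd <-.
have jn : (j < n)%N.
  by apply: leq_trans jd _; rewrite -[X in (_ <= X)%N]sn -szs // -ts size_take_min geq_minr.
apply/colspP; exists (delta_mx (Ordinal jn) 0).
rewrite -mulmxA ee (bigD1 (Ordinal jn)) //= big1 => [|k kj].
  by rewrite pid_mulE jd mxE !eqxx scale1r addr0 -ts nth_take.
by rewrite pid_mulE mxE (negPf kj) if_same scale0r.
Qed.

End MatrixFlags.

(** * Block triangular matrices and the big cell *)

Section Levels.
Variables (K : fieldType).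

(** Levels are block numbers: such a matrix is block upper triangular, that
    is, it preserves the flag of the coordinate subspaces spanned by the
    levels below p. *)
Definition level_par n n' (lv : 'I_n -> nat) (lv' : 'I_n' -> nat) (M : 'M[K]_(n', n)) :=
  forall i k, (lv k < lv' i)%N -> M i k = 0.

(** Strictly block lower triangular; 1 + X is then unipotent and moves the
    coordinate flag. *)
Definition level_low n (lv : 'I_n -> nat) (X : 'M[K]_n) :=
  forall i k, (lv i <= lv k)%N -> X i k = 0.

Lemma det_unip n (lv : 'I_n -> nat) (X : 'M[K]_n) :
  {homo lv : i j / (i <= j)%N} -> level_low lv X -> \det (1%:M + X) = 1.
Proof.
move=> mono low; rewrite det_trig.
  by rewrite big1 // => i _; rewrite !mxE eqxx low ?addr0.
apply/is_trig_mxP => i j ij; rewrite !mxE low ?addr0; last exact/mono/ltnW.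
by rewrite (negPf (_ : i != j)) // -val_eqE neq_ltn ij.
Qed.

Lemma unip_unit n (lv : 'I_n -> nat) (X : 'M[K]_n) :
  {homo lv : i j / (i <= j)%N} -> level_low lv X -> 1%:M + X \in unitmx.
Proof. by move=> mono low; rewrite unitmxE (det_unip mono low) unitr1. Qed.

(** The rows of Y vanish one after another, by induction on their level. With
    Y = (1 + X)^-1 (1 + Z) - 1 and X' = Z - X, this says that lower unipotent
    and block upper triangular matrices meet only in the identity. *)
Lemma low_par_eq0 n (lv : 'I_n -> nat) (X X' Y : 'M[K]_n) :
  level_low lv X -> level_low lv X' -> level_par lv lv Y ->
  (1%:M + X) *m Y = X' -> Y = 0.
Proof.
move=> lX lX' pY e; apply/matrixP => i k; rewrite mxE.
have [m] := ubnP (lv i); elim: m i k => // m IH i k im.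
have [ik|ki] := leqP (lv i) (lv k); last exact: pY.
have := congr1 (fun M : 'M[K]_n => M i k) e.
rewrite mulmxDl mul1mx mxE (lX' _ _ ik) mxE big1 ?addr0 // => j _.
have [ij|ji] := leqP (lv i) (lv j); first by rewrite lX // mul0r.
by rewrite IH ?mulr0 //; apply: leq_trans ji im.
Qed.

End Levels.

Section BigCell.
Variable C : numClosedFieldType.
Variables (n : nat).
Implicit Types (X T : 'M[C]_n).
Local Notation Id d := (pid_mx d : 'M[C]_n).

(** When T has rank d, its column space is a graph over the first d
    coordinates exactly when the upper left d x d block of the Gram matrix of
    the rows of T is invertible. That block is completed by an identity block
    to keep the size independent of d. *)
Definition cell_mx d T : 'M[C]_n := Id d *m (T *m T^t*) *m Id d + (1%:M - Id d).

(** The graph itself: the matrix with the column space of T whose first d rows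
    are those of the identity. Its entries are rational in those of T and
    their conjugates, hence continuous where cell_mx is invertible. *)
Definition cell_section d T : 'M[C]_n :=
  T *m T^t* *m Id d *m invmx (cell_mx d T) *m Id d.

Lemma pid_mx_idem d : Id d *m Id d = Id d.
Proof. by apply/matrixP => i j; rewrite pid_mulE !mxE; do 2!case: ltnP; rewrite // !andbF. Qed.

Lemma pid_mx_ctr d : (Id d)^t* = Id d.
Proof. by rewrite tr_pid_mx map_pid_mx. Qed.

(** A vector of the kernel is orthogonal to the first d columns of 1 + X, and
    lives on the first d coordinates; the corresponding block of 1 + X is
    unipotent, so the vector is zero. *)
Lemma cell_mx_unit (lv : 'I_n -> nat) d X T Z : {homo lv : i j / (i <= j)%N} ->
  level_low lv X -> (1%:M + X) *m Id d = T *m Z -> cell_mx d T \in unitmx.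
Proof.
move=> mono low e; apply: unitmx_inj => x Nx.
(* The identity block of cell_mx confines the kernel to the first d
   coordinates. *)
have x1 : x = Id d *m x.
  have JI : (1%:M - Id d) *m Id d = 0 by rewrite mulmxBl mul1mx pid_mx_idem subrr.
  have := congr1 (mulmx (1%:M - Id d)) Nx; rewrite mulmx0 mulmxA /cell_mx.
  rewrite mulmxDr !mulmxA JI !mul0mx add0r mulmxBr mulmx1 JI subr0 mulmxBl mul1mx.
  by move=> /eqP; rewrite subr_eq0 => /eqP.
have TT : Id d *m (T *m T^t*) *m x = 0.
  rewrite -[RHS]Nx /cell_mx mulmxDl -[_ *m Id d *m x]mulmxA -x1.
  by rewrite mulmxBl mul1mx -x1 subrr addr0.
(* The Gram form at x is the squared norm of the adjoint of T applied to x. *)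
have Tx : T^t* *m x = 0.
  apply: ctrmx_mul_eq0; rewrite ctrmx_mul trmxCK {1}x1 ctrmx_mul pid_mx_ctr.
  transitivity (x^t* *m (Id d *m (T *m T^t*) *m x)); first by rewrite !mulmxA.
  by rewrite TT mulmx0.
have IMx : Id d *m (1%:M + X)^t* *m x = 0.
  by rewrite -pid_mx_ctr -ctrmx_mul e ctrmx_mul -mulmxA Tx mulmx0.
pose X' := Id d *m X *m Id d.
have lowX' : level_low lv X'.
  by move=> i k ik; rewrite mul_pidE pid_mulE low // !if_same.
have u : (1%:M + X')^t* \in unitmx.
  by rewrite map_unitmx unitmx_tr; apply: unip_unit lowX'.
rewrite -(mulKmx u x) (_ : _ *m x = 0) ?mulmx0 //.
have -> : 1%:M + X' = Id d *m (1%:M + X) *m Id d + (1%:M - Id d).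
  by rewrite mulmxDr mulmx1 mulmxDl pid_mx_idem [RHS]addrC addrA subrK.
rewrite linearD /= map_mxD mulmxDl !ctrmx_mul pid_mx_ctr [Id d *m (_ *m _)]mulmxA.
rewrite -[X in X + _]mulmxA -x1 IMx add0r linearB /= map_mxB trmx1 map_mx1.
by rewrite pid_mx_ctr mulmxBl mul1mx -x1 subrr.
Qed.

Lemma cell_section_pid d T : cell_mx d T \in unitmx ->
  Id d *m cell_section d T = Id d.
Proof.
move=> Nu; have IN : Id d *m cell_mx d T = Id d *m (T *m T^t*) *m Id d.
  by rewrite mulmxDr !mulmxA pid_mx_idem mulmxBr mulmx1 pid_mx_idem subrr addr0.
by rewrite /cell_section !mulmxA -[Id d *m T *m _]mulmxA -IN mulmxK // pid_mx_idem.
Qed.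

Lemma colsp_cell_section d T : cell_mx d T \in unitmx -> (d <= n)%N ->
  \dim (colsp T) = d -> colsp (cell_section d T) = colsp T.
Proof.
move=> Nu dn dT; apply/eqP; rewrite eqEdim dT; apply/andP; split.
  by rewrite /cell_section -!mulmxA; apply: colsp_mul.
have e : \dim (colsp (Id d *m cell_section d T)) = d.
  by rewrite cell_section_pid // dim_colsp_pid.
rewrite -[X in (X <= _)%N]e colsp_mulmx.
by rewrite -[X in (_ <= X)%N](limg_ker_dim (mulv (Id d))) leq_addl.
Qed.

End BigCell.

(** * The standard flag of a given type *)

Section FiltrationTypes.
Variables (R : realType) (Q : quiver) (v : dimvec Q) (alpha : vertex Q -> Cplx R).
Local Notation K := (Cplx R).
Implicit Types (A : Rep R v) (U W : grsub R v) (F G : nat -> grsub R v).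

Lemma type_dims vs F G p l : filtration_of_type vs F -> filtration_of_type vs G ->
  (p <= size vs)%N -> \dim (F p l) = \dim (G p l).
Proof.
move=> [[F0 _ FS] eF] [[G0 _ GS] eG]; elim: p => [|p IH] pL; first by rewrite F0 G0.
have e : quo_dim (F p) (F p.+1) = quo_dim (G p) (G p.+1).
  have nF := nth_mkseq [ffun=> 0%N] (fun j => quo_dim (F j) (F j.+1)) pL.
  have nG := nth_mkseq [ffun=> 0%N] (fun j => quo_dim (G j) (G j.+1)) pL.
  by rewrite eF in nF; rewrite eG in nG; rewrite -nF -nG.
have := congr1 (fun w : dimvec Q => w l) e; rewrite !ffunE IH ?(ltnW pL) //.
have := grsub_le_dim l (FS _ pL); have := grsub_le_dim l (GS _ pL).
by rewrite IH ?(ltnW pL) //; lia.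
Qed.

Lemma same_dims_type vs F G : filtration_of_type vs F -> filtration (size vs) G ->
  (forall p l, (p <= size vs)%N -> \dim (G p l) = \dim (F p l)) ->
  filtration_of_type vs G.
Proof.
move=> [fF eF] fG dG; split=> //; rewrite -[RHS]eF; apply/eq_in_map => j.
rewrite mem_iota /= add0n => jL; apply/ffunP => l; rewrite !ffunE !dG //.
exact: ltnW.
Qed.

Lemma filtration_ext L F G : (forall p, (p <= L)%N -> F p = G p) ->
  filtration L F -> filtration L G.
Proof.
move=> FG [F0 F1 FS]; split=> [l|l|j jL]; rewrite -?FG //; last exact: ltnW.
exact: FS.
Qed.

Lemma HN_ext A L F G : (forall p, (p <= L)%N -> F p = G p) ->
  HN_filtration alpha A L F -> HN_filtration alpha A L G.
Proof.
move=> FG [fF sF hF]; split.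
- exact: filtration_ext fF.
- by move=> j jL; rewrite -FG //; apply: sF.
- by move=> j jL; rewrite -!FG ?(ltnW jL) //; apply: hF.
Qed.

Lemma rep_conjM (g h : forall l, 'M[K]_(v l)) A :
  (forall l, g l \in unitmx) -> (forall l, h l \in unitmx) ->
  rep_conj h (rep_conj g A) = rep_conj (fun l => h l *m g l) A.
Proof.
move=> gu hu; apply: functional_extensionality_dep => a.
by rewrite /rep_conj invmx_mulmx // !mulmxA.
Qed.

Lemma rep_conj1 A : rep_conj (fun l => 1%:M) A = A.
Proof.
by apply: functional_extensionality_dep => a; rewrite /rep_conj invmx1 mulmx1 mul1mx.
Qed.

Lemma grsub_img_colsp (g : forall l, 'M[K]_(v l)) (M : forall l, 'M[K]_(v l)) :
  grsub_img g (fun l => colsp (M l)) = fun l => colsp (g l *m M l).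
Proof.
by apply: functional_extensionality_dep => l; rewrite colsp_mulmx.
Qed.

End FiltrationTypes.

Lemma cancel_frames (K : fieldType) n m p (e g : 'M[K]_n) (g' : 'M[K]_n)
    (J : 'M[K]_(n, m)) (Z : 'M[K]_(m, p)) (J' : 'M[K]_(n, p)) :
  e \in unitmx -> g \in unitmx -> e *m g' *m J' = e *m g *m J *m Z ->
  invmx g *m g' *m J' = J *m Z.
Proof.
move=> eu gu h; rewrite -mulmxA -(mulKmx eu (g' *m J')) (mulmxA e) h.
by rewrite -!mulmxA (mulKmx eu) (mulKmx gu).
Qed.

Section StandardFlag.
Variables (R : realType) (Q : quiver) (v : dimvec Q) (alpha : vertex Q -> Cplx R).
Variables (L : nat) (F : nat -> grsub R v).
Hypothesis fF : filtration L F.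
Local Notation K := (Cplx R).

Definition fdim p l := \dim (F p l).
Local Notation d := fdim.

(** The block of the k-th coordinate, that is, the p with d p l <= k < d p.+1
    l. *)
Definition lev l (k : 'I_(v l)) : nat := (\sum_(j < L) (d j.+1 l <= k))%N.

Lemma fdim_le p l : (d p l <= v l)%N.
Proof. by have := dimvS (subvf (F p l)); rewrite dimvf /dim /= muln1. Qed.

Lemma fdim_mono p q l : (p <= q <= L)%N -> (d p l <= d q l)%N.
Proof. by move=> pq; apply: dimvS; apply: (filtration_le fF pq). Qed.

Lemma fdim0 l : d 0 l = 0%N.
Proof. by case: fF => F0 _ _; rewrite /d F0 dimv0. Qed.

Lemma fdimL l : d L l = v l.
Proof. by case: fF => _ FL _; rewrite /d FL dimvf /dim /= muln1. Qed.

Lemma lev_lt p l (k : 'I_(v l)) : (p <= L)%N -> (lev k < p)%N = (k < d p l)%N.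
Proof.
move=> pL; apply/idP/idP; last first.
  case: p pL => [|p] pL kd; first by move: kd; rewrite fdim0.
  rewrite ltnS /lev (bigID (fun j : 'I_L => (j < p)%N)) /= [X in (_ + X)%N]big1.
    apply: (@leq_trans (\sum_(j < L | (j < p)%N) 1)).
      by rewrite addn0; apply: leq_sum => j _; exact: leq_b1.
    by rewrite -(big_ord_widen _ (fun=> 1%N) (ltnW pL)) sum1_card card_ord.
  move=> j; rewrite -leqNgt => pj; rewrite leqNgt (leq_trans kd) //.
  by apply: fdim_mono; rewrite ltnS pj /=.
apply: contraTT; rewrite -!leqNgt => dk.
have : (\sum_(j < p) 1 <= lev k)%N; last by rewrite sum1_card card_ord.
rewrite /lev (big_ord_widen _ (fun=> 1%N) pL) big_mkcond /=; apply: leq_sum => j _.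
case: ifP => // jp; rewrite (leq_trans _ dk) //; apply: fdim_mono.
by rewrite jp.
Qed.

Lemma lev_ltL l (k : 'I_(v l)) : (lev k < L)%N.
Proof. by rewrite lev_lt // fdimL. Qed.

Lemma lev_mono l : {homo @lev l : i j / (i <= j)%N}.
Proof.
move=> i j ij; apply: leq_sum => k _.
by case di: (d k.+1 l <= i)%N => //; rewrite (leq_trans di ij).
Qed.

Local Notation Id p l := (pid_mx (d p l) : 'M[K]_(v l)).
Definition stdflag p : grsub R v := fun l => colsp (Id p l).
Local Notation E := stdflag.

Lemma mem_stdflag p l x : (p <= L)%N ->
  (x \in E p l) <-> (forall i, (p <= lev i)%N -> x i 0 = 0).
Proof.
move=> pL; have := @mem_colsp_pid K (v l) (d p l) 1%:M x (unitmx1 _ _).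
rewrite mul1mx invmx1 mul1mx => [[h1 h2]]; split=> h.
  by move=> i; rewrite leqNgt lev_lt // -leqNgt; apply: h1.
by apply: h2 => i; rewrite leqNgt -lev_lt // -leqNgt; apply: h.
Qed.

Local Notation par l l' M := (level_par (@lev l) (@lev l') M).

Lemma stdflag_par l l' (M : 'M[K]_(v l', v l)) :
  (forall p, (p <= L)%N -> forall x, x \in E p l -> M *m x \in E p l') <-> par l l' M.
Proof.
split=> [h i k ki|pM p pL x /(mem_stdflag _ pL) xE].
  have kE : delta_mx k 0 \in E (lev k).+1 l.
    apply/mem_stdflag; first exact: lev_ltL.
    by move=> j kj; rewrite mxE; case: eqP kj => [->|//]; rewrite ltnn.
  have /mem_stdflag h' := h _ (lev_ltL k) _ kE.
  by have := h' (lev_ltL k) i ki; rewrite -colE mxE.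
apply/mem_stdflag => // i pi; rewrite mxE big1 // => k _.
have [pk|kp] := leqP p (lev k); first by rewrite xE // mulr0.
by rewrite pM ?mul0r //; apply: leq_trans kp pi.
Qed.

Lemma stdflag_subrep (B : Rep R v) :
  (forall p, (p <= L)%N -> subrep B (E p)) <-> (forall a, par (qout a) (qin a) (B a)).
Proof.
split=> [h a|h p pL a x]; first by apply/stdflag_par => p pL x; apply: h.
by apply: (stdflag_par _).2 => //; apply: h.
Qed.

(** The form in which the absence of morphisms to smaller slopes enters the
    chart. *)
Lemma stdflag_hom_vanish (B : Rep R v) (Y : forall l, 'M[K]_(v l)) :
  HN_filtration alpha B L E ->
  (forall a, par (qout a) (qin a) (Y (qin a) *m B a - B a *m Y (qout a))) ->
  forall l, par l l (Y l).
Proof.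
move=> hn pY l; apply/stdflag_par => p pL x; apply: (HN_hom_vanish hn) => //.
move=> q a z qL zE; rewrite !mulmxA -mulmxBl.
by apply: (stdflag_par _).2 zE => //; apply: pY.
Qed.

Lemma level_par1 l : par l l (1%:M : 'M[K]_(v l)).
Proof.
by move=> i k ki; rewrite mxE; case: eqP ki => [->|//]; rewrite ltnn.
Qed.

Lemma level_parD l l' (M N : 'M[K]_(v l', v l)) : par l l' M -> par l l' N -> par l l' (M + N).
Proof. by move=> pM pN i k ki; rewrite mxE pM ?pN ?addr0. Qed.

Lemma level_parN l l' (M : 'M[K]_(v l', v l)) : par l l' M -> par l l' (- M).
Proof. by move=> pM i k ki; rewrite mxE pM ?oppr0. Qed.

Local Notation low l X := (level_low (@lev l) X).

(** The matrix Y that compares the two unipotents preserves the standard flag,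
    so Y - 1 is block upper triangular and low_par_eq0 applies to it. *)
Lemma unip_flag_inj l (e X X' : 'M[K]_(v l)) : e \in unitmx -> low l X -> low l X' ->
  (forall p, (p <= L)%N ->
     colsp (e *m (1%:M + X') *m Id p l) = colsp (e *m (1%:M + X) *m Id p l)) ->
  X' = X.
Proof.
move=> eu lX lX' h; have Xu := unip_unit (@lev_mono l) lX.
pose Y := invmx (1%:M + X) *m (1%:M + X').
have pY : par l l Y.
  move=> i k ki; have kL := lev_ltL k.
  have [Z eZ] : exists Z, e *m (1%:M + X') *m Id (lev k).+1 l =
      e *m (1%:M + X) *m Id (lev k).+1 l *m Z.
    by apply: colsp_sub; rewrite (h _ kL) subvv.
  have : Y *m Id (lev k).+1 l = Id (lev k).+1 l *m Z.
    exact: cancel_frames eu Xu eZ.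
  move=> /(congr1 (fun M : 'M[K]_(v l) => M i k)).
  rewrite mul_pidE pid_mulE -!lev_lt // ltnSn => ->.
  by rewrite ltnS leqNgt ki.
have Y0 : Y - 1%:M = 0.
  apply: (low_par_eq0 lX (X' := X' - X)).
  - by move=> i k ik; rewrite !mxE lX ?lX' ?subrr.
  - by apply: level_parD => //; apply: level_parN; apply: level_par1.
  by rewrite mulmxBr mulKVmx // mulmx1 opprD addrACA subrr add0r.
move/eqP: Y0; rewrite subr_eq0 => /eqP Y1.
have := mulKVmx Xu (1%:M + X'); rewrite -/Y Y1 mulmx1.
by move=> /(can_inj (addKr 1%:M)).
Qed.

End StandardFlag.

(** * The chart of a stratum *)

Lemma conj_deriv_rel (K : fieldType) n p (gi Zi : 'M[K]_n) (go Zo : 'M[K]_p)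
    (B Ch : 'M[K]_(n, p)) : gi \in unitmx ->
  gi *m B *m invmx go *m Zo = Zi *m B + gi *m Ch ->
  (invmx gi *m Zi) *m B - B *m (invmx go *m Zo) = - Ch.
Proof.
move=> giu /(congr1 (mulmx (invmx gi))).
rewrite mulmxDr -!mulmxA !mulKmx // => ->.
by rewrite opprD addrA subrr add0r.
Qed.

Section Chart.
Variables (R : realType) (Q : quiver) (v : dimvec Q) (alpha : vertex Q -> Cplx R).
Variables (L : nat) (F : nat -> grsub R v).
Hypothesis fF : filtration L F.
Local Notation K := (Cplx R).
Local Notation E := (stdflag F).
Local Notation lev := (lev L F).
Local Notation low l X := (level_low (@lev l) X).
Local Notation par l l' M := (level_par (@lev l) (@lev l') M).

Definition entry_index : finType :=
  ({l : vertex Q & ('I_(v l) * 'I_(v l))%type} +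
   {a : arrow Q & ('I_(v (qin a)) * 'I_(v (qout a)))%type})%type.

(** An entry at a vertex belongs to the frame X and has to be strictly lower;
    an entry along an arrow belongs to the representation B and has to be
    block upper. *)
Definition chart_entry (x : entry_index) : bool :=
  match x with
  | inl t => (lev (tagged t).2 < lev (tagged t).1)%N
  | inr t => (lev (tagged t).1 <= lev (tagged t).2)%N
  end.

Definition chart_dim : nat := #|[pred x | chart_entry x]|.

Definition chart_index (j : 'I_chart_dim) : entry_index :=
  @enum_val _ [pred x | chart_entry x] j.

(** The coordinate of y at an entry, extended by zero to the entries outside
    the chart. *)
Definition chart_coord (y : 'rV[K]_chart_dim) (x : entry_index) : K :=
  \sum_(j < chart_dim | chart_index j == x) y 0 j.

Lemma chart_coordP x :
  (exists2 j, chart_index j = x & forall y, chart_coord y x = y 0 j) \/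
  (~~ chart_entry x /\ forall y, chart_coord y x = 0).
Proof.
have [xJ|xJ] := boolP (chart_entry x); [left|right].
  exists (enum_rank_in (xJ : x \in [pred x | chart_entry x]) x).
    by rewrite /chart_index enum_rankK_in.
  move=> y; apply: big_pred1 => j /=; rewrite /chart_index.
  apply/eqP/eqP => [jx|->]; last by rewrite enum_rankK_in.
  by apply: enum_val_inj; rewrite enum_rankK_in.
split=> // y; apply: big1 => j /eqP jx; case/negP: xJ; rewrite -jx.
exact: (@enum_valP _ [pred x | chart_entry x] j).
Qed.

Definition chart_low (y : 'rV[K]_chart_dim) l : 'M[K]_(v l) :=
  \matrix_(i, k) chart_coord y (inl (Tagged (fun l => ('I_(v l) * 'I_(v l))%type) (i, k))).

Definition chart_rep (y : 'rV[K]_chart_dim) : Rep R v :=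
  fun a => \matrix_(i, k) chart_coord y
    (inr (Tagged (fun a => ('I_(v (qin a)) * 'I_(v (qout a)))%type) (i, k))).

Definition chart_pack (X : forall l, 'M[K]_(v l)) (B : Rep R v) : 'rV[K]_chart_dim :=
  \row_j match chart_index j with
  | inl t => X (tag t) (tagged t).1 (tagged t).2
  | inr t => B (tag t) (tagged t).1 (tagged t).2
  end.

Lemma chart_low_low y l : low l (chart_low y l).
Proof.
move=> i k ik; rewrite mxE; set x := inl _.
have [[j jx _]|[_ ->//]] := chart_coordP x.
have := @enum_valP _ [pred x | chart_entry x] j.
by rewrite -/(chart_index j) jx inE /= ltnNge ik.
Qed.

Lemma chart_rep_par y a : par (qout a) (qin a) (chart_rep y a).
Proof.
move=> i k ik; rewrite mxE; set x := inr _.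
have [[j jx _]|[_ ->//]] := chart_coordP x.
have := @enum_valP _ [pred x | chart_entry x] j.
by rewrite -/(chart_index j) jx inE /= leqNgt ik.
Qed.

Lemma chart_packK y : chart_pack (chart_low y) (chart_rep y) = y.
Proof.
have h j : chart_coord y (chart_index j) = y 0 j.
  by apply: big_pred1 => k /=; apply: (inj_eq enum_val_inj).
apply/rowP => j; rewrite mxE -[RHS]h.
by case: (chart_index j) => [] [t [i k]]; rewrite mxE.
Qed.

Lemma chart_low_pack X B l : low l (X l) -> chart_low (chart_pack X B) l = X l.
Proof.
move=> lX; apply/matrixP => i k; rewrite mxE; set x := inl _.
have [[j jx ->]|[]] := chart_coordP x; first by rewrite mxE jx.
by rewrite /= -leqNgt => /lX -> ->.
Qed.

Lemma chart_rep_pack X B : (forall a, par (qout a) (qin a) (B a)) ->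
  chart_rep (chart_pack X B) = B.
Proof.
move=> pB; apply: functional_extensionality_dep => a; apply/matrixP => i k.
rewrite mxE; set x := inr _.
have [[j jx ->]|[]] := chart_coordP x; first by rewrite mxE jx.
by rewrite /= -ltnNge => /pB -> ->.
Qed.

Lemma cvg_chart_coord (T : Type) (G : set_system T) (f : T -> 'rV[K]_chart_dim)
    (y : 'rV[K]_chart_dim) x : Filter G ->
  f t @[t --> G] --> y -> chart_coord (f t) x @[t --> G] --> chart_coord y x.
Proof.
move=> FG fy; have [[j _ h]|[_ h]] := chart_coordP x; rewrite h.
  by under eq_fun do rewrite h; apply: cvg_entry.
by under eq_fun do rewrite h; exact: cvg_cst.
Qed.

Lemma differentiable_chart_coord x (y : 'rV[K]_chart_dim) :
  differentiable (fun y => chart_coord y x : K) y.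
Proof.
have [[j _ h]|[_ h]] := chart_coordP x.
  by under eq_fun do rewrite h; exact: differentiable_coord.
by under eq_fun do rewrite h; exact: differentiable_cst.
Qed.

Lemma derive_chart_coord x (y h : 'rV[K]_chart_dim) :
  'D_h (fun y => chart_coord y x : K) y = chart_coord h x.
Proof.
have [[j _ e]|[_ e]] := chart_coordP x; rewrite e.
  under eq_fun do rewrite e.
  by rewrite (@derive_entry K _ _ _ (fun y : 'rV[K]_chart_dim => y)) // derive_id.
by under eq_fun do rewrite e; rewrite derive_cst.
Qed.

Lemma differentiable_chart_low l y : differentiable (fun y => chart_low y l) y.
Proof.
apply: differentiable_mx => i k; under eq_fun do rewrite mxE.
exact: differentiable_chart_coord.
Qed.

Lemma differentiable_chart_rep a y : differentiable (fun y => chart_rep y a) y.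
Proof.
apply: differentiable_mx => i k; under eq_fun do rewrite mxE.
exact: differentiable_chart_coord.
Qed.

Lemma derive_chart_low l y h : 'D_h (fun y => chart_low y l) y = chart_low h l.
Proof.
apply/matrixP => i k; rewrite -derive_entry; last exact: differentiable_chart_low.
by under eq_fun do rewrite mxE; rewrite derive_chart_coord mxE.
Qed.

Lemma derive_chart_rep a y h : 'D_h (fun y => chart_rep y a) y = chart_rep h a.
Proof.
apply/matrixP => i k; rewrite -derive_entry; last exact: differentiable_chart_rep.
by under eq_fun do rewrite mxE; rewrite derive_chart_coord mxE.
Qed.

Variable e : forall l, 'M[K]_(v l).
Hypothesis eu : forall l, e l \in unitmx.

Definition chart_frame y l : 'M[K]_(v l) := e l *m (1%:M + chart_low y l).

Lemma chart_frame_unit y l : chart_frame y l \in unitmx.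
Proof.
rewrite unitmx_mul eu /=; apply: unip_unit (@chart_low_low y l).
exact: lev_mono.
Qed.

Definition chart_map y : Rep R v := rep_conj (chart_frame y) (chart_rep y).

Lemma differentiable_chart_frame l y : differentiable (fun y => chart_frame y l) y.
Proof.
apply: differentiable_mulmx; first exact: differentiable_cst.
by apply: differentiableD; [exact: differentiable_cst|exact: differentiable_chart_low].
Qed.

Lemma derive_chart_frame l y h :
  'D_h (fun y => chart_frame y l) y = e l *m chart_low h l.
Proof.
rewrite derive_mulmx.
- rewrite derive_cst mul0mx add0r deriveD.
  + by rewrite derive_cst add0r derive_chart_low.
  + exact: derivable_cst.
  + by apply: diff_derivable; apply: differentiable_chart_low.
- exact: differentiable_cst.
- by apply: differentiableD; [exact: differentiable_cst|exact: differentiable_chart_low].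
Qed.

(** The determinant of the unipotent factor is one, so the inverse is the
    adjugate: a polynomial in the coordinates, which gives
    differentiability. *)
Lemma chart_frame_inv y l : invmx (chart_frame y l) =
  \adj (1%:M + chart_low y l) *m invmx (e l).
Proof.
have lm := @lev_mono R Q v L F l; have ll := @chart_low_low y l.
have u := unip_unit lm ll.
rewrite /chart_frame invmx_mulmx //; congr (_ *m _).
by rewrite /invmx u (det_unip lm ll) invr1 scale1r.
Qed.

Lemma differentiable_chart_map a y : differentiable (fun y => chart_map y a) y.
Proof.
apply: differentiable_mulmx.
  apply: differentiable_mulmx; first exact: differentiable_chart_frame.
  exact: differentiable_chart_rep.
have -> : (fun y => invmx (chart_frame y (qout a))) =
    (fun y => \adj (1%:M + chart_low y (qout a)) *m invmx (e (qout a))).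
  by apply/funext => z; rewrite chart_frame_inv.
apply: differentiable_mulmx; last exact: differentiable_cst.
apply: differentiable_adjugate.
by apply: differentiableD; [exact: differentiable_cst|exact: differentiable_chart_low].
Qed.

Definition chart_dom : set 'rV[K]_chart_dim :=
  [set y | HN_filtration alpha (chart_rep y) L E].

(** Put Y = g^-1 dg for the frame g. If the differential kills h, then the
    commutator of Y with B is minus the variation of B, which preserves the
    standard flag; hence Y does. But (1 + X) Y is the variation of X, strictly
    lower, so Y = 0, and both variations vanish. *)
Lemma chart_immersion y h : chart_dom y ->
  (forall a, 'D_h (fun y => chart_map y a) y = 0) -> h = 0.
Proof.
move=> Dy D0; pose g := chart_frame y; pose B := chart_rep y.
have gu l : g l \in unitmx by exact: chart_frame_unit.
pose Y l := invmx (g l) *m (e l *m chart_low h l).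
have YB a : Y (qin a) *m B a - B a *m Y (qout a) = - chart_rep h a.
  have e1 : (fun y => chart_map y a *m chart_frame y (qout a)) =
      (fun y => chart_frame y (qin a) *m chart_rep y a).
    by apply/funext => z; rewrite /chart_map /rep_conj mulmxKV // chart_frame_unit.
  have dM := @differentiable_chart_map a y.
  have dg := fun l => @differentiable_chart_frame l y.
  have dB := @differentiable_chart_rep a y.
  have := congr1 (fun f => 'D_h f y) e1.
  rewrite (derive_mulmx _ dM (dg _)) (derive_mulmx _ (dg _) dB).
  rewrite D0 mul0mx add0r !derive_chart_frame derive_chart_rep.
  by move=> h1; apply: (conj_deriv_rel (gu (qin a))).
have pY : forall l, par l l (Y l).
  apply: (stdflag_hom_vanish fF Dy) => a; rewrite -/B YB.
  by apply: level_parN; apply: chart_rep_par.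
have Y0 l : Y l = 0.
  apply: (low_par_eq0 (@chart_low_low y l) (@chart_low_low h l)) => //.
  apply: (can_inj (mulKmx (eu l))); rewrite mulmxA -/(chart_frame y l) -/g.
  by rewrite /Y mulKVmx.
have X0 l : chart_low h l = 0.
  rewrite -[LHS](mulKmx (eu l)) -(mulKVmx (gu l) (e l *m _)) -/(Y l) Y0.
  by rewrite !mulmx0.
have C0 a : chart_rep h a = 0.
  by apply/eqP; rewrite -oppr_eq0 -YB !Y0 mul0mx mulmx0 subrr.
rewrite -[h]chart_packK; apply/rowP => j; rewrite !mxE.
by case: (chart_index j) => t; rewrite ?X0 ?C0 mxE.
Qed.

End Chart.

(** * Flags of projectors and unipotent coordinates *)

Section ChartTopology.
Variables (R : realType) (Q : quiver) (v : dimvec Q).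
Variables (vs : seq (dimvec Q)) (F : nat -> grsub R v).
Hypothesis tF : filtration_of_type vs F.
Local Notation K := (Cplx R).
Local Notation L := (size vs).
Local Notation d := (fdim F).
Local Notation Id p l := (pid_mx (d p l) : 'M[K]_(v l)).
Local Notation lev := (lev L F).
Local Notation low l X := (level_low (@lev l) X).

Let fF : filtration L F. Proof. by case: tF. Qed.

Definition frame_flag (g : forall l, 'M[K]_(v l)) p : grsub R v :=
  fun l => colsp (g l *m Id p l).

Definition flag_index := (vertex Q * 'I_(L.+1))%type.
Definition flagfam := projfam R (fun i : flag_index => v i.1).

(** The flags of subrepresentations with the dimensions of F. Apart from the
    dimensions, which are locally constant on projectors, these are closed
    conditions on A and P jointly. *)
Definition is_flag (A : Rep R v) (P : flagfam) : Prop :=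
  [/\ forall i, \dim (colsp (P i)) = d i.2 i.1,
      forall l (p q : 'I_(L.+1)), (p <= q)%N ->
        (P (l, q) : 'M[K]_(v l)) *m P (l, p) = P (l, p)
    & forall a (p : 'I_(L.+1)), (P (qin a, p) : 'M[K]_(v (qin a))) *m
        (A a *m P (qout a, p)) = A a *m P (qout a, p)].

Lemma is_flag_exists A G : filtration L G ->
  (forall p, (p <= L)%N -> subrep A (G p)) ->
  (forall p l, (p <= L)%N -> \dim (G p l) = d p l) ->
  exists P : flagfam, [/\ forall i, orth_proj (P i), is_flag A P &
     forall l (p : 'I_(L.+1)), colsp (P (l, p) : 'M[K]_(v l)) = G p l].
Proof.
move=> fG sG dG.
have h (i : flag_index) : exists P : 'M[K]_(v i.1), orth_proj P /\ colsp P = G i.2 i.1.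
  by have [P oP cP] := orth_proj_exists (G i.2 i.1); exists P.
pose P : flagfam := fun i => projT1 (cid (h i)).
have hP i : orth_proj (P i) /\ colsp (P i) = G i.2 i.1 := projT2 (cid (h i)).
exists P; split=> [i||l p]; [by case: (hP i)|split|by case: (hP (l, p))].
- by move=> i; rewrite (hP i).2 dG // -ltnS.
- move=> l p q pq; have [[_ idq] cq] := hP (l, q); have [_ cp] := hP (l, p).
  have pqL : (p <= q <= L)%N by rewrite pq -ltnS ltn_ord.
  by apply: colsp_sub_idem => //; rewrite cq cp; apply: (filtration_le fG pqL l).
- move=> a p; have [[_ idq] cq] := hP (qin a, p); have [_ cp] := hP (qout a, p).
  apply: colsp_sub_idem => //; apply/subvP => _ /colspP[y ->].
  rewrite -mulmxA cq; apply: (sG p); first by rewrite -ltnS.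
  by rewrite /= in cp; rewrite -cp mem_colsp.
Qed.

Lemma is_flag_filtration A (P : flagfam) : (forall i, orth_proj (P i)) -> is_flag A P ->
  let G p : grsub R v := fun l => colsp (P (l, inord p) : 'M[K]_(v l)) in
  [/\ filtration L G, forall p, (p <= L)%N -> subrep A (G p) &
      forall p l, (p <= L)%N -> \dim (G p l) = d p l].
Proof.
move=> oP [dP nP sP] G.
have dG p l : (p <= L)%N -> \dim (G p l) = d p l.
  by move=> pL; have := dP (l, inord p); rewrite /= inordK.
split=> //; last first.
  move=> p pL a x; rewrite /G !mem_colsp_idem => [/eqP<-||]; last 2 first.
  - by case: (oP (qin a, inord p)).
  - by case: (oP (qout a, inord p)).
  by rewrite (mulmxA (A a)) mulmxA sP.
split=> [l|l|j jL l].
- by apply/eqP; rewrite -dimv_eq0 dG // (fdim0 fF).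
- by apply/eqP; rewrite eqEdim subvf dG // (fdimL fF) dimvf /dim /= muln1.
have jl : ((inord j : 'I_(L.+1)) <= (inord j.+1 : 'I_(L.+1)))%N.
  by rewrite !inordK // ltnW.
by rewrite /G -(nP l _ _ jl); apply: colsp_mul.
Qed.

Variable e : forall l, 'M[K]_(v l).
Hypothesis eu : forall l, e l \in unitmx.

Definition flag_cell (P : flagfam) (i : flag_index) : 'M[K]_(v i.1) :=
  cell_mx (d i.2 i.1) (invmx (e i.1) *m P i).

Definition big_cell (P : flagfam) : Prop := forall i, flag_cell P i \in unitmx.

(** All the graphs of the terms of a flag are gathered in one matrix: a column
    of block p is read off the graph of the term of index p + 1, where it is
    the first block to occur. In this way the matrix is the identity plus a
    strictly lower one. *)
Definition cell_frame (P : flagfam) l : 'M[K]_(v l) :=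
  \matrix_(i, k) cell_section (d (lev k).+1 l)
    (invmx (e l) *m (P (l, inord (lev k).+1) : 'M[K]_(v l))) i k.

Lemma cell_frameE (P : flagfam) l i k : cell_frame P l i k =
  cell_section (d (lev k).+1 l)
    (invmx (e l) *m (P (l, inord (lev k).+1) : 'M[K]_(v l))) i k.
Proof. by rewrite mxE. Qed.

Lemma cell_frame_low (P : flagfam) l : big_cell P -> low l (cell_frame P l - 1%:M).
Proof.
move=> bP i k ik; rewrite mxE mxE; set T := invmx _ *m _.
have kL := lev_ltL fF k.
have Nu : cell_mx (d (lev k).+1 l) T \in unitmx.
  by have := bP (l, inord (lev k).+1); rewrite /flag_cell /= inordK.
have := congr1 (fun M : 'M[K]_(v l) => M i k) (cell_section_pid Nu).
rewrite pid_mulE -(lev_lt fF) // ltnS ik => ->.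
by rewrite !mxE -(lev_lt fF) // ltnS ik andbT val_eqE subrr.
Qed.

(** The columns of block at most p - 1 lie in the terms of index at most p,
    hence in the p-th one, and there are as many of them as its dimension. *)
Lemma cell_frame_flag (A : Rep R v) (P : flagfam) p l : (forall i, orth_proj (P i)) ->
  is_flag A P -> big_cell P -> (p <= L)%N ->
  colsp (e l *m cell_frame P l *m Id p l) = colsp (P (l, inord p) : 'M[K]_(v l)).
Proof.
move=> oP fP bP pL; have [fG _ dG] := is_flag_filtration oP fP.
pose g := cell_frame P l.
have gu : g \in unitmx.
  have -> : g = 1%:M + (g - 1%:M) by rewrite addrC subrK.
  exact: unip_unit (@lev_mono R Q v L F l) (cell_frame_low bP).
apply/eqP; rewrite eqEdim; apply/andP; split; last first.
  rewrite -mulmxA !dim_colsp_unit // dim_colsp_pid ?fdim_le //.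
  by rewrite -(dG p l pL).
apply/subvP => _ /colspP[y ->].
have -> : e l *m cell_frame P l *m Id p l *m y =
    \sum_k (Id p l *m y) k 0 *: (e l *m col k g).
  rewrite -[_ *m _ *m y]mulmxA; apply/colP => i; rewrite mxE summxE.
  apply: eq_bigr => k _; rewrite [RHS]mxE mulrC; congr (_ * _).
  by rewrite [in RHS]colE mulmxA -colE [RHS]mxE.
apply: memv_suml => k _; rewrite pid_mulE; case: ltnP => kd; last by rewrite scale0r mem0v.
apply: memvZ; have kL := lev_ltL fF k; move: kd; rewrite -(lev_lt fF) // => kp.
set T := invmx (e l) *m (P (l, inord (lev k).+1) : 'M[K]_(v l)).
have Nu : cell_mx (d (lev k).+1 l) T \in unitmx.
  by have := bP (l, inord (lev k).+1); rewrite /flag_cell /= inordK.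
have cT : colsp (cell_section (d (lev k).+1 l) T) = colsp T.
  apply: colsp_cell_section => //; first exact: fdim_le.
  by rewrite dim_colsp_unit ?unitmx_inv // -(dG _ l kL).
have : col k g \in colsp T.
  rewrite -cT; have -> : col k g = col k (cell_section (d (lev k).+1 l) T).
    by apply/colP => i; rewrite !mxE.
  by rewrite colE mem_colsp.
move=> /colspP[z ->]; rewrite /T -mulmxA mulKVmx //.
have := filtration_le fG (p := (lev k).+1) (q := p); rewrite kp pL => /(_ isT l)/subvP.
by apply; rewrite mem_colsp.
Qed.

End ChartTopology.

(** * Openness of the domain and of the cell *)

Section ChartOpen.
Variables (R : realType) (Q : quiver) (v : dimvec Q) (alpha : vertex Q -> Cplx R).
Variables (vs : seq (dimvec Q)) (F : nat -> grsub R v).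
Hypothesis tF : filtration_of_type vs F.
Local Notation K := (Cplx R).
Local Notation L := (size vs).
Local Notation d := (fdim F).
Local Notation Id p l := (pid_mx (d p l) : 'M[K]_(v l)).
Local Notation E := (stdflag F).
Local Notation lev := (lev L F).
Local Notation flagfam := (flagfam R v vs).
Variable e : forall l, 'M[K]_(v l).
Hypothesis eu : forall l, e l \in unitmx.

Lemma orth_projfam_exists (Z : grsub R v) :
  exists P : projfam R (fun l : vertex Q => v l),
    (forall l, orth_proj (P l)) /\ (forall l, colsp (P l) = Z l).
Proof.
have h l : exists P : 'M[K]_(v l), orth_proj P /\ colsp P = Z l.
  by have [P oP cP] := orth_proj_exists (Z l); exists P.
by exists (fun l => projT1 (cid (h l))); split=> l; case: (projT2 (cid (h l))).
Qed.

(** Contrapositively, a limit of invariant flags of the given dimensions is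
    again one. *)
Lemma near_not_flag (T : Type) (G : set_system T) (fA : T -> Rep R v)
    (fP : T -> flagfam) (A : Rep R v) (P : flagfam) : Filter G ->
  fA t @[t --> G] --> A -> fP t @[t --> G] --> P ->
  (forall i, orth_proj (P i)) -> ~ is_flag F A P ->
  \forall t \near G, (forall i, orth_proj (fP t i)) -> ~ is_flag F (fA t) (fP t).
Proof.
move=> FG cA cP oP nf.
have cPi i : fP t i @[t --> G] --> P i by apply: cvg_proj cP.
have cAa a : fA t a @[t --> G] --> A a by apply: cvg_proj cA.
(* Each of the three conditions can fail at the limit, and each failure is
   open. *)
have [d1|/existsNP[i di]] := pselect (forall i, \dim (colsp (P i)) = d i.2 i.1); last first.
  have h : \forall t \near G, orth_proj (fP t i) ->
      \dim (colsp (fP t i)) = \dim (colsp (P i)) by exact: near_dim_colsp.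
  by apply: filterS h => t h oPt [dt _ _]; apply: di; rewrite -h.
have [n1|] := pselect (forall l (p q : 'I_(L.+1)), (p <= q)%N ->
        (P (l, q) : 'M[K]_(v l)) *m P (l, p) = P (l, p)); last first.
  move=> /existsNP[l] /existsNP[p] /existsNP[q] /not_implyP[pq h].
  have h' : \forall t \near G, (fP t (l, q) : 'M[K]_(v l)) *m fP t (l, p) <> fP t (l, p).
    exact: near_mx_neq (cvg_mulmx (cPi (l, q)) (cPi (l, p))) (cPi (l, p)) h.
  by apply: filterS h' => t ht _ [_ nt _]; apply: ht; apply: nt.
have [s1|] := pselect (forall a (p : 'I_(L.+1)), (P (qin a, p) : 'M[K]_(v (qin a))) *m
        (A a *m P (qout a, p)) = A a *m P (qout a, p)); first by case: nf.
move=> /existsNP[a] /existsNP[p] h.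
have cAP : fA t a *m fP t (qout a, p) @[t --> G] --> A a *m P (qout a, p).
  exact: cvg_mulmx (cAa a) (cPi (qout a, p)).
have h' : \forall t \near G, (fP t (qin a, p) : 'M[K]_(v (qin a))) *m
    (fA t a *m fP t (qout a, p)) <> fA t a *m fP t (qout a, p).
  exact: near_mx_neq (cvg_mulmx (cPi (qin a, p)) cAP) cAP h.
by apply: filterS h' => t ht _ [_ _ st]; apply: ht; apply: st.
Qed.

Lemma cvg_cell_mx (T : Type) (G : set_system T) n dd (f : T -> 'M[K]_n) (M : 'M[K]_n) :
  Filter G -> f t @[t --> G] --> M -> cell_mx dd (f t) @[t --> G] --> cell_mx dd M.
Proof.
move=> FG fM; apply: (@cvgD _ 'M[K]_n); last exact: cvg_cst.
apply: cvg_mulmx; last exact: cvg_cst.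
apply: cvg_mulmx; first exact: cvg_cst.
by apply: cvg_mulmx; [exact: fM|exact: cvg_ctrmx fM].
Qed.

Lemma cvg_cell_section (T : Type) (G : set_system T) n dd (f : T -> 'M[K]_n)
    (M : 'M[K]_n) : Filter G -> f t @[t --> G] --> M -> cell_mx dd M \in unitmx ->
  cell_section dd (f t) @[t --> G] --> cell_section dd M.
Proof.
move=> FG fM Mu; apply: cvg_mulmx; last exact: cvg_cst.
apply: cvg_mulmx; last by apply: cvg_invmx; [exact: cvg_cell_mx|exact: Mu].
apply: cvg_mulmx; last exact: cvg_cst.
by apply: cvg_mulmx; [exact: fM|exact: cvg_ctrmx fM].
Qed.

#[local] Opaque cell_section.

Lemma near_big_cell (T : Type) (G : set_system T) (fP : T -> flagfam) (P : flagfam) :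
  Filter G -> fP t @[t --> G] --> P -> big_cell F e P ->
  \forall t \near G, big_cell F e (fP t).
Proof.
move=> FG cP bP; apply: filter_forall => i.
apply: near_unitmx (bP i); apply: cvg_cell_mx; apply: cvg_mulmx; first exact: cvg_cst.
exact: cvg_proj cP.
Qed.

Lemma cvg_cell_frame (T : Type) (G : set_system T) (fP : T -> flagfam) (P : flagfam) l :
  Filter G -> fP t @[t --> G] --> P -> big_cell F e P ->
  cell_frame F e (fP t) l @[t --> G] --> cell_frame F e P l.
Proof.
move=> FG cP bP; apply: cvg_mxP => i k.
pose q : 'I_(L.+1) := inord (lev k).+1.
pose S (M : 'M[K]_(v l)) : K := cell_section (d (lev k).+1 l) (invmx (e l) *m M) i k.
have eqS (P' : flagfam) : S (P' (l, q)) = cell_frame F e P' l i k := esym (cell_frameE F e P' i k).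
have H : S (fP t (l, q)) @[t --> G] --> S (P (l, q)).
  apply: cvg_entry; apply: cvg_cell_section.
    by apply: cvg_mulmx; [exact: cvg_cst|exact: (cvg_proj (i := (l, q)) cP)].
  have := bP (l, q); rewrite /flag_cell /= inordK //.
  by apply: lev_ltL; case: tF.
apply: (eq_rect _ (fun c : K => cell_frame F e (fP t) l i k @[t --> G] --> c) _ _ (eqS P)).
apply: (eq_rect _ (fun f : T -> K => f t @[t --> G] --> S (P (l, q))) H).
by apply/funext => t; apply: eqS.
Qed.

(** All invariant flags of the given dimensions are considered, not only
    Harder-Narasimhan filtrations: this is what makes the set open among all
    representations. *)
Definition cell_open : set (Rep R v) :=
  [set A | forall P : flagfam, (forall i, orth_proj (P i)) -> is_flag F A P ->
     big_cell F e P].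

Lemma open_cell_open : open cell_open.
Proof.
rewrite openE => A UA.
apply: (@near_all_projectors R _ _ (Rep R v) (nbhs A)
  (fun A P => is_flag F A P -> big_cell F e P)) => P oP.
have c1 : z.1 @[z --> filter_prod (nbhs P) (nbhs A)] --> P by exact: cvg_fst.
have c2 : z.2 @[z --> filter_prod (nbhs P) (nbhs A)] --> A by exact: cvg_snd.
have [fP|nP] := pselect (is_flag F A P).
  have h : \forall z \near filter_prod (nbhs P) (nbhs A), big_cell F e z.1.
    exact: near_big_cell c1 (UA P oP fP).
  by apply: filterS h => z /= bz _ _.
have h : \forall z \near filter_prod (nbhs P) (nbhs A),
    (forall i, orth_proj (z.1 i)) -> ~ is_flag F z.2 z.1.
  exact: near_not_flag c2 c1 oP nP.
by apply: filterS h => z /= h oz fz; case: (h oz).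
Qed.

(** The source of the continuity of the inverse chart. If all invariant flags
    of A have the same unipotent coordinate g, as happens in the image of the
    chart, then those of nearby representations have coordinates near g, since
    otherwise a limit of them would be an invariant flag of A with another
    coordinate. *)
Lemma near_cell_frame (A : Rep R v) (g : forall l, 'M[K]_(v l)) l (W : set 'M[K]_(v l)) :
  (forall P : flagfam, (forall i, orth_proj (P i)) -> is_flag F A P ->
     big_cell F e P /\ cell_frame F e P l = g l) -> nbhs (g l) W ->
  \forall A' \near A, forall P : flagfam, (forall i, orth_proj (P i)) ->
     is_flag F A' P -> W (cell_frame F e P l).
Proof.
move=> UA nW.
apply: (@near_all_projectors R _ _ (Rep R v) (nbhs A)
  (fun A P => is_flag F A P -> W (cell_frame F e P l))) => P oP.
have c1 : z.1 @[z --> filter_prod (nbhs P) (nbhs A)] --> P by exact: cvg_fst.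
have c2 : z.2 @[z --> filter_prod (nbhs P) (nbhs A)] --> A by exact: cvg_snd.
have [fP|nP] := pselect (is_flag F A P).
  have [bP gP] := UA P oP fP; rewrite -gP in nW.
  have h : \forall z \near filter_prod (nbhs P) (nbhs A), W (cell_frame F e z.1 l).
    have cc : cell_frame F e z.1 l @[z --> filter_prod (nbhs P) (nbhs A)] -->
        cell_frame F e P l by exact: cvg_cell_frame c1 bP.
    exact: (cc W nW).
  by apply: filterS h => z /= Wz _ _.
have h : \forall z \near filter_prod (nbhs P) (nbhs A),
    (forall i, orth_proj (z.1 i)) -> ~ is_flag F z.2 z.1.
  exact: near_not_flag c2 c1 oP nP.
by apply: filterS h => z /= h oz fz; case: (h oz).
Qed.

Lemma cvg_chart_rep (T : Type) (G : set_system T) (f : T -> 'rV[K]_(chart_dim L F))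
   (y : 'rV[K]_(chart_dim L F)) : Filter G -> f t @[t --> G] --> y ->
  (chart_rep (f t) : Rep R v) @[t --> G] --> (chart_rep y : Rep R v).
Proof.
move=> FG fy; apply: cvg_prodP => a; apply: cvg_mxP => i k; rewrite mxE.
by under eq_fun do rewrite mxE; apply: cvg_chart_coord.
Qed.

(** For each step, maximality over all subrepresentations Z is a condition on
    a compact family of projectors. A limit of subrepresentations above E j is
    again one, with the same dimensions, and theta and the rank depend only on
    dimensions. *)
Lemma open_chart_dom : open (chart_dom alpha (L := L) (F := F)).
Proof.
have [fF _] := tF.
rewrite openE => y Dy; have /HN_filtrationP[fE sE hE] := Dy.
suff H : \forall z \near y, forall j : 'I_L,
    destab_max alpha (chart_rep z) (slope alpha (quo_dim (E j) (E j.+1))) (E j) (E j.+1).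
  apply: filterS H => z H; apply/HN_filtrationP; split; [exact: fE|move=> j jL|move=> j jL].
    by apply: (stdflag_subrep fF (chart_rep z)).2 jL => a; exact: chart_rep_par.
  exact: (H (Ordinal jL)).
apply: (@filter_forall _ _ _ (nbhs y)) => j; have [lt eq max] := hE j (ltn_ord j).
set mu := slope _ _ in eq max *.
pose n := (fun l : vertex Q => v l).
pose G (z : 'rV[K]_(chart_dim L F)) (P : projfam R n) :=
  (forall a, (P (qin a) : 'M[K]_(v (qin a))) *m (chart_rep z a *m P (qout a)) =
      chart_rep z a *m P (qout a)) ->
  (forall l, (P l : 'M[K]_(v l)) *m Id j l = Id j l) ->
  let Z : grsub R v := fun l => colsp (P l : 'M[K]_(v l)) in
  theta alpha mu Z <= theta alpha mu (E j) /\
  (theta alpha mu Z = theta alpha mu (E j) -> (grsub_rank Z <= grsub_rank (E j.+1))%N).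
suff H : \forall z \near y, forall P : projfam R n, (forall l, orth_proj (P l)) -> G z P.
  apply: filterS H => z Gz; split; [exact: lt|exact: eq|] => Z sZ EZ.
  have [P [oP cP]] := orth_projfam_exists Z.
  have eZ : Z = fun l => colsp (P l : 'M[K]_(v l)).
    by apply: functional_extensionality_dep => l; exact: esym (cP l).
  rewrite eZ; apply: (Gz P oP) => [a|l].
    apply: colsp_sub_idem; first exact: (oP (qin a)).2.
    apply/subvP => _ /colspP[w ->]; rewrite -mulmxA (cP (qin a)); apply: sZ.
    by rewrite -(cP (qout a)) mem_colsp.
  apply: colsp_sub_idem; first exact: (oP l).2.
  by rewrite (cP l); apply: EZ.
apply: (@near_all_projectors R _ n 'rV[K]_(chart_dim L F) (nbhs y) G) => P oP.
have c1 : z.1 @[z --> filter_prod (nbhs P) (nbhs y)] --> P by exact: cvg_fst.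
have c2 : z.2 @[z --> filter_prod (nbhs P) (nbhs y)] --> y by exact: cvg_snd.
have cP i : z.1 i @[z --> filter_prod (nbhs P) (nbhs y)] --> P i by apply: cvg_proj c1.
have cB a : chart_rep z.2 a @[z --> filter_prod (nbhs P) (nbhs y)] --> chart_rep y a.
  have cBB : (chart_rep z.2 : Rep R v) @[z --> filter_prod (nbhs P) (nbhs y)] -->
      (chart_rep y : Rep R v) by exact: cvg_chart_rep c2.
  exact: (cvg_proj (i := a) cBB).
have [s1|] := pselect (forall a, (P (qin a) : 'M[K]_(v (qin a))) *m
   (chart_rep y a *m P (qout a)) = chart_rep y a *m P (qout a)); last first.
  move=> /existsNP[a] h.
  pose f2 (z : projfam R n * 'rV[K]_(chart_dim L F)) :=
    chart_rep z.2 a *m (z.1 (qout a) : 'M[K]_(v (qout a))).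
  have cAP : f2 z @[z --> filter_prod (nbhs P) (nbhs y)] -->
      chart_rep y a *m (P (qout a) : 'M[K]_(v (qout a))).
    exact: cvg_mulmx (cB a) (cP (qout a)).
  have h' : \forall z \near filter_prod (nbhs P) (nbhs y),
      ((z.1 : projfam R n) (qin a) : 'M[K]_(v (qin a))) *m f2 z <> f2 z.
    exact: near_mx_neq (cvg_mulmx (cP (qin a)) cAP) cAP h.
  by apply: filterS h' => z /= h2 _ st; case: h2; apply: st.
have [i1|] := pselect (forall l, (P l : 'M[K]_(v l)) *m Id j l = Id j l); last first.
  move=> /existsNP[l] h;
  have cI : Id j l @[z --> filter_prod (nbhs P) (nbhs y)] --> Id j l by exact: cvg_cst.
  have h' : \forall z \near filter_prod (nbhs P) (nbhs y),
      ((z.1 : projfam R n) l : 'M[K]_(v l)) *m Id j l <> Id j l.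
    exact: near_mx_neq (cvg_mulmx (cP l) cI) cI h.
  by apply: filterS h' => z /= h2 _ _ it; case: h2; apply: it.
have hd : \forall z \near filter_prod (nbhs P) (nbhs y), forall l,
    orth_proj ((z.1 : projfam R n) l) ->
    \dim (colsp ((z.1 : projfam R n) l : 'M[K]_(v l))) = \dim (colsp (P l : 'M[K]_(v l))).
  by apply: filter_forall => l; exact: near_dim_colsp (cP l) (oP l).
apply: filterS hd => z hd oz _ _ Z.
pose Z0 : grsub R v := fun l => colsp (P l : 'M[K]_(v l)).
have hd' l : \dim (Z l) = \dim (Z0 l) := hd l (oz l).
rewrite (theta_eq_dim alpha mu hd') (grsub_rank_eq_dim hd'); apply: max.
  move=> a x; rewrite mem_colsp_idem; last by case: (oP (qout a)).
  by move=> /eqP<-; rewrite mulmxA -s1 -!mulmxA mem_colsp.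
by move=> l; apply/subvP => _ /colspP[w ->]; rewrite -i1 -mulmxA mem_colsp.
Qed.

End ChartOpen.

(** * The image of the chart *)

Section Stratum.
Variables (R : realType) (Q : quiver) (v : dimvec Q) (alpha : vertex Q -> Cplx R).
Variables (vs : seq (dimvec Q)) (F : nat -> grsub R v).
Hypothesis tF : filtration_of_type vs F.
Local Notation K := (Cplx R).
Local Notation L := (size vs).
Local Notation d := (fdim F).
Local Notation Id p l := (pid_mx (d p l) : 'M[K]_(v l)).
Local Notation E := (stdflag F).
Local Notation lev := (lev L F).
Local Notation S := (@HN_stratum R Q v alpha vs).
Local Notation flagfam := (flagfam R v vs).
Local Notation m := (chart_dim L F).
Variable e : forall l, 'M[K]_(v l).
Hypothesis eu : forall l, e l \in unitmx.
Local Notation D := (@chart_dom R Q v alpha L F).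
Local Notation psi := (@chart_map R Q v L F e).
Local Notation U := (@cell_open R Q v vs F e).

Let fF : filtration L F. Proof. by case: tF. Qed.

Lemma dim_frame_flag (g : forall l, 'M[K]_(v l)) p l : g l \in unitmx ->
  \dim (frame_flag F g p l) = d p l.
Proof. by move=> gu; rewrite /frame_flag dim_colsp_unit // dim_colsp_pid // fdim_le. Qed.

Lemma HN_frame_flag (g : forall l, 'M[K]_(v l)) (B : Rep R v) :
  (forall l, g l \in unitmx) -> HN_filtration alpha B L E ->
  HN_filtration alpha (rep_conj g B) L (frame_flag F g).
Proof.
move=> gu hn; apply: HN_ext (HN_conj gu hn) => p _.
exact: grsub_img_colsp.
Qed.

Lemma HN_chart_map y : D y ->
  HN_filtration alpha (psi y) L (frame_flag F (chart_frame e y)).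
Proof. by move=> Dy; apply: HN_frame_flag => // l; apply: chart_frame_unit. Qed.

Lemma chart_map_stratum y : D y -> S (psi y).
Proof.
move=> Dy; exists (frame_flag F (chart_frame e y)); split; last exact: HN_chart_map.
have [fG _ _] := HN_chart_map Dy.
apply: same_dims_type tF fG _ => p l _.
by apply: dim_frame_flag; apply: chart_frame_unit.
Qed.

Lemma flag_unique (A : Rep R v) G (P : flagfam) : HN_filtration alpha A L G ->
  (forall p l, (p <= L)%N -> \dim (G p l) = d p l) ->
  (forall i, orth_proj (P i)) -> is_flag F A P ->
  forall p l, (p <= L)%N -> colsp (P (l, inord p) : 'M[K]_(v l)) = G p l.
Proof.
move=> hn dG oP fP p l pL; have [fH sH dH] := is_flag_filtration tF oP fP.
by apply: (HN_unique hn fH sH) => // q k qL; rewrite dH // dG.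
Qed.

(** The only invariant flag of psi y with the dimensions of F is the
    transported standard flag, whose unipotent coordinate is the one of y. *)
Lemma chart_map_cell y (P : flagfam) : D y -> (forall i, orth_proj (P i)) ->
  is_flag F (psi y) P ->
  big_cell F e P /\ (forall l, cell_frame F e P l = 1%:M + chart_low y l).
Proof.
move=> Dy oP fP.
have gu l : chart_frame e y l \in unitmx by apply: chart_frame_unit.
have dG p l : (p <= L)%N -> \dim (frame_flag F (chart_frame e y) p l) = d p l.
  by move=> _; apply: dim_frame_flag.
have cP := flag_unique (HN_chart_map Dy) dG oP fP.
have bP : big_cell F e P.
  move=> [l p]; rewrite /flag_cell /=.
  have := cP p l; rewrite -ltnS ltn_ord inord_val => /(_ isT) c.
  have [Z eZ] : exists Z, chart_frame e y l *m Id p l = (P (l, p) : 'M[K]_(v l)) *m Z.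
    by apply: colsp_sub; rewrite c.
  apply: (cell_mx_unit (lv := @lev l) (X := chart_low y l) (Z := Z)).
  - exact: lev_mono.
  - exact: chart_low_low.
  by rewrite -mulmxA -eZ /chart_frame -mulmxA mulKmx.
split=> // l; apply/eqP; rewrite -subr_eq0 opprD addrA subr_eq0; apply/eqP.
apply: (unip_flag_inj fF (eu l)).
- exact: chart_low_low.
- exact: cell_frame_low.
move=> p pL; rewrite subrKC (cell_frame_flag tF eu _ oP fP bP pL).
exact: cP.
Qed.

Lemma chart_map_open y : D y -> U (psi y).
Proof. by move=> Dy P oP fP; case: (chart_map_cell Dy oP fP). Qed.

(** The Harder-Narasimhan filtration of a point of the stratum as a flag of
    projectors; its dimensions are those of F because they depend only on
    vs. *)
Lemma stratum_flag A : S A -> exists P : flagfam,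
  [/\ forall i, orth_proj (P i), is_flag F A P &
     HN_filtration alpha A L (fun p l => colsp (P (l, inord p) : 'M[K]_(v l)))].
Proof.
move=> [G [tG hn]]; have [fG sG _] := hn.
have dG p l : (p <= L)%N -> \dim (G p l) = d p l by apply: type_dims tG tF.
have [P [oP fP cP]] := is_flag_exists fG sG dG; exists P; split=> //.
apply: HN_ext hn => p pL; apply: functional_extensionality_dep => l.
by rewrite cP inordK.
Qed.

Lemma rep_conjK (g : forall l, 'M[K]_(v l)) (A : Rep R v) : (forall l, g l \in unitmx) ->
  rep_conj (fun l => invmx (g l)) (rep_conj g A) = A.
Proof.
move=> gu; rewrite rep_conjM //; last by move=> l; rewrite unitmx_inv.
rewrite -[RHS]rep_conj1; congr rep_conj; apply: functional_extensionality_dep => l.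
by rewrite mulVmx.
Qed.

Lemma rep_conjVK (g : forall l, 'M[K]_(v l)) (A : Rep R v) : (forall l, g l \in unitmx) ->
  rep_conj g (rep_conj (fun l => invmx (g l)) A) = A.
Proof.
move=> gu; have gv l : invmx (g l) \in unitmx by rewrite unitmx_inv.
rewrite rep_conjM //.
rewrite -[RHS]rep_conj1; congr rep_conj; apply: functional_extensionality_dep => l.
by rewrite mulmxV.
Qed.

Lemma chart_map_inj y y' : D y -> D y' -> psi y = psi y' -> y = y'.
Proof.
move=> Dy Dy' e1; have [P [oP fP _]] := stratum_flag (chart_map_stratum Dy).
have [_ c] := chart_map_cell Dy oP fP.
rewrite e1 in fP; have [_ c'] := chart_map_cell Dy' oP fP.
have el : chart_low y = chart_low y'.
  apply: functional_extensionality_dep => l.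
  by apply: (can_inj (addKr (1%:M : 'M[K]_(v l)))); rewrite -c -c'.
have eg : chart_frame e y = chart_frame e y'.
  by apply: functional_extensionality_dep => l; rewrite /chart_frame el.
have gu (z : 'rV[K]_m) l : chart_frame e z l \in unitmx by exact: chart_frame_unit.
rewrite -[y]chart_packK -[y']chart_packK el; congr chart_pack.
rewrite -(rep_conjK (chart_rep y) (gu y)) -(rep_conjK (chart_rep y') (gu y')).
by rewrite -/(psi y) -/(psi y') e1 eg.
Qed.

Lemma stratum_chart_map A : S A -> U A -> exists2 y, D y & psi y = A.
Proof.
move=> SA UA; have [P [oP fP hn]] := stratum_flag SA.
have bP := UA P oP fP; pose X l := cell_frame F e P l - 1%:M.
have lX l : level_low (@lev l) (X l) by apply: cell_frame_low.
pose g l := e l *m (1%:M + X l).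
have gE l : g l = e l *m cell_frame F e P l by rewrite /g /X addrC subrK.
have gu l : g l \in unitmx.
  by rewrite unitmx_mul eu; apply: unip_unit (lX l); apply: lev_mono.
have gv l : invmx (g l) \in unitmx by rewrite unitmx_inv.
pose B := rep_conj (fun l => invmx (g l)) A.
have hB : HN_filtration alpha B L E.
  apply: HN_ext (HN_conj gv hn) => p pL; apply: functional_extensionality_dep => l.
  rewrite /grsub_img -(cell_frame_flag tF eu _ oP fP bP pL) -gE -colsp_mulmx.
  by rewrite mulKmx.
have pB a : level_par (@lev _) (@lev _) (B a).
  by apply: (stdflag_subrep fF B).1; case: hB.
exists (chart_pack L F X B); first by rewrite /chart_dom /= (chart_rep_pack X pB).
have eg : chart_frame e (chart_pack L F X B) = g.
  by apply: functional_extensionality_dep => l; rewrite /chart_frame chart_low_pack.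
rewrite /chart_map eg (chart_rep_pack X pB).
exact: rep_conjVK.
Qed.

End Stratum.

(** * Continuity of the inverse chart *)

Lemma cvg_sub_cst (K : numFieldType) n (M0 N : 'M[K]_n) :
  (M - N) @[M --> M0] --> M0 - N.
Proof.
apply: (@cvgB K 'M[K]_n _ (nbhs M0) _ id (cst N)); first exact: cvg_id.
exact: (@cvg_cst _ N _ (nbhs M0) _).
Qed.

Lemma conj_cancel (K : fieldType) n p (gi : 'M[K]_n) (go : 'M[K]_p) (B : 'M[K]_(n, p)) :
  gi \in unitmx -> go \in unitmx ->
  invmx gi *m (gi *m B *m invmx go) *m go = B.
Proof. by move=> iu ou; rewrite -!mulmxA mulKmx // mulVmx // mulmx1. Qed.

Section Submanifold.
Variables (R : realType) (Q : quiver) (v : dimvec Q) (alpha : vertex Q -> Cplx R).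
Variables (vs : seq (dimvec Q)) (F : nat -> grsub R v).
Hypothesis tF : filtration_of_type vs F.
Local Notation K := (Cplx R).
Local Notation L := (size vs).
Local Notation d := (fdim F).
Local Notation Id p l := (pid_mx (d p l) : 'M[K]_(v l)).
Local Notation E := (stdflag F).
Local Notation lev := (lev L F).
Local Notation S := (@HN_stratum R Q v alpha vs).
Local Notation flagfam := (flagfam R v vs).
Local Notation m := (chart_dim L F).
Variable e : forall l, 'M[K]_(v l).
Hypothesis eu : forall l, e l \in unitmx.
Local Notation D := (@chart_dom R Q v alpha L F).
Local Notation psi := (@chart_map R Q v L F e).
Local Notation U := (@cell_open R Q v vs F e).

Definition chart_inv (A : Rep R v) : 'rV[K]_m := xget 0 [set y | D y /\ psi y = A].

Lemma chart_invP A : (S `&` U) A -> D (chart_inv A) /\ psi (chart_inv A) = A.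
Proof.
move=> [SA UA]; have [y Dy py] := stratum_chart_map tF eu SA UA.
by apply: (@xgetPex _ 0 [set y | D y /\ psi y = A]); exists y.
Qed.

Lemma chart_mapK y : D y -> chart_inv (psi y) = y.
Proof.
move=> Dy; have SU : (S `&` U) (psi y).
  by split; [exact: (chart_map_stratum tF eu Dy)|exact: (chart_map_open tF eu Dy)].
have [D' e'] := chart_invP SU.
exact: (chart_map_inj tF eu D' Dy e').
Qed.

Lemma cvg_chart_low_inv A l : (S `&` U) A ->
  chart_low (chart_inv A') l @[A' --> within (S `&` U) (nbhs A)] -->
    chart_low (chart_inv A) l.
Proof.
move=> SUA N nN; have [Dy py] := chart_invP SUA.
pose g (y : 'rV[K]_m) k : 'M[K]_(v k) := 1%:M + chart_low y k.
pose W := [set M : 'M[K]_(v l) | N (M - 1%:M)].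
have nW : nbhs (g (chart_inv A) l) W.
  have c : (M - 1%:M : 'M[K]_(v l)) @[M --> g (chart_inv A) l] --> chart_low (chart_inv A) l.
    have -> : chart_low (chart_inv A) l = g (chart_inv A) l - 1%:M.
      by rewrite /g addrC addKr.
    exact: cvg_sub_cst.
  exact: (c N nN).
have H : \forall A' \near A, forall P : flagfam, (forall i, orth_proj (P i)) ->
     is_flag F A' P -> W (cell_frame F e P l).
  apply: (near_cell_frame tF (g := g (chart_inv A)) _ nW) => P oP fP.
  rewrite -py in fP; have [bP cP] := chart_map_cell tF eu Dy oP fP.
  by split; [exact: bP|exact: cP].
apply: filterS H => A' H SU'; have [Dy' py'] := chart_invP SU'.
have [P [oP fP _]] := stratum_flag tF SU'.1.
have := H P oP fP; rewrite -py' in fP.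
have [_ cP] := chart_map_cell tF eu Dy' oP fP.
by rewrite cP /W /= addrC addKr.
Qed.

Lemma cvg_chart_rep_inv A a : (S `&` U) A ->
  chart_rep (chart_inv A') a @[A' --> within (S `&` U) (nbhs A)] -->
    chart_rep (chart_inv A) a.
Proof.
move=> SUA.
pose h (A' : Rep R v) : 'M[K]_(v (qin a), v (qout a)) :=
  invmx (chart_frame e (chart_inv A') (qin a)) *m A' a *m
    chart_frame e (chart_inv A') (qout a).
have gu (z : 'rV[K]_m) l : chart_frame e z l \in unitmx by exact: chart_frame_unit.
have hE A' : (S `&` U) A' -> h A' = chart_rep (chart_inv A') a.
  move=> /chart_invP[_ p]; rewrite /h -{2}p.
  exact: conj_cancel (gu _ _) (gu _ _).
have cf l : chart_frame e (chart_inv A') l @[A' --> within (S `&` U) (nbhs A)] -->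
    chart_frame e (chart_inv A) l.
  apply: cvg_mulmx; first exact: cvg_cst.
  apply: (@cvgD _ 'M[K]_(v l)); [exact: cvg_cst|exact: cvg_chart_low_inv].
have cA : A' a @[A' --> within (S `&` U) (nbhs A)] --> A a.
  have cw : A' @[A' --> within (S `&` U) (nbhs A)] --> A by exact: cvg_within.
  exact: (cvg_proj (i := a) cw).
rewrite -(hE A SUA); apply: (@cvg_trans _ (h A' @[A' --> within (S `&` U) (nbhs A)])).
  have w : nbhs A [set A' | (S `&` U) A' -> h A' = chart_rep (chart_inv A') a].
    by apply: filterE => A' SU; exact: hE A' SU.
  apply: near_eq_cvg; exact: w.
apply: cvg_mulmx; last exact: cf.
by apply: cvg_mulmx; [apply: cvg_invmx; [exact: cf|exact: gu]|exact: cA].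
Qed.

Lemma chart_inv_continuous : {within S `&` U, continuous chart_inv}.
Proof.
apply/subspace_continuousP => A SUA; apply: cvg_mxP => i j; rewrite (ord1 i).
pose ent (y : 'rV[K]_m) : K := match chart_index j with
  | inl t => chart_low y (tag t) (tagged t).1 (tagged t).2
  | inr t => chart_rep y (tag t) (tagged t).1 (tagged t).2
  end.
have entE (y : 'rV[K]_m) : ent y = y 0 j.
  by rewrite -{2}[y]chart_packK mxE.
have ce : ent (chart_inv A') @[A' --> within (S `&` U) (nbhs A)] --> ent (chart_inv A).
  rewrite /ent; case: (chart_index j) => t; apply: cvg_entry.
    exact: cvg_chart_low_inv.
  exact: cvg_chart_rep_inv.
rewrite -entE; apply: (eq_rect _ (fun f : Rep R v -> K =>
  f A' @[A' --> within (S `&` U) (nbhs A)] --> ent (chart_inv A)) ce).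
by apply/funext => A'; apply: entE.
Qed.

Lemma HN_stratum_submanifold A :
  (forall p l, (p <= L)%N -> F p l = colsp (e l *m Id p l)) ->
  HN_filtration alpha A L F -> complex_submanifold_at S A m.
Proof.
move=> eF hn; have im : psi @` D = S `&` U.
  apply/seteqP; split=> [_ [y Dy <-]|A' [SA UA]].
    by split; [exact: (chart_map_stratum tF eu Dy)|exact: (chart_map_open tF eu Dy)].
  by have [y Dy py] := stratum_chart_map tF eu SA UA; exists y.
exists D, U, psi, chart_inv; split=> //.
- split; [exact: open_chart_dom tF|exact: open_cell_open|].
  rewrite -im; pose X l : 'M[K]_(v l) := 0.
  have lX l : level_low (@lev l) (X l) by move=> i k _; rewrite mxE.
  pose B := rep_conj (fun l => invmx (e l)) A.
  have ev l : invmx (e l) \in unitmx by rewrite unitmx_inv.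
  have hB : HN_filtration alpha B L E.
    apply: HN_ext (HN_conj ev hn) => p pL; apply: functional_extensionality_dep => l.
    by rewrite /grsub_img eF // -colsp_mulmx mulKmx.
  have fF : filtration L F by case: tF.
  have pB a : level_par (@lev _) (@lev _) (B a).
    by apply: (stdflag_subrep fF B).1; case: hB.
  (* A is the image of X = 0 and of its own matrix in the adapted bases. *)
  exists (chart_pack L F X B); first by rewrite /chart_dom /= (chart_rep_pack X pB).
  have -> : psi (chart_pack L F X B) = rep_conj e B.
    rewrite /chart_map (chart_rep_pack X pB); congr rep_conj.
    apply: functional_extensionality_dep => l.
    by rewrite /chart_frame chart_low_pack // addr0 mulmx1.
  exact: rep_conjVK.
- by move=> y _ a; apply: differentiable_chart_map.
- move=> y Dy h dh; apply: (chart_immersion (e := e) _ eu Dy); first by case: tF.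
  move=> a; rewrite deriveE; first exact: dh.
  exact: differentiable_chart_map.
- by split; [exact: chart_mapK|exact: chart_inv_continuous].
Qed.

End Submanifold.

(** * Counting the coordinates *)

(** Pairs (x, y) with p x < q y, sorted by the values of p and q. *)
Lemma sum_level_lt L n n' (p : 'I_n -> 'I_L) (q : 'I_n' -> 'I_L) :
  (\sum_(j < L) \sum_(k < L | j < k) (\sum_x (p x == j)) * (\sum_y (q y == k)) =
   \sum_y \sum_x (p x < q y))%N.
Proof.
rewrite exchange_big /= [RHS](partition_big p predT) //=; apply: eq_bigr => j _.
transitivity (\sum_(x | p x == j) \sum_y (j < q y))%N; last first.
  by apply: eq_bigr => x /eqP->.
rewrite sum_nat_const -big_distrr /=; congr (_ * _)%N.
  by rewrite -sum1_card [RHS]big_mkcond /=; apply: eq_bigr => x _;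
     rewrite unfold_in -[p x == j]/(eqn (p x) j); case: eqn.
rewrite [RHS](partition_big q predT) //= big_mkcond /=; apply: eq_bigr => k _.
transitivity (\sum_(y | q y == k) (j < k))%N; last by apply: eq_bigr => y /eqP->.
rewrite sum_nat_const; case: ltnP => _; last by rewrite muln0.
by rewrite muln1 -sum1_card [RHS]big_mkcond /=; apply: eq_bigr => y _;
  rewrite unfold_in -[q y == k]/(eqn (q y) k); case: eqn.
Qed.

Section CountLevels.
Variables (R : realType) (Q : quiver) (v : dimvec Q).
Variables (L : nat) (F : nat -> grsub R v).
Hypothesis fF : filtration L F.
Local Notation d := (fdim F).
Local Notation lev := (lev L F).

Lemma sum_ord_lt n d' : (d' <= n)%N -> (\sum_(x < n) (x < d') = d')%N.
Proof.
move=> dn; transitivity (\sum_(x < n | x < d') 1)%N.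
  by rewrite [RHS]big_mkcond; apply: eq_bigr => x _; case: (x < d')%N.
by rewrite -(big_ord_widen _ (fun=> 1%N) dn) sum1_card card_ord.
Qed.

Lemma sum_lev_eq (j : nat) l : (j < L)%N ->
  (\sum_(x : 'I_(v l)) (lev x == j) = d j.+1 l - d j l)%N.
Proof.
move=> jL; have h p : (p <= L)%N -> (\sum_(x : 'I_(v l)) (lev x < p) = d p l)%N.
  move=> pL; rewrite -[RHS](sum_ord_lt (fdim_le F p l)); apply: eq_bigr => x _.
  by rewrite (lev_lt fF).
rewrite -(h _ jL) -(h _ (ltnW jL)) -sumnB; last first.
  by move=> x _; case lx: (lev x < j)%N => //; rewrite ltnS (ltnW lx).
by apply: eq_bigr => x _; rewrite ltnS; case: ltngtP.
Qed.

Definition lt_pairs l l' : nat :=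
  (\sum_(y : 'I_(v l')) \sum_(x : 'I_(v l)) (lev x < lev y))%N.

Lemma sum_quo_dim l l' :
  (\sum_(j < L) \sum_(k < L | j < k) (d j.+1 l - d j l) * (d k.+1 l' - d k l') =
   lt_pairs l l')%N.
Proof.
rewrite /lt_pairs -(@sum_level_lt L _ _ (fun x : 'I_(v l) => Ordinal (lev_ltL fF x))
  (fun y : 'I_(v l') => Ordinal (lev_ltL fF y))).
by apply: eq_bigr => j _; apply: eq_bigr => k _; rewrite -!sum_lev_eq.
Qed.

Lemma chart_dimE : (chart_dim L F =
  \sum_l lt_pairs l l + \sum_a (v (qin a) * v (qout a) - lt_pairs (qout a) (qin a)))%N.
Proof.
rewrite /chart_dim -sum1_card big_mkcond big_sumType /=; congr (_ + _)%N.
  rewrite -(@sig_big_dep _ _ _ _ _ predT (fun _ => predT)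
    (fun l (t : 'I_(v l) * 'I_(v l)) => if (lev t.2 < lev t.1)%N then 1 else 0)%N) /=.
  apply: eq_bigr => l _; rewrite /lt_pairs pair_big /=.
  by apply: eq_bigr => -[i k] _ /=; case: ltnP.
rewrite -(@sig_big_dep _ _ _ _ _ predT (fun _ => predT)
    (fun a (t : 'I_(v (qin a)) * 'I_(v (qout a))) =>
      if (lev t.1 <= lev t.2)%N then 1 else 0)%N) /=.
apply: eq_bigr => a _; rewrite /lt_pairs pair_big /=.
have -> : (v (qin a) * v (qout a) =
    \sum_(t : 'I_(v (qin a)) * 'I_(v (qout a))) 1)%N.
  by rewrite sum1_card card_prod !card_ord.
rewrite -sumnB; last by move=> t _; case: ltnP.
by apply: eq_bigr => -[i k] _ /=; case: ltnP.
Qed.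

Lemma lt_pairs_le l l' : (lt_pairs l l' <= v l' * v l)%N.
Proof.
rewrite /lt_pairs -[v l' in X in (_ <= X)%N]card_ord -[v l in X in (_ <= X)%N]card_ord.
rewrite -sum_nat_const; apply: leq_sum => y _.
by rewrite -sum1_card; apply: leq_sum => x _; apply: leq_b1.
Qed.

End CountLevels.

Lemma dim_HomE (K : fieldType) (aT rT : vectType K) (U : {vspace aT}) (W : {vspace rT}) :
  dim_Hom U W = (\dim U * \dim W)%N.
Proof. by rewrite /dim_Hom dimvf. Qed.

(** The orthogonal complement is the kernel of the orthogonal projector, to
    which rank-nullity applies. *)
Lemma dim_splitting (R : realType) (Q : quiver) (v : dimvec Q) L
    (F : nat -> grsub R v) j l : filtration L F -> (j < L)%N ->
  \dim (splitting F j l) = (fdim F j.+1 l - fdim F j l)%N.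
Proof.
move=> [_ _ FS] jL; have [P [PC PP] cP] := orth_proj_exists (F j l).
have -> : splitting F j l = (F j.+1 l :&: lker (mulv P))%VS.
  congr (_ :&: _)%VS; apply/vspaceP => x; apply/idP/idP.
    move=> /memv_orthov h; rewrite memv_ker mulvE; apply/eqP.
    apply: ctrmx_mul_eq0; rewrite ctrmx_mul PC -mulmxA (mulmxA P) PP.
    rewrite mulmxA; have -> : x^t* *m P = (P *m x)^t* by rewrite ctrmx_mul PC.
    by apply: h; rewrite -cP mem_colsp.
  rewrite memv_ker mulvE => /eqP Px; apply/memv_orthov => y; rewrite -cP.
  by move=> /colspP[z ->]; rewrite ctrmx_mul PC -mulmxA Px mulmx0.
have := limg_ker_dim (mulv P) (F j.+1 l).
have -> : (mulv P @: F j.+1 l)%VS = F j l.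
  apply/eqP; rewrite eqEsubv; apply/andP; split.
    by apply/subvP => _ /memv_imgP[y _ ->]; rewrite mulvE -cP mem_colsp.
  apply/subvP => x xF; have := xF; rewrite -cP mem_colsp_idem // => /eqP <-.
  by rewrite -mulvE memv_img //; apply: (subvP (FS _ jL l)).
by move=> h; rewrite /fdim -[X in (X - _)%N]h addnK.
Qed.

(** The block upper entries along the arrows are the complement of the
    strictly lower ones, so the coordinates of the chart number dim Rep - dim
    Rep_LT + dim g_LT. *)
Lemma HN_codimE (R : realType) (Q : quiver) (v : dimvec Q) vs (F G : nat -> grsub R v) :
  filtration_of_type vs F -> filtration_of_type vs G ->
  HN_codim (size vs) G = (dimRep v)%:Z - (chart_dim (size vs) F)%:Z.
Proof.
move=> tF tG; have [fF _] := tF; have [fG _] := tG.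
have sp j l : (j < size vs)%N ->
    \dim (splitting G j l) = (fdim F j.+1 l - fdim F j l)%N.
  move=> jL; rewrite (dim_splitting _ fG jL) /fdim.
  by rewrite !(type_dims _ tF tG) // ltnW.
have hL l l' : (\sum_(j < size vs) \sum_(k < size vs | j < k)
     dim_Hom (splitting G j l) (splitting G k l') = lt_pairs (size vs) F l l')%N.
  rewrite -(sum_quo_dim fF); apply: eq_bigr => j _; apply: eq_bigr => k _.
  by rewrite dim_HomE !sp.
rewrite /HN_codim.
have -> : dim_Rep_LT (size vs) G = (\sum_a lt_pairs (size vs) F (qout a) (qin a))%N.
  by apply: eq_bigr => a _.
have -> : dim_g_LT (size vs) G = (\sum_l lt_pairs (size vs) F l l)%N.
  by apply: eq_bigr => l _.
rewrite chart_dimE // /dimRep sumnB => [|a _]; last exact: lt_pairs_le.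
set x := (\sum_a lt_pairs _ _ _ _)%N; set y := (\sum_l _)%N; set z := (\sum_a _)%N.
have : (x <= z)%N by apply: leq_sum => a _; apply: lt_pairs_le.
by move=> xz; rewrite PoszD -subzn //; lia.
Qed.

(** * The real trace form *)

Section ConjTranspose.
Variable C : numClosedFieldType.

Lemma ctrmxD m n (M N : 'M[C]_(m, n)) : (M + N)^t* = M^t* + N^t*.
Proof. by rewrite linearD /= map_mxD. Qed.

Lemma ctrmxN m n (M : 'M[C]_(m, n)) : (- M)^t* = - M^t*.
Proof. by rewrite linearN /= map_mxN. Qed.

Lemma ctrmxB m n (M N : 'M[C]_(m, n)) : (M - N)^t* = M^t* - N^t*.
Proof. by rewrite ctrmxD ctrmxN. Qed.

Lemma ctrmxZ m n (a : C) (M : 'M[C]_(m, n)) : (a *: M)^t* = Num.conj a *: M^t*.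
Proof. by rewrite linearZ /= map_mxZ. Qed.

Lemma ctrmx_sum m n (I : Type) (r : seq I) (P : pred I) (M : I -> 'M[C]_(m, n)) :
  (\sum_(i <- r | P i) M i)^t* = \sum_(i <- r | P i) (M i)^t*.
Proof.
elim/big_rec2: _ => [|i A B _ <-]; last exact: ctrmxD.
by rewrite trmx0 map_mx0.
Qed.

Lemma tr_ctrmx n (M : 'M[C]_n) : \tr (M^t*) = Num.conj (\tr M).
Proof. by rewrite trace_map_mx mxtrace_tr. Qed.

End ConjTranspose.

Section RealTrace.
Variable R : realType.
Local Notation K := (Cplx R).

Lemma ReD (x y : K) : complex.Re (x + y) = complex.Re x + complex.Re y.
Proof. by case: x y => ? ? []. Qed.

Lemma ReN (x : K) : complex.Re (- x) = - complex.Re x.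
Proof. by case: x. Qed.

Lemma Re_conj (x : K) : complex.Re (Num.conj x) = complex.Re x.
Proof. by case: x. Qed.

Lemma ReM_real (t : R) (x : K) : complex.Re ((t%:C : K) * x) = t * complex.Re x.
Proof. by case: x => a b /=; rewrite mul0r subr0. Qed.

Definition rdot n (X Y : 'M[K]_n) : R := complex.Re (\tr (X^t* *m Y)).

Lemma rdotDl n (X X' Y : 'M[K]_n) : rdot (X + X') Y = rdot X Y + rdot X' Y.
Proof. by rewrite /rdot ctrmxD mulmxDl mxtraceD ReD. Qed.

Lemma rdotDr n (X Y Y' : 'M[K]_n) : rdot X (Y + Y') = rdot X Y + rdot X Y'.
Proof. by rewrite /rdot mulmxDr mxtraceD ReD. Qed.

Lemma conj_real (t : R) : Num.conj (t%:C : K) = t%:C.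
Proof. exact: conjc_real. Qed.

Lemma rdotZl n (t : R) (X Y : 'M[K]_n) : rdot ((t%:C : K) *: X) Y = t * rdot X Y.
Proof.
by rewrite /rdot ctrmxZ conj_real -scalemxAl mxtraceZ ReM_real.
Qed.

Lemma rdotZr n (t : R) (X Y : 'M[K]_n) : rdot X ((t%:C : K) *: Y) = t * rdot X Y.
Proof. by rewrite /rdot -scalemxAr mxtraceZ ReM_real. Qed.

Lemma rdotC n (X Y : 'M[K]_n) : rdot X Y = rdot Y X.
Proof.
by rewrite /rdot -[RHS]Re_conj -tr_ctrmx ctrmx_mul trmxCK.
Qed.

(** The function is a quartic polynomial in t, whose coefficient of degree one
    is 2 * rdot H0 L1. *)
Lemma quadratic_derive0 n (H0 L1 L2 : 'M[K]_n) :
  is_derive (0 : R) (1 : R) (fun t : R =>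
    rdot (H0 + (t%:C : K) *: L1 + ((t ^+ 2)%:C : K) *: L2)
         (H0 + (t%:C : K) *: L1 + ((t ^+ 2)%:C : K) *: L2)) 0 ->
  rdot H0 L1 = 0.
Proof.
pose p := \poly_(i < 5) [:: rdot H0 H0; 2 * rdot H0 L1; 2 * rdot H0 L2 + rdot L1 L1;
   2 * rdot L1 L2; rdot L2 L2]`_i.
have -> : (fun t : R => rdot (H0 + (t%:C : K) *: L1 + ((t ^+ 2)%:C : K) *: L2)
         (H0 + (t%:C : K) *: L1 + ((t ^+ 2)%:C : K) *: L2)) = horner p.
  apply/funext => t; rewrite horner_poly !big_ord_recl big_ord0 /=.
  rewrite !rdotDl !rdotDr !rdotZl !rdotZr (rdotC L1 H0) (rdotC L2 H0) (rdotC L2 L1).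
  rewrite /bump /=; ring.
move=> h.
have [_ h1] := h; have [_ h2] := is_derive_poly p (0 : R).
have : p^`().[0] = 0 by rewrite -h2.
rewrite horner_coef0 coef_deriv coef_poly /= => h3.
by move/eqP: h3; rewrite mulrn_eq0 /= mulf_eq0 pnatr_eq0 /= => /eqP.
Qed.

End RealTrace.

(** * Critical points commute with their moment map *)

Lemma comm_commutator (K : fieldType) n (P X Y : 'M[K]_n) (c c' : K) :
  P *m X = c *: X -> X *m P = c' *: X -> P *m Y = c' *: Y -> Y *m P = c *: Y ->
  P *m (X *m Y - Y *m X) = (X *m Y - Y *m X) *m P.
Proof.
move=> PX XP PY YP; rewrite mulmxBr mulmxBl !mulmxA PX PY -[_ *m Y *m P]mulmxA YP.
by rewrite -[_ *m X *m P]mulmxA XP -!scalemxAl -!scalemxAr.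
Qed.

Lemma scale_split (K : comNzRingType) (V : lmodType K) (c t u : K) (x y z : V) :
  c *: (x + t *: y + u *: z) = c *: x + t *: (c *: y) + u *: (c *: z).
Proof. by rewrite !scalerDr !scalerA (mulrC c t) (mulrC c u). Qed.

Lemma sub_addACA (V : zmodType) (x y z w : V) : x + y + z - w = x - w + y + z.
Proof. by rewrite addrAC; congr (_ + _); rewrite addrAC. Qed.

(** Cyclicity of the trace turns the pairing of S with the variation of the
    moment map in the direction Y, the commutator of H and X, into a squared
    norm. *)
Lemma commutator_trace (C : numClosedFieldType) n (S H X Y : 'M[C]_n) :
  H^t* = H -> H = 'i *: S -> Y = H *m X - X *m H ->
  \tr (S *m ((X *m Y^t* + Y *m X^t*) - (X^t* *m Y + Y^t* *m X))) =
    - ('i * 2) * \tr (Y *m Y^t*).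
Proof.
move=> HC HS YE.
have -> : S = (- 'i) *: H by rewrite HS scalerA mulNr -expr2 sqrCi opprK scale1r.
have YC : Y^t* = X^t* *m H - H *m X^t* by rewrite YE ctrmxB !ctrmx_mul HC.
rewrite -scalemxAl mxtraceZ mulmxBr !mulmxDr raddfB /= !mxtraceD !mulmxA.
have e1 : \tr (H *m X *m Y^t*) - \tr (H *m Y^t* *m X) = \tr (Y *m Y^t*).
  rewrite -[H *m Y^t* *m X]mulmxA [\tr (H *m _)]mxtrace_mulC -[_ *m X *m H]mulmxA.
  by rewrite [\tr (Y^t* *m _)]mxtrace_mulC -raddfB -mulmxBl -YE.
have e2 : \tr (H *m Y *m X^t*) - \tr (H *m X^t* *m Y) = \tr (Y *m Y^t*).
  rewrite [\tr (H *m X^t* *m Y)]mxtrace_mulC -[H *m Y *m X^t*]mulmxA.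
  rewrite [\tr (H *m _)]mxtrace_mulC -[Y *m X^t* *m H]mulmxA.
  by rewrite -raddfB -mulmxBr YC.
move: e1 e2; set a := \tr (H *m X *m _); set b := \tr (H *m Y *m _).
set c := \tr (H *m _ *m Y); set dd := \tr (H *m _ *m X); set T := \tr _ => e1 e2.
have -> : a + b - (c + dd) = (a - dd) + (b - c) by ring.
by rewrite e1 e2; ring.
Qed.

Lemma proj_commutator (K : fieldType) n (P P' H X : 'M[K]_n) :
  P *m H = H *m P -> P' *m H = H *m P' -> P *m X = X -> X *m P' = X ->
  P *m (H *m X - X *m H) *m P' = H *m X - X *m H.
Proof.
move=> PH PH' PX XP.
have e1 : P *m (H *m X *m P') = H *m X by rewrite -mulmxA XP mulmxA PH -mulmxA PX.
have e2 : P *m (X *m H *m P') = X *m H.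
  by rewrite -[X *m H *m P']mulmxA -PH' !mulmxA -[P *m X *m P']mulmxA XP PX.
by rewrite -mulmxA mulmxBl mulmxBr e1 e2.
Qed.

Lemma i_cancel (C : numClosedFieldType) (T : C) : - ('i / 2 * (- ('i * 2) * T)) = - T.
Proof.
have i2 : ('i : C) * 'i = - 1 by rewrite -expr2 sqrCi.
have two : (2 : C) != 0 by rewrite pnatr_eq0.
have -> : 'i / 2 * (- ('i * 2) * T) = - ('i * 'i) * T.
  by rewrite !mulNr mulrN mulrA mulrACA mulVf // mulr1.
by rewrite i2 opprK mul1r.
Qed.

Lemma ge0_Re_eq0 (R : realType) (z : Cplx R) : 0 <= z -> complex.Re z = 0 -> z = 0.
Proof.
by case: z => x y; rewrite lecE /= => /andP[/eqP-> _] ->.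
Qed.

Lemma compress_comm (C : numClosedFieldType) n m (J : 'M[C]_(n, m)) (H : 'M[C]_n) :
  J^t* *m J = 1%:M -> (J *m J^t*) *m H = H *m (J *m J^t*) ->
  H *m J = J *m (J^t* *m H *m J).
Proof.
by move=> iso comm; rewrite !mulmxA comm -!mulmxA iso mulmx1.
Qed.

Lemma compress_arrow (C : numClosedFieldType) n m p (J : 'M[C]_(n, m)) (I : 'M[C]_(n, p))
    (H : 'M[C]_n) (HJ : 'M[C]_m) (HI : 'M[C]_p) (A : 'M[C]_(m, p)) :
  J^t* *m J = 1%:M -> I^t* *m I = 1%:M -> H *m J = J *m HJ -> H *m I = I *m HI ->
  H *m (J *m A *m I^t*) = (J *m A *m I^t*) *m H -> HJ *m A = A *m HI.
Proof.
move=> Ji Ii hJ hI h.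
have eJ : J^t* *m H *m J = HJ by rewrite -mulmxA hJ mulmxA Ji mul1mx.
have eI : I^t* *m H *m I = HI by rewrite -mulmxA hI mulmxA Ii mul1mx.
transitivity (J^t* *m (H *m (J *m A *m I^t*)) *m I).
  by rewrite -[LHS]mulmx1 -Ii -eJ !mulmxA.
by rewrite h -[RHS]mul1mx -Ji -eI !mulmxA.
Qed.

Section CriticalPoints.
Variables (R : realType) (Q : quiver) (v : dimvec Q) (alpha : vertex Q -> Cplx R).
Hypothesis alpha_im : forall l, complex.Re (alpha l) = 0.
Local Notation K := (Cplx R).
Local Notation inj l := (vect_inj R v l).
Definition vproj l : 'M[K]_(vect_dim v) := inj l *m (inj l)^t*.
Local Notation Pi l := (vproj l).
Local Notation hat A a := (@vect_arrow R Q v A a).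
Implicit Types (A B : Rep R v).

Lemma vect_inj_iso l : (inj l)^t* *m inj l = 1%:M.
Proof.
apply/matrixP => i j; rewrite vect_inj_isometry mxE.
by rewrite eq_Tagged.
Qed.

Lemma vect_inj_orth l l' : l != l' -> (inj l)^t* *m inj l' = 0.
Proof.
move=> ll; apply/matrixP => i j; rewrite vect_inj_isometry mxE.
case: eqP => // /(congr1 (@tag _ _)) /= e; by rewrite e eqxx in ll.
Qed.

Lemma vproj_ctr l : (Pi l)^t* = Pi l.
Proof. by rewrite /vproj ctrmx_mul trmxCK. Qed.

Lemma vproj_inj l m : Pi l *m inj m = (l == m)%:R *: inj m.
Proof.
rewrite /vproj; case: eqP => [<-|/eqP lm]; first by rewrite -mulmxA vect_inj_iso mulmx1 scale1r.
by rewrite -mulmxA vect_inj_orth // mulmx0 scale0r.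
Qed.

Lemma inj_vproj l m : (inj m)^t* *m Pi l = (l == m)%:R *: (inj m)^t*.
Proof.
have := congr1 (fun M => M^t*) (vproj_inj l m).
by rewrite ctrmx_mul vproj_ctr ctrmxZ rmorph_nat.
Qed.

Lemma vproj_arrow_in A a : Pi (qin a) *m hat A a = hat A a.
Proof. by rewrite /vect_arrow !mulmxA vproj_inj eqxx scale1r. Qed.

Lemma arrow_vproj_out A a : hat A a *m Pi (qout a) = hat A a.
Proof. by rewrite /vect_arrow -!mulmxA inj_vproj eqxx scale1r. Qed.

Lemma vproj_arrow A l a : Pi l *m hat A a = (l == qin a)%:R *: hat A a.
Proof. by rewrite /vect_arrow !mulmxA vproj_inj -!scalemxAl. Qed.

Lemma arrow_vproj A l a : hat A a *m Pi l = (l == qout a)%:R *: hat A a.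
Proof. by rewrite /vect_arrow -!mulmxA inj_vproj -!scalemxAr. Qed.

Lemma arrowC_vproj A l a : (hat A a)^t* *m Pi l = (l == qin a)%:R *: (hat A a)^t*.
Proof.
have := congr1 (fun M => M^t*) (vproj_arrow A l a).
by rewrite ctrmx_mul vproj_ctr ctrmxZ rmorph_nat.
Qed.

Lemma vproj_arrowC A l a : Pi l *m (hat A a)^t* = (l == qout a)%:R *: (hat A a)^t*.
Proof.
have := congr1 (fun M => M^t*) (arrow_vproj A l a).
by rewrite ctrmx_mul vproj_ctr ctrmxZ rmorph_nat.
Qed.

Lemma comm_sum n (M : 'M[K]_n) (I : finType) (N : I -> 'M[K]_n) :
  (forall i, M *m N i = N i *m M) -> M *m (\sum_i N i) = (\sum_i N i) *m M.
Proof. by move=> h; rewrite mulmx_sumr mulmx_suml; apply: eq_bigr => i _. Qed.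

Lemma vproj_moment A l : Pi l *m shifted_moment alpha A = shifted_moment alpha A *m Pi l.
Proof.
rewrite mulmxBr mulmxBl; congr (_ - _).
  rewrite -scalemxAr -scalemxAl; congr (_ *: _); apply: comm_sum => a.
  exact: comm_commutator (vproj_arrow _ _ _) (arrow_vproj _ _ _) (vproj_arrowC _ _ _)
    (arrowC_vproj _ _ _).
apply: comm_sum => m; rewrite -scalemxAr -scalemxAl; congr (_ *: _).
by rewrite (mulmxA (Pi l)) vproj_inj -(mulmxA (inj m)) inj_vproj -scalemxAl -scalemxAr.
Qed.

(** The hermitian matrix whose eigenspaces are those in the definition of the
    type of a critical point. *)
Definition moment_herm A : 'M[K]_(vect_dim v) := 'i *: shifted_moment alpha A.
Local Notation H A := (moment_herm A).

Lemma vproj_herm A l : Pi l *m H A = H A *m Pi l.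
Proof. by rewrite -scalemxAr -scalemxAl vproj_moment. Qed.

Lemma conj_alpha l : Num.conj (alpha l) = - alpha l.
Proof.
have := alpha_im l; case: (alpha l) => x y /= ->.
by apply/eqP; rewrite eq_complex; apply/andP; split; rewrite /= ?oppr0.
Qed.

Lemma shifted_moment_skew A : (shifted_moment alpha A)^t* = - shifted_moment alpha A.
Proof.
rewrite ctrmxB opprB addrC; congr (_ + _).
  rewrite ctrmx_sum -sumrN; apply: eq_bigr => l _.
  by rewrite ctrmxZ conj_alpha scaleNr opprK ctrmx_mul trmxCK.
rewrite ctrmxZ ctrmx_sum -scaleNr.
have -> : Num.conj ('i / 2 : K) = - ('i / 2).
  by rewrite rmorphM /= conjCi fmorphV rmorph_nat mulNr.
congr (_ *: _); apply: eq_bigr => a _.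
by rewrite ctrmxB !ctrmx_mul !trmxCK.
Qed.

Lemma moment_hermC A : (H A)^t* = H A.
Proof. by rewrite ctrmxZ shifted_moment_skew conjCi scalerN scaleNr opprK. Qed.

Definition rep_shift A B (t : R) : Rep R v := fun a => A a + (t%:C : K) *: B a.

Lemma arrow_shift A B t a : hat (rep_shift A B t) a = hat A a + (t%:C : K) *: hat B a.
Proof. by rewrite /vect_arrow /rep_shift mulmxDr mulmxDl -scalemxAr -scalemxAl. Qed.

Lemma commutator_shift n (X Y : 'M[K]_n) (t : R) :
  let Z := X + (t%:C : K) *: Y in
  Z *m Z^t* - Z^t* *m Z = (X *m X^t* - X^t* *m X) +
    (t%:C : K) *: ((X *m Y^t* + Y *m X^t*) - (X^t* *m Y + Y^t* *m X)) +
    ((t ^+ 2)%:C : K) *: (Y *m Y^t* - Y^t* *m Y).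
Proof.
rewrite /= ctrmxD ctrmxZ conj_real !mulmxDl !mulmxDr -!scalemxAl -!scalemxAr.
move: (X *m X^t*) (X^t* *m X) (X *m Y^t*) (Y *m X^t*) (X^t* *m Y) (Y^t* *m X)
  (Y *m Y^t*) (Y^t* *m Y) => a1 a2 a3 a4 a5 a6 a7 a8.
rewrite (_ : ((t ^+ 2)%:C : K) = (t%:C : K) * (t%:C : K)); last first.
  by rewrite -rmorphM.
by move: (t%:C : K) => c; apply/matrixP => i j; rewrite !mxE; ring.
Qed.

(** The differential of the moment map at A in the direction B. *)
Definition moment_diff A B : 'M[K]_(vect_dim v) := ('i / 2) *:
  \sum_a ((hat A a *m (hat B a)^t* + hat B a *m (hat A a)^t*) -
          ((hat A a)^t* *m hat B a + (hat B a)^t* *m hat A a)).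

Lemma moment_map_shift A B t : moment_map (rep_shift A B t) =
  moment_map A + (t%:C : K) *: moment_diff A B + ((t ^+ 2)%:C : K) *: moment_map B.
Proof.
apply: etrans (scale_split _ _ _ _ _ _); congr (_ *: _).
rewrite !scaler_sumr -!big_split /=; apply: eq_bigr => a _.
by rewrite arrow_shift; apply: commutator_shift.
Qed.

Lemma shifted_moment_shift A B t : shifted_moment alpha (rep_shift A B t) =
  shifted_moment alpha A + (t%:C : K) *: moment_diff A B +
    ((t ^+ 2)%:C : K) *: moment_map B.
Proof. by rewrite /shifted_moment moment_map_shift; exact: sub_addACA. Qed.

Lemma critical_moment_diff A B : critical_point alpha A ->
  rdot (shifted_moment alpha A) (moment_diff A B) = 0.
Proof.
move=> /(_ B) h; apply: (quadratic_derive0 (L2 := moment_map B)).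
have -> : (fun t : R => rdot (shifted_moment alpha A + (t%:C : K) *: moment_diff A B +
      ((t ^+ 2)%:C : K) *: moment_map B) (shifted_moment alpha A +
      (t%:C : K) *: moment_diff A B + ((t ^+ 2)%:C : K) *: moment_map B)) =
    (fun t => energy alpha (rep_shift A B t)).
  by apply/funext => t; rewrite -shifted_moment_shift.
exact: h.
Qed.

(** Take for direction B the infinitesimal action of H on A: the derivative of
    the energy is then a negative multiple of the sum of the squared norms of
    the commutators of H with the arrows. *)
Lemma critical_commute A a : critical_point alpha A ->
  H A *m hat A a = hat A a *m H A.
Proof.
move=> crit.
(* The commutator of H with an arrow is again supported between the two
   vertices, so it comes from a representation B. *)
pose B : Rep R v := fun a => (inj (qin a))^t* *m (H A *m hat A a - hat A a *m H A) *m
  inj (qout a).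
have hB b : hat B b = H A *m hat A b - hat A b *m H A.
  have -> : hat B b = Pi (qin b) *m (H A *m hat A b - hat A b *m H A) *m Pi (qout b).
    by rewrite /vect_arrow /vproj /B !mulmxA.
  exact: proj_commutator (vproj_herm _ _) (vproj_herm _ _) (vproj_arrow_in _ _)
    (arrow_vproj_out _ _).
have := critical_moment_diff B crit.
rewrite /rdot shifted_moment_skew /moment_diff mulNmx -scalemxAr mulmx_sumr.
rewrite linearN /= mxtraceZ raddf_sum /=.
have -> : \sum_b \tr (shifted_moment alpha A *m
    ((hat A b *m (hat B b)^t* + hat B b *m (hat A b)^t*) -
          ((hat A b)^t* *m hat B b + (hat B b)^t* *m hat A b))) =
    - ('i * 2) * \sum_b \tr (hat B b *m (hat B b)^t*).
  rewrite mulr_sumr; apply: eq_bigr => b _; rewrite hB.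
  exact: commutator_trace (moment_hermC A) erefl erefl.
set T := fun b => \tr (hat B b *m (hat B b)^t*) : K.
rewrite (i_cancel (\sum_b T b)) ReN => /eqP; rewrite oppr_eq0 => /eqP ReT.
have T0 b : 0 <= T b by apply: tr_ctrmx_ge0.
have : \sum_b T b = 0 by apply: ge0_Re_eq0 ReT; apply: sumr_ge0.
move=> /eqP; rewrite psumr_eq0 // => /allP/(_ a); rewrite mem_index_enum => /(_ isT).
move=> /eqP/tr_ctrmx_eq0; rewrite hB => /eqP; rewrite subr_eq0 => /eqP.
exact.
Qed.

(** As H commutes with the projectors on the summands V_l, it is block
    diagonal, with these blocks. *)
Definition vblock A l : 'M[K]_(v l) := (inj l)^t* *m H A *m inj l.

Lemma herm_inj A l : H A *m inj l = inj l *m vblock A l.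
Proof. exact: compress_comm (vect_inj_iso l) (vproj_herm A l). Qed.

Lemma vblock_herm A l : (vblock A l)^t* = vblock A l.
Proof. by rewrite /vblock !ctrmx_mul trmxCK moment_hermC mulmxA. Qed.

Lemma critical_vblock A a : critical_point alpha A ->
  vblock A (qin a) *m A a = A a *m vblock A (qout a).
Proof.
move=> crit; have h := critical_commute a crit.
exact: compress_arrow (vect_inj_iso _) (vect_inj_iso _) (herm_inj _ _) (herm_inj _ _) h.
Qed.

Lemma mem_eigenspace_vblock A z l x :
  (x \in moment_eigenspace alpha A z l) = (vblock A l *m x == z *: x).
Proof.
have hi : H A *m (inj l *m x) = inj l *m (vblock A l *m x).
  by rewrite mulmxA herm_inj mulmxA.
apply/idP/eqP => [/mem_moment_eigenspace|] e; last first.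
  by apply/mem_moment_eigenspace; rewrite -/(H A) hi e scalemxAr.
have : inj l *m (vblock A l *m x) = inj l *m (z *: x) by rewrite -hi -scalemxAr.
by move=> /(congr1 (mulmx ((inj l)^t*))); rewrite !mulmxA vect_inj_iso !mul1mx.
Qed.

End CriticalPoints.

(** * The degree of a subrepresentation *)

Section ProjectorTraces.
Variable C : numClosedFieldType.

Lemma orth_proj_compl n (P : 'M[C]_n) : orth_proj P -> orth_proj (1%:M - P).
Proof.
move=> [PC PP]; split; first by rewrite ctrmxB PC trmx1 map_mx1.
by rewrite mulmxBl mul1mx mulmxBr mulmx1 PP subrr subr0.
Qed.

Lemma tr_orth_proj m n (X : 'M[C]_(m, n)) (P : 'M[C]_n) : orth_proj P ->
  \tr ((X *m P) *m (X *m P)^t*) = \tr (X *m P *m X^t*).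
Proof.
by move=> [PC PP]; rewrite ctrmx_mul PC mulmxA -[X *m P *m P]mulmxA PP.
Qed.

Lemma tr_proj_mul_ge0 n (P Q : 'M[C]_n) : orth_proj P -> orth_proj Q ->
  0 <= \tr (P *m Q).
Proof.
move=> oP oQ; have [PC PP] := oP.
have -> : \tr (P *m Q) = \tr ((P *m Q) *m (P *m Q)^t*).
  by rewrite tr_orth_proj // PC [RHS]mxtrace_mulC mulmxA PP.
exact: tr_ctrmx_ge0.
Qed.

Lemma tr_proj_mul_le n (P Q : 'M[C]_n) : orth_proj P -> orth_proj Q ->
  \tr (P *m Q) <= \tr Q.
Proof.
move=> oP oQ; rewrite -subr_ge0 -raddfB /= -{1}[Q]mul1mx -mulmxBl.
by apply: tr_proj_mul_ge0 => //; apply: orth_proj_compl.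
Qed.

(** The difference is the squared norm of the component of A from the
    complement of the image of Q to the image of P: the second fundamental
    form of the subrepresentation. *)
Lemma tr_invariant_ge0 m n (P : 'M[C]_m) (Q : 'M[C]_n) (A : 'M[C]_(m, n)) :
  orth_proj P -> orth_proj Q -> P *m (A *m Q) = A *m Q ->
  0 <= \tr (P *m (A *m A^t*)) - \tr (Q *m (A^t* *m A)).
Proof.
move=> oP oQ inv; have [PC PP] := oP; pose B := P *m A.
have e1 : \tr (P *m (A *m A^t*)) = \tr (B *m B^t*).
  by rewrite /B ctrmx_mul PC [in RHS]mulmxA [RHS]mxtrace_mulC !mulmxA PP.
have e2 : \tr (Q *m (A^t* *m A)) = \tr (B *m Q *m B^t*).
  rewrite /B -[P *m A *m Q]mulmxA inv ctrmx_mul PC.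
  transitivity (\tr (A *m Q *m A^t*)).
    by rewrite [LHS]mxtrace_mulC [RHS]mxtrace_mulC mulmxA.
  by rewrite mulmxA [RHS]mxtrace_mulC !mulmxA -(mulmxA P) inv.
rewrite e1 e2 -raddfB /= -mulmxBl -{1}[B]mulmx1 -mulmxBr.
by rewrite -(tr_orth_proj B (orth_proj_compl oQ)); apply: tr_ctrmx_ge0.
Qed.

Lemma tr_commute_eq0 m n (P : 'M[C]_m) (Q : 'M[C]_n) (A : 'M[C]_(m, n)) :
  P *m A = A *m Q -> \tr (P *m (A *m A^t*)) - \tr (Q *m (A^t* *m A)) = 0.
Proof.
move=> PA; apply/eqP; rewrite subr_eq0; apply/eqP.
by rewrite mulmxA PA -mulmxA [LHS]mxtrace_mulC -mulmxA.
Qed.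

Lemma i_split (S D : C) : 'i * S = - ('i * ('i / 2 * D - S)) - 2^-1 * D.
Proof.
have i2 : ('i : C) * 'i = - 1 by rewrite -expr2 sqrCi.
rewrite mulrBr !mulrA i2 mulN1r opprB mulNr opprK -addrA subrr addr0.
by [].
Qed.

End ProjectorTraces.

Lemma Re_sum (R : realType) (I : Type) (r : seq I) (P : pred I) (f : I -> Cplx R) :
  complex.Re (\sum_(i <- r | P i) f i) = \sum_(i <- r | P i) complex.Re (f i).
Proof. by elim/big_rec2: _ => [|i x y _ <-] //; rewrite ReD. Qed.

Lemma Re_mulrn (R : realType) (x : Cplx R) (n : nat) :
  complex.Re (x * n%:R) = complex.Re x * n%:R.
Proof.
rewrite mulrC [RHS]mulrC -ReM_real; congr (complex.Re (_ * _)).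
by rewrite rmorph_nat.
Qed.

Section Degree.
Variables (R : realType) (Q : quiver) (v : dimvec Q) (alpha : vertex Q -> Cplx R).
Local Notation K := (Cplx R).
Local Notation inj l := (vect_inj R v l).
Local Notation hat A a := (@vect_arrow R Q v A a).
Local Notation vblock := (vblock alpha).
Implicit Types (A B : Rep R v).

Definition vect_sum (P : forall l, 'M[K]_(v l)) : 'M[K]_(vect_dim v) :=
  \sum_l inj l *m P l *m (inj l)^t*.

Lemma vect_sum_inj P m : vect_sum P *m inj m = inj m *m P m.
Proof.
rewrite /vect_sum mulmx_suml (bigD1 m) //= big1 => [|l lm].
  by rewrite -mulmxA vect_inj_iso mulmx1 addr0.
by rewrite -mulmxA vect_inj_orth // mulmx0.
Qed.

Lemma tr_compress n m (J : 'M[K]_(n, m)) (M : 'M[K]_m) : J^t* *m J = 1%:M ->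
  \tr (J *m M *m J^t*) = \tr M.
Proof. by move=> iso; rewrite mxtrace_mulC mulmxA iso mul1mx. Qed.

Lemma tr_vect_sum_arrow P A a :
  \tr (vect_sum P *m (hat A a *m (hat A a)^t*)) = \tr (P (qin a) *m (A a *m (A a)^t*)).
Proof.
rewrite -[RHS](tr_compress _ (vect_inj_iso R v (qin a))); congr (\tr _).
rewrite /vect_arrow !ctrmx_mul trmxCK !mulmxA vect_sum_inj.
by rewrite -[_ *m (inj (qout a))^t* *m inj (qout a)]mulmxA vect_inj_iso mulmx1.
Qed.

Lemma tr_vect_sum_arrowC P A a :
  \tr (vect_sum P *m ((hat A a)^t* *m hat A a)) = \tr (P (qout a) *m ((A a)^t* *m A a)).
Proof.
rewrite -[RHS](tr_compress _ (vect_inj_iso R v (qout a))); congr (\tr _).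
rewrite /vect_arrow !ctrmx_mul trmxCK !mulmxA vect_sum_inj.
by rewrite -[_ *m (inj (qin a))^t* *m inj (qin a)]mulmxA vect_inj_iso mulmx1.
Qed.

Lemma tr_vect_sum_herm P A :
  \sum_l \tr (P l *m vblock A l) = \tr (vect_sum P *m moment_herm alpha A).
Proof.
rewrite /vect_sum mulmx_suml raddf_sum /=; apply: eq_bigr => l _.
by rewrite /vblock -!mulmxA [RHS]mxtrace_mulC -!mulmxA.
Qed.

Lemma tr_vect_sum_central P : \tr (vect_sum P *m central_mx v alpha) = \sum_l alpha l * \tr (P l).
Proof.
rewrite /central_mx mulmx_sumr raddf_sum /=; apply: eq_bigr => l _.
by rewrite -scalemxAr mxtraceZ mulmxA vect_sum_inj tr_compress // vect_inj_iso.
Qed.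

(** The contribution of the arrow a to the pairing of the moment map with
    P. *)
Definition arrow_defect (P : forall l, 'M[K]_(v l)) A a : K :=
  \tr (P (qin a) *m (A a *m (A a)^t*)) - \tr (P (qout a) *m ((A a)^t* *m A a)).

Lemma weighted_trace P A : \sum_l ('i * alpha l) * \tr (P l) =
  - \sum_l \tr (P l *m vblock A l) - 2^-1 * \sum_a arrow_defect P A a.
Proof.
rewrite tr_vect_sum_herm /moment_herm -scalemxAr mxtraceZ mulmxBr raddfB /= tr_vect_sum_central.
rewrite -scalemxAr mxtraceZ mulmx_sumr raddf_sum /=.
have -> : \sum_a \tr (vect_sum P *m (hat A a *m (hat A a)^t* - (hat A a)^t* *m hat A a)) =
    \sum_a arrow_defect P A a.
  by apply: eq_bigr => a _; rewrite mulmxBr raddfB /= tr_vect_sum_arrow tr_vect_sum_arrowC.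
rewrite (eq_bigr (fun l => 'i * (alpha l * \tr (P l)))); last by move=> l _; rewrite mulrA.
rewrite -mulr_sumr; exact: i_split.
Qed.

(** The degree of U as minus the trace of H on U, corrected by the
    contributions of the arrows, which are nonnegative when U is a
    subrepresentation. *)
Lemma theta0_trace A (P : forall l, 'M[K]_(v l)) (U : grsub R v) :
  (forall l, orth_proj (P l)) -> (forall l, colsp (P l) = U l) ->
  theta alpha 0 U = - \sum_l complex.Re (\tr (P l *m vblock A l)) -
    2^-1 * \sum_a complex.Re (arrow_defect P A a).
Proof.
move=> oP cP; have := congr1 (fun z : K => complex.Re z) (weighted_trace P A).
have eD : complex.Re (2^-1 * \sum_a arrow_defect P A a) =
    2^-1 * \sum_a complex.Re (arrow_defect P A a).
  rewrite -Re_sum -ReM_real; congr (complex.Re (_ * _)).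
  by rewrite fmorphV rmorph_nat.
rewrite /= ReD !ReN eD !Re_sum => <-; apply: eq_bigr => l _.
by rewrite subr0 (tr_idem (oP l).2) cP Re_mulrn.
Qed.

End Degree.

(** * Spectral projectors of a hermitian matrix *)

Section SpectralProjectors.
Variables (C : numClosedFieldType) (n : nat) (M : 'M[C]_n).
Hypothesis MC : M^t* = M.
Local Notation U := (spectralmx M).
Local Notation sp := (spectral_diag M).

Definition eigproj (z : C) : 'M[C]_n :=
  invmx U *m diag_mx (\row_i (sp 0 i == z)%:R) *m U.

Let Uu : U \in unitmx. Proof. exact: spectral_unit. Qed.

Let ME : M = invmx U *m diag_mx sp *m U.
Proof. by apply/orthomx_spectralP/normalmxP; rewrite MC. Qed.

Lemma conj_diagM (d d' : 'rV[C]_n) :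
  (invmx U *m diag_mx d *m U) *m (invmx U *m diag_mx d' *m U) =
  invmx U *m diag_mx (\row_i (d 0 i * d' 0 i)) *m U.
Proof. by rewrite -mulmx_diag !mulmxA mulmxK. Qed.

Lemma eigproj_orth z : orth_proj (eigproj z).
Proof.
split.
  have UV := invmx_unitary (spectral_unitarymx M).
  rewrite /eigproj !ctrmx_mul UV trmxCK mulmxA; congr (_ *m _ *m _).
  rewrite tr_diag_mx map_diag_mx; congr diag_mx.
  by apply/rowP => i; rewrite !mxE rmorph_nat.
rewrite /eigproj conj_diagM; congr (_ *m diag_mx _ *m _).
by apply/rowP => i; rewrite !mxE -natrM mulnb andbb.
Qed.

Lemma eigproj_orthogonal z z' : z != z' -> eigproj z *m eigproj z' = 0.
Proof.
move=> zz; rewrite /eigproj conj_diagM (_ : diag_mx _ = 0) ?mulmx0 ?mul0mx //.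
apply/matrixP => i j; rewrite !mxE -natrM mulnb.
by case: (sp 0 i =P z) => [->|//]; rewrite ?mul0rn // (negPf zz) mul0rn.
Qed.

Lemma mul_eigproj z : M *m eigproj z = z *: eigproj z.
Proof.
rewrite {1}ME /eigproj conj_diagM scalemxAl scalemxAr.
congr (_ *m _ *m _); apply/matrixP => i j; rewrite !mxE.
by case: (sp 0 i =P z) => [->|_]; rewrite ?mulr1 ?mulr0 ?mul0rn ?mulr0 // mulr_natr.
Qed.

Lemma mem_colsp_eigproj z x : (x \in colsp (eigproj z)) = (M *m x == z *: x).
Proof.
apply/idP/eqP => [/colspP[y ->]|Mx].
  by rewrite mulmxA mul_eigproj -scalemxAl.
apply/colspP; exists x.
have e : diag_mx sp *m (U *m x) = z *: (U *m x).
  by rewrite mulmxA -(mulKVmx Uu (diag_mx sp *m U)) (mulmxA (invmx U)) -ME -mulmxA Mx scalemxAr.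
rewrite /eigproj -!mulmxA; apply: (can_inj (mulKmx Uu)); rewrite mulKVmx //.
apply/colP => i; have := congr1 (fun y : 'cV[C]_n => y i 0) e.
rewrite !mul_diag_mx !mxE => e'.
case: eqP => [_|ne]; first by rewrite mul1r.
rewrite mul0r; apply/eqP; move/eqP: e'.
by rewrite -subr_eq0 -mulrBl mulf_eq0 subr_eq0 => /orP[/eqP|].
Qed.

Lemma spectral_eigen i : exists2 x : 'cV[C]_n, x != 0 & M *m x = sp 0 i *: x.
Proof.
exists (invmx U *m delta_mx i 0).
  apply/eqP => /(congr1 (mulmx U)); rewrite mulKVmx // mulmx0.
  by move=> /(congr1 (fun y : 'cV[C]_n => y i 0)) /eqP; rewrite !mxE !eqxx oner_eq0.
rewrite {1}ME -!mulmxA mulKVmx // scalemxAr; congr (_ *m _).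
apply/colP => k; rewrite mul_diag_mx !mxE.
by case: eqP => [->|]; rewrite /= ?mulr0.
Qed.

Lemma sum_eigproj (zs : seq C) : uniq zs -> (forall i, sp 0 i \in zs) ->
  \sum_(j < size zs) eigproj zs`_j = 1%:M.
Proof.
move=> uz spz; rewrite /eigproj -mulmx_suml -mulmx_sumr.
have -> : \sum_(j < size zs) diag_mx (\row_i (sp 0 i == zs`_j)%:R) = 1%:M :> 'M[C]_n.
  apply/matrixP => a b; rewrite summxE !mxE.
  have h : (index (sp 0%R a) zs < size zs)%N by rewrite index_mem.
  rewrite (bigD1 (Ordinal h)) //= big1 => [|j jn]; rewrite !mxE.
    by rewrite nth_index // eqxx addr0.
  case: eqP => [e|]; last by rewrite mul0rn.
  case/eqP: jn; apply: val_inj; rewrite /= e index_uniq //.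
by rewrite mulmx1 mulVmx.
Qed.

End SpectralProjectors.

(** * Critical points are of Harder-Narasimhan type *)

Lemma tr_sum (C : fieldType) n (I : Type) (r : seq I) (P : pred I) (M : I -> 'M[C]_n) :
  \tr (\sum_(i <- r | P i) M i) = \sum_(i <- r | P i) \tr (M i).
Proof. exact: raddf_sum. Qed.

Lemma orth_proj_sum (C : numClosedFieldType) n (I : finType) (E : I -> 'M[C]_n)
    (p : pred I) : (forall i, orth_proj (E i)) ->
  (forall i j, i != j -> E i *m E j = 0) -> orth_proj (\sum_(i | p i) E i).
Proof.
move=> oE oo; split.
  by rewrite ctrmx_sum; apply: eq_bigr => i _; case: (oE i).
rewrite mulmx_suml; apply: eq_bigr => i pi.
rewrite mulmx_sumr (bigD1 i) //= big1 ?addr0; first by case: (oE i).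
by move=> j /andP[_ ji]; rewrite oo // eq_sym.
Qed.

Lemma orth_sum_mul (C : numClosedFieldType) n (I : finType) (E : I -> 'M[C]_n)
    (p : pred I) k : (forall i, orth_proj (E i)) ->
  (forall i j, i != j -> E i *m E j = 0) ->
  (\sum_(i | p i) E i) *m E k = if p k then E k else 0.
Proof.
move=> oE oo; rewrite mulmx_suml; case: ifPn => pk.
  rewrite (bigD1 k) //= big1 ?addr0; first by case: (oE k).
  by move=> j /andP[_ jk]; rewrite oo.
by rewrite big1 // => i pi; rewrite oo //; apply: contraNneq pk => <-.
Qed.

Lemma Re_mul_ge0 (R : realType) (z t : Cplx R) : 0 <= t ->
  complex.Re (z * t) = complex.Re z * complex.Re t.
Proof.
case: z t => x y [a b]; rewrite lecE /= => /andP[/eqP-> _].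
by rewrite mulr0 subr0.
Qed.

Lemma Re_ge0 (R : realType) (t : Cplx R) : 0 <= t -> 0 <= complex.Re t.
Proof. by case: t => a b; rewrite lecE /= => /andP[]. Qed.

Lemma Re_nat (R : realType) (n : nat) : complex.Re (n%:R : Cplx R) = n%:R.
Proof. by rewrite -[n%:R]mul1r Re_mulrn /= mul1r. Qed.

Lemma intertwine_eigen (C : fieldType) m n p q (H : 'M[C]_m) (H' : 'M[C]_n)
    (A : 'M[C]_(m, n)) (E : 'M[C]_(n, p)) (z : C) (y : 'M[C]_(p, q)) :
  H *m A = A *m H' -> H' *m E = z *: E -> H *m (A *m E *m y) = z *: (A *m E *m y).
Proof. by move=> HA HE; rewrite !mulmxA HA -(mulmxA A) HE -scalemxAr -scalemxAl. Qed.

Section CriticalHN.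
Variables (R : realType) (Q : quiver) (v : dimvec Q) (alpha : vertex Q -> Cplx R).
Hypothesis alpha_im : forall l, complex.Re (alpha l) = 0.
Local Notation K := (Cplx R).
Variable A : Rep R v.
Hypothesis crit : critical_point alpha A.
Variable zs : seq K.
Hypothesis uz : uniq zs.
Hypothesis hz : forall z, (z \in zs) <-> (0 < rank_dim (eigen_dim alpha A z))%N.
Hypothesis hs : sorted (fun w w' => slope alpha w' < slope alpha w)
  (map (eigen_dim alpha A) zs).
Local Notation N := (size zs).
Local Notation vb l := (vblock alpha A l).

Definition eproj (i : 'I_N) l : 'M[K]_(v l) := eigproj (vb l) zs`_i.
Local Notation E := eproj.
Definition edim (i : 'I_N) l : nat := \dim (colsp (E i l)).

Lemma eproj_orth_proj i l : orth_proj (E i l).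
Proof. exact: eigproj_orth. Qed.

Lemma eproj_orthogonal l i j : i != j -> E i l *m E j l = 0.
Proof.
move=> ij; apply: eigproj_orthogonal.
by rewrite nth_uniq.
Qed.

Lemma moment_eigenspaceE z l : moment_eigenspace alpha A z l = colsp (eigproj (vb l) z).
Proof.
apply/vspaceP => x; rewrite mem_eigenspace_vblock //.
by rewrite (mem_colsp_eigproj (vblock_herm alpha_im A l)).
Qed.

Lemma eigen_dimE (i : 'I_N) l : eigen_dim alpha A zs`_i l = edim i l.
Proof. by rewrite ffunE moment_eigenspaceE. Qed.

Lemma sum_eproj l : \sum_i E i l = 1%:M.
Proof.
apply: sum_eigproj => // i; apply/hz; have [x x0 Mx] := spectral_eigen (vblock_herm alpha_im A l) i.
set z := spectral_diag _ _ _ in Mx *.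
have xE : x \in moment_eigenspace alpha A z l by rewrite mem_eigenspace_vblock // Mx.
rewrite /rank_dim (bigD1 l) //= ffunE; apply: ltn_addr.
rewrite lt0n dimv_eq0; apply: contraNneq x0 => e0.
by move: xE; rewrite e0 memv0.
Qed.

Lemma vblock_sum l : vb l = \sum_(i < N) zs`_i *: E i l.
Proof.
rewrite -[LHS]mulmx1 -(sum_eproj l) mulmx_sumr; apply: eq_bigr => i _.
exact: (mul_eigproj (vblock_herm alpha_im A l)).
Qed.

Lemma vblock_eproj i l : vb l *m E i l = zs`_i *: E i l.
Proof. exact: (mul_eigproj (vblock_herm alpha_im A l)). Qed.

Lemma eproj_invariant i a : E i (qin a) *m (A a *m E i (qout a)) = A a *m E i (qout a).
Proof.
have com := critical_vblock alpha_im a crit.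
apply: colsp_sub_idem; first by case: (eproj_orth_proj i (qin a)).
apply/subvP => _ /colspP[y ->]; rewrite (mem_colsp_eigproj (vblock_herm alpha_im A _)).
by apply/eqP; apply: intertwine_eigen com (vblock_eproj _ _).
Qed.

Lemma eproj_arrow i a : E i (qin a) *m A a = A a *m E i (qout a).
Proof.
rewrite -[LHS]mulmx1 -(sum_eproj (qout a)) mulmx_sumr (bigD1 i) //= big1 => [|j ji].
  by rewrite addr0 -mulmxA eproj_invariant.
by rewrite -mulmxA -eproj_invariant mulmxA eproj_orthogonal 1?eq_sym // mul0mx.
Qed.

Definition fproj p l : 'M[K]_(v l) := \sum_(i : 'I_N | (i < p)%N) E i l.
Definition eflag p : grsub R v := fun l => colsp (fproj p l).

Lemma fproj_orth_proj p l : orth_proj (fproj p l).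
Proof.
apply: orth_proj_sum => [i|i j]; [exact: eproj_orth_proj|exact: eproj_orthogonal].
Qed.

Lemma fproj_mul p i l : fproj p l *m E i l = if (i < p)%N then E i l else 0.
Proof.
by apply: orth_sum_mul => [j|j k]; [exact: eproj_orth_proj|exact: eproj_orthogonal].
Qed.

Lemma fproj_le p q l : (p <= q)%N -> fproj q l *m fproj p l = fproj p l.
Proof.
move=> pq; rewrite mulmx_sumr; apply: eq_bigr => i ip.
by rewrite fproj_mul (leq_trans ip pq).
Qed.

Lemma eflag_dim p l : \dim (eflag p l) = (\sum_(i : 'I_N | (i < p)%N) edim i l)%N.
Proof.
apply/eqP; rewrite -(eqr_nat K) -(tr_idem (fproj_orth_proj p l).2) tr_sum natr_sum.
by apply/eqP/eq_bigr => i _; rewrite (tr_idem (eproj_orth_proj i l).2).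
Qed.

Lemma eflag_quo j l : (j < N)%N ->
  (\dim (eflag j.+1 l) - \dim (eflag j l))%N = eigen_dim alpha A zs`_j l.
Proof.
move=> jN; rewrite !eflag_dim (eigen_dimE (Ordinal jN)) (bigD1 (Ordinal jN)) //=.
rewrite [X in (_ + X - _)%N](_ : _ = \sum_(i : 'I_N | (i < j)%N) edim i l)%N.
  by rewrite addnK.
by apply: eq_bigl => i; rewrite ltnS -val_eqE /= andbC -ltn_neqAle.
Qed.

Lemma eflag_filtration : filtration N eflag.
Proof.
split=> [l|l|j jN l].
- by apply/eqP; rewrite -dimv_eq0 eflag_dim big_pred0.
- rewrite /eflag (_ : fproj N l = 1%:M).
    by apply/vspaceP => x; rewrite memvf; apply/colspP; exists x; rewrite mul1mx.
  by rewrite -(sum_eproj l); apply: eq_bigl => i; rewrite ltn_ord.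
by rewrite /eflag -(fproj_le l (leqnSn j)); apply: colsp_mul.
Qed.

Lemma fproj_arrow p a : fproj p (qin a) *m A a = A a *m fproj p (qout a).
Proof.
by rewrite mulmx_suml mulmx_sumr; apply: eq_bigr => i _; apply: eproj_arrow.
Qed.

Lemma eflag_subrep p : subrep A (eflag p).
Proof.
by move=> a x /colspP[y ->]; rewrite mulmxA -fproj_arrow -mulmxA mem_colsp.
Qed.

Definition eigval (i : 'I_N) : R := complex.Re zs`_i.
(** The share of the i-th eigenspace in the image of P, a real number between
    0 and the multiplicity. *)
Definition proj_weight (P : forall l, 'M[K]_(v l)) (i : 'I_N) l : R :=
  complex.Re (\tr (P l *m E i l)).

Lemma proj_weight_ge0 P i l : orth_proj (P l) -> 0 <= proj_weight P i l.
Proof. by move=> oP; apply/Re_ge0/tr_proj_mul_ge0 => //; apply: eproj_orth_proj. Qed.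

Lemma proj_weight_le P i l : orth_proj (P l) -> proj_weight P i l <= (edim i l)%:R.
Proof.
move=> oP; rewrite -(Re_nat R) -(tr_idem (eproj_orth_proj i l).2) -subr_ge0 -ReN -ReD.
by apply/Re_ge0; rewrite subr_ge0; apply: tr_proj_mul_le => //; apply: eproj_orth_proj.
Qed.

Lemma proj_weight_full P i l : P l *m E i l = E i l -> proj_weight P i l = (edim i l)%:R.
Proof. by move=> e; rewrite /proj_weight e (tr_idem (eproj_orth_proj i l).2) Re_nat. Qed.

Lemma proj_weight_sum P l : orth_proj (P l) ->
  (\dim (colsp (P l)))%:R = \sum_i proj_weight P i l :> R.
Proof.
move=> oP; rewrite -(Re_nat R) -(tr_idem oP.2) -{1}[P l]mulmx1 -(sum_eproj l).
by rewrite mulmx_sumr tr_sum Re_sum.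
Qed.

Lemma theta_proj_weight (P : forall l, 'M[K]_(v l)) (Z : grsub R v) (j : 'I_N) :
  (forall l, orth_proj (P l)) -> (forall l, colsp (P l) = Z l) ->
  theta alpha (- eigval j) Z = - \sum_l \sum_i (eigval i - eigval j) * proj_weight P i l -
    2^-1 * \sum_a complex.Re (arrow_defect P A a).
Proof.
move=> oP cP; rewrite (theta_mu alpha (- eigval j) 0) (theta0_trace alpha A oP cP).
have -> : (grsub_rank Z)%:R = \sum_l \sum_i proj_weight P i l.
  rewrite /grsub_rank natr_sum; apply: eq_bigr => l _.
  by rewrite -(proj_weight_sum (oP l)) cP.
rewrite addrAC; congr (_ - _); rewrite sub0r opprK mulr_sumr -sumrN -sumrN -big_split /=.
apply: eq_bigr => l _; rewrite {1}vblock_sum mulmx_sumr tr_sum Re_sum.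
rewrite mulr_sumr -!sumrN -big_split /=; apply: eq_bigr => i _.
rewrite -scalemxAr mxtraceZ Re_mul_ge0; last first.
  by apply: tr_proj_mul_ge0 => //; apply: eproj_orth_proj.
by rewrite -/(proj_weight P i l) -/(eigval i); ring.
Qed.

Lemma theta_eflag p (j : 'I_N) : theta alpha (- eigval j) (eflag p) =
  - \sum_l \sum_(i : 'I_N | (i < p)%N) (eigval i - eigval j) * (edim i l)%:R.
Proof.
rewrite (theta_proj_weight j (fproj_orth_proj p) (fun l => erefl)).
rewrite [X in _ * X]big1 ?mulr0 ?subr0 => [|a _]; last first.
  by rewrite /arrow_defect tr_commute_eq0 //; apply: fproj_arrow.
congr (- _); apply: eq_bigr => l _; rewrite [RHS]big_mkcond; apply: eq_bigr => i _.
rewrite /proj_weight fproj_mul; case: ifP => _.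
  by rewrite (tr_idem (eproj_orth_proj i l).2) Re_nat.
by rewrite mxtrace0 mulr0.
Qed.

Lemma eflag_rank_lt (j : 'I_N) : (grsub_rank (eflag j) < grsub_rank (eflag j.+1))%N.
Proof.
have [_ _ fS] := eflag_filtration.
rewrite -subn_gt0 -(rank_quo (fS _ (ltn_ord j))).
have -> : quo_dim (eflag j) (eflag j.+1) = eigen_dim alpha A zs`_j.
  by apply/ffunP => l; rewrite ffunE eflag_quo.
by apply/hz; apply: mem_nth.
Qed.

Lemma theta_eflagS (j : 'I_N) :
  theta alpha (- eigval j) (eflag j.+1) = theta alpha (- eigval j) (eflag j).
Proof.
rewrite !theta_eflag; congr (- _); apply: eq_bigr => l _.
rewrite (bigD1 j) //= subrr mul0r add0r; apply: eq_bigl => i.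
by rewrite ltnS -val_eqE /= andbC -ltn_neqAle.
Qed.

(** The projectors on the terms j and j.+1 of the flag commute with A, so the
    arrows contribute nothing to their degrees, and these differ by the j-th
    eigenspace, on which H is the scalar eigval j. *)
Lemma slope_eigen (j : 'I_N) : slope alpha (eigen_dim alpha A zs`_j) = - eigval j.
Proof.
have [_ _ fS] := eflag_filtration.
have <- : quo_dim (eflag j) (eflag j.+1) = eigen_dim alpha A zs`_j.
  by apply/ffunP => l; rewrite ffunE eflag_quo.
have := theta_slope alpha (- eigval j) (fS _ (ltn_ord j)) (eflag_rank_lt j).
rewrite theta_eflagS subrr => /esym/eqP; rewrite mulf_eq0 subr_eq0 => /orP[/eqP//|].
by rewrite pnatr_eq0 subn_eq0 leqNgt eflag_rank_lt.
Qed.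

Lemma eigval_mono (i j : 'I_N) : (i < j)%N -> eigval i < eigval j.
Proof.
move=> ij; rewrite -ltrN2 -!slope_eigen.
have tr : transitive (fun w w' : dimvec Q => slope alpha w' < slope alpha w).
  by move=> x y z h1 h2; apply: lt_trans h2 h1.
have h := sorted_ltn_nth tr (eigen_dim alpha A 0) hs; have := h i j.
rewrite !inE !size_map !ltn_ord => /(_ isT isT ij).
by rewrite !(nth_map 0).
Qed.

(** Compared with the first j eigenspaces, a larger subrepresentation Z has
    theta smaller by the weights of the later eigenspaces, multiplied by the
    nonnegative differences of eigenvalues, and by the contributions of the
    arrows. Equality forces the weights beyond j to vanish, and those up to j
    are bounded by the multiplicities. *)
Lemma eflag_destab (j : 'I_N) : destab_max alpha A (- eigval j) (eflag j) (eflag j.+1).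
Proof.
split; [exact: eflag_rank_lt|exact: theta_eflagS|] => Z sZ jZ.
have [P [oP cP]] := orth_projfam_exists Z.
have full (i : 'I_N) l : (i < j)%N -> proj_weight P i l = (edim i l)%:R.
  move=> ij; apply: proj_weight_full; apply: colsp_sub_idem; first by case: (oP l).
  rewrite cP; apply: subv_trans (jZ l); rewrite /eflag.
  have -> : E i l = fproj j l *m E i l by rewrite fproj_mul ij.
  exact: colsp_mul.
have D0 : 0 <= \sum_a complex.Re (arrow_defect P A a).
  apply: sumr_ge0 => a _; apply/Re_ge0/tr_invariant_ge0 => //; try exact: oP.
  apply: colsp_sub_idem; first by case: (oP (qin a)).
  apply/subvP => _ /colspP[y ->]; rewrite -mulmxA cP; apply: sZ.
  by rewrite -cP mem_colsp.
have G0 l (i : 'I_N) : (j <= i)%N -> 0 <= (eigval i - eigval j) * proj_weight P i l.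
  rewrite leq_eqVlt => /orP[/eqP/val_inj->|ji]; first by rewrite subrr mul0r.
  by rewrite mulr_ge0 ?proj_weight_ge0 // subr_ge0 ltW // eigval_mono.
(* The first j eigenspaces lie in Z, so they have full weight and cancel. *)
have diff : theta alpha (- eigval j) Z - theta alpha (- eigval j) (eflag j) =
    - \sum_l \sum_(i : 'I_N | (j <= i)%N) (eigval i - eigval j) * proj_weight P i l -
    2^-1 * \sum_a complex.Re (arrow_defect P A a).
  rewrite (theta_proj_weight j oP cP) theta_eflag opprK addrAC; congr (_ - _).
  rewrite addrC -sumrB -sumrN; apply: eq_bigr => l _.
  rewrite [X in _ - X](bigID (fun i : 'I_N => (i < j)%N)) /= opprD addrA.
  rewrite -sumrB big1 => [|i ij]; last by rewrite full // subrr.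
  by rewrite add0r; congr (- _); apply: eq_bigl => i; rewrite -leqNgt.
have S0 : 0 <= \sum_l \sum_(i : 'I_N | (j <= i)%N) (eigval i - eigval j) * proj_weight P i l.
  by apply: sumr_ge0 => l _; apply: sumr_ge0 => i ji; apply: G0.
split; first by rewrite -subr_le0 diff; lra.
move=> e; have {e} e :
    \sum_l \sum_(i : 'I_N | (j <= i)%N) (eigval i - eigval j) * proj_weight P i l = 0.
  by apply/eqP; rewrite eq_le S0 andbT; move: diff; rewrite e subrr; lra.
have z0 l (i : 'I_N) : (j < i)%N -> proj_weight P i l = 0.
  move=> ji; move/eqP: e; rewrite psumr_eq0; last first.
    by move=> k _; apply: sumr_ge0 => i' ji'; apply: G0.
  move=> /allP/(_ l); rewrite mem_index_enum => /(_ isT) /=.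
  rewrite psumr_eq0; last by move=> i' ji'; apply: G0.
  move=> /allP/(_ i); rewrite mem_index_enum => /(_ isT) /=; rewrite (ltnW ji) /=.
  by rewrite mulf_eq0 subr_eq0 (gt_eqF (eigval_mono ji)) => /eqP.
rewrite -(ler_nat R) /grsub_rank !natr_sum; apply: ler_sum => l _.
rewrite -cP (proj_weight_sum (oP l)) eflag_dim natr_sum [leRHS]big_mkcond.
apply: ler_sum => i _; rewrite ltnS; case: leqP => ij; first exact: proj_weight_le.
by rewrite z0.
Qed.

Lemma critical_HN : HN_filtration alpha A N eflag.
Proof.
have fF := eflag_filtration; have [_ _ fS] := fF.
apply/HN_filtrationP; split; [exact: fF|move=> j _|move=> j jN].
  exact: eflag_subrep.
have h := eflag_destab (Ordinal jN).
by rewrite -(destab_max_slope (fS _ jN) h).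
Qed.

Lemma critical_in_stratum : HN_stratum alpha (map (eigen_dim alpha A) zs) A.
Proof.
exists eflag; rewrite size_map; split; last exact: critical_HN.
split; rewrite ?size_map; first exact: eflag_filtration.
apply: (@eq_from_nth _ [ffun=> 0%N]); rewrite !size_map ?size_iota // => j jN.
rewrite nth_mkseq // (nth_map 0) //; apply/ffunP => l.
by rewrite ffunE eflag_quo.
Qed.

End CriticalHN.

(** * The codimension of the stratum *)

(** The chart is built on the Harder-Narasimhan filtration of A itself, while
    the dimension count depends only on vs. *)
Lemma HN_stratum_codim (R : realType) (Q : quiver) (v : dimvec Q)
    (alpha : vertex Q -> Cplx R) vs (A : Rep R v) (G : nat -> grsub R v) :
  filtration_of_type vs G -> HN_stratum alpha vs A ->
  complex_codim_at (HN_stratum alpha vs) A (HN_codim (size vs) G).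
Proof.
move=> tG [F [tF hn]]; have [[F0 FL FS] _] := tF.
have h l : exists e : 'M[Cplx R]_(v l), e \in unitmx /\
    forall p, (p <= size vs)%N -> F p l = colsp (e *m (pid_mx (fdim F p l) : 'M[Cplx R]_(v l))).
  have [e eu eF] := @adapted_basis _ _ (size vs) (fun p => F p l) (FL l)
    (fun j jL => FS j jL l).
  by exists e; split; [exact: eu|exact: eF].
pose e l := projT1 (cid (h l)).
have eP l : e l \in unitmx /\ forall p, (p <= size vs)%N ->
    F p l = colsp (e l *m (pid_mx (fdim F p l) : 'M[Cplx R]_(v l))) := projT2 (cid (h l)).
exists (chart_dim (size vs) F); split; last exact: HN_codimE.
apply: (HN_stratum_submanifold tF (e := e)) hn => [l|p l pL]; first by case: (eP l).
by case: (eP l) => _; apply.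
Qed.

Theorem proposition6p5 (R : realType) (Q : quiver) (v : dimvec Q)
    (alpha : vertex Q -> Cplx R) (vs : seq (dimvec Q)) (F : nat -> grsub R v) :
  central_parameter v alpha ->
  @HN_stratum R Q v alpha vs !=set0 ->
  filtration_of_type vs F ->
  (forall A : Rep R v,
     HN_stratum_preserving alpha vs F A -> critical_point alpha A ->
     complex_codim_at (HN_stratum alpha vs) A (HN_codim (size vs) F)) /\
  (forall A : Rep R v,
     critical_set alpha vs A ->
     complex_codim_at (HN_stratum alpha vs) A (HN_codim (size vs) F)).
Proof.
move=> [alpha_im _] _ tF; split=> A.
  by move=> [SA _] _; apply: HN_stratum_codim.
move=> [crit [zs [uz hz evs hs]]]; apply: HN_stratum_codim => //.
by rewrite -evs; apply: critical_in_stratum => //; rewrite evs.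
Qed.
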